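(* Let $A:\Lambda\to\mathcal{M}^*$, $t\mapsto\underline A_t$, be a smooth family satisfying (A1)-(A2). Then for Lebesgue almost every $t\in\Lambda$ there exists $\sigma=\sigma(t)>0$ such that for $\eta_t$-a.e. $\hat v\in\mathbb{P}^1$ (with $v$ a unit representative), with respect to $\mu$, $$\frac{\log\|A_t^nv\|-n\,L_1(A_t)}{\sigma\sqrt n}\xrightarrow{d}\mathcal{N}(0,1),$$ and moreover $$\frac{\log\|A_t^n\|-n\,L_1(A_t)}{\sigma\sqrt n}\xrightarrow{d}\mathcal{N}(0,1).$$
   Context: Bernoulli setting: $\mathscr{A}=\{1,\dots,k\}=\mathscr{A}_{\mathrm{sing}}\sqcup\mathscr{A}_{\mathrm{inv}}$ both nonempty, $p_i>0$, $X=\mathscr{A}^{\mathbb{Z}}$, $\mu=p^{\mathbb{Z}}$. $\mathcal{M}^*$: tuples with $\mathrm{rank}A_i=1$ ($i\in\mathscr{A}_{\mathrm{sing}}$), $\det A_j>0$ ($j\in\mathscr{A}_{\mathrm{inv}}$), $\hat r_i\ne\hat k_j$ for $i,j\in\mathscr{A}_{\mathrm{sing}}$ ($r_i,k_i$ range and kernel of $A_i$). $\Lambda\subset\mathbb{R}$ compact interval of length 1; (A1) $A_t(i)\equiv A_i$ for $i\in\mathscr{A}_{\mathrm{sing}}$; (A2) there is $c_0>0$ with $\frac{A_t(j)v\wedge\frac{d}{dt}A_t(j)v}{\|A_t(j)v\|^2}\ge c_0$ for all $t\in\Lambda$, $j\in\mathscr{A}_{\mathrm{inv}}$, $\hat v$.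 $A_t^n=A_t^n(\omega)=A_t(\omega_n)\cdots A_t(\omega_1)$ as a random matrix on $(X,\mu)$; $L_1(A_t)=\lim_n\frac1n\log\|A_t^n(\omega)\|$ $\mu$-a.e. Projective action of rank one matrices: constant map to range. $\eta_t$ is the unique stationary probability of $\mathcal{Q}_t\psi(\hat v)=\sum_ip_i\psi(\hat A_t(i)\hat v)$, i.e. $\eta_t=\sum_{s\in\mathscr{A}_{\mathrm{sing}}}p_s\sum_{n\ge0}\sum_{\underline\omega\in\mathscr{A}_{\mathrm{inv}}^n}p(\underline\omega)\delta_{\hat A_t^n(\underline\omega)\hat r_s}$. *)

(* Defs.v *)
From HB Require Import structures.
From mathcomp Require Import all_boot all_order all_algebra.
From mathcomp Require Import all_classical all_reals all_analysis.
Set Implicit Arguments. Unset Strict Implicit. Unset Printing Implicit Defensive.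
Import Order.TTheory GRing.Theory Num.Theory.
Import numFieldNormedType.Exports.
Local Open Scope classical_set_scope.
Local Open Scope ring_scope.

Section Defs.
Variable R : realType.

Definition vnorm (v : 'cV[R]_2) : R := Num.sqrt (v 0 0 ^+ 2 + v 1 0 ^+ 2).

Definition opnorm (M : 'M[R]_2) : R :=
  sup [set vnorm (M *m v) | v in [set v : 'cV[R]_2 | vnorm v = 1]].

Definition wedge (u w : 'cV[R]_2) : R := u 0 0 * w 1 0 - u 1 0 * w 0 0.

Variable k : nat.

Definition word_prod (A : R -> 'I_k -> 'M[R]_2) (t : R) (w : seq 'I_k) : 'M[R]_2 :=
  foldl (fun M i => A t i *m M) 1%:M w.

(* the random product A_t^n(omega) = A_t(xi_{n-1} omega) ... A_t(xi_0 omega),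
   i.e. omega_j is read as xi_(j-1) omega *)
Definition rand_prod (T : Type) (A : R -> 'I_k -> 'M[R]_2) (t : R)
    (xi : nat -> T -> 'I_k) (n : nat) (om : T) : 'M[R]_2 :=
  word_prod A t [seq xi i om | i <- iota 0 n].

Definition dA (A : R -> 'I_k -> 'M[R]_2) (t : R) (i : 'I_k) : 'M[R]_2 :=
  \matrix_(r, c) derive1 (fun s => A s i r c) t.

Definition in_Mstar (sing : {set 'I_k}) (B : 'I_k -> 'M[R]_2) : Prop :=
  [/\ (forall i, i \in sing -> \rank (B i) = 1%N),
      (forall j, j \notin sing -> 0 < \det (B j)) &
      (* range of B i (column space = row space of (B i)^T) differs from
         kernel of B j ({v | B j v = 0} = row kernel of (B j)^T) *)
      (forall i j, i \in sing -> j \in sing ->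
         ~~ ((B i)^T == kermx ((B j)^T))%MS)].

Definition smooth_family (A : R -> 'I_k -> 'M[R]_2) (a : R) : Prop :=
  exists U : set R, [/\ open U, `[a, a + 1] `<=` U &
    forall i r c (m : nat) t, U t ->
      derivable (derive1n m (fun s => A s i r c)) t 1].

Definition Phi (x : R) : R := fine (normal_prob 0 1 `]-oo, x]).

Section Prob.
Context (d : measure_display) (T : measurableType d) (P : probability T R).

Definition iid_law (xi : nat -> T -> 'I_k) (p : 'I_k -> R) : Prop :=
  (forall n a, measurable [set om | xi n om = a]) /\
  (forall w : seq 'I_k,
    P [set om | forall i, (i < size w)%N -> xi i om = nth (xi 0%N om) w i]
      = (\prod_(i <- w) p i)%:E)%E.

Definition cvg_dist_std_normal (X : nat -> T -> R) : Prop :=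
  forall x : R,
    (fun n => fine (P [set om | X n om <= x])) @ \oo --> Phi x.
End Prob.

End Defs.

(* Main.v *)
(* At a singular letter [s] the direction is reset to the range of [A_s = r_s l_s].  Cutting the
   random word at the occurrences of a fixed singular letter [s0], [log |A_t^n r_s0|] becomes a sum
   of i.i.d. blocks [log |l_s0 A_t(u) r_s0|], where [u] avoids [s0] and has geometric length.

   By (A2) the direction of [A_t(w) x] rotates with positive speed in [t], so that the set of
   parameters with [|l A_t(w) x| < eps] has measure at most [E^|w| eps].  With [eps = eta beta^|w|]
   this is summable over all words, hence for almost every [t] every block is bounded by a constant
   times its length, and has exponential moments.

   The law of large numbers follows from exponential moments and Borel-Cantelli.  The central limit
   theorem follows from Lindeberg's method with the explicit heat function [Phi (- x / sqrt tau)],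
   smoothing the indicator by a Gaussian of variance [delta n] and letting [delta] tend to 0.

   If the variance vanished, [|l_s0 A_t(j)^n r_s0|] would be geometric in [n] for an invertible
   letter [j]; then one of [r /\ A r], [r /\ A^2 r], [l A (ker l)] would be 0 for [A = A_t(j)], which
   by the same rotation estimate happens only on a null set of parameters. *)
Require Import Defs.
From HB Require Import structures.
From mathcomp Require Import all_boot all_order all_algebra.
From mathcomp Require Import all_classical all_reals all_analysis.
From mathcomp Require Import ring lra.
Set Implicit Arguments. Unset Strict Implicit. Unset Printing Implicit Defensive.
Import Order.TTheory GRing.Theory Num.Theory.
Import numFieldNormedType.Exports.
Local Open Scope classical_set_scope.
Local Open Scope ring_scope.

(** * Sums over words and the decomposition at a marked letter *)

Section WordSums.
Context {R : realType} {I : finType}.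
Implicit Types (q : I -> R) (f g : seq I -> R).

(** Probability is confined to finite weighted sums over words; measurable events enter only when
    the limits are transferred to [P]. The functionals [log |A_t^n v|], [log ||A_t^n||] and
    [log |A_t^n r_s0|] differ only up to the first [s0]: afterwards each is a number fixed by that
    prefix plus the same functional of the rest. This exact splitting gives one [L] and one [sigma]
    for all starting directions and for the norm. A block avoids [s0] but may contain other singular
    letters, so its size is a product of factors [|l_s' A_t(w) r_s|] with [w] invertible; hence the
    parameter estimate is needed for all pairs of singular letters. For the empty word this factor
    does not move with [t], and there the transversality of ranges and kernels is what keeps it away
    from 0. Since the sums are centred by [n L] and not by a multiple of the number of blocks, the
    relevant block variable is its value minus [L] times its length; [sigma ^+ 2] is the variance of
    that variable divided by the mean block length. *)

Fixpoint wsum q n f : R :=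
  if n is m.+1 then \sum_i q i * wsum q m (fun w => f (i :: w)) else f [::].

(** Restricting to letters of nonzero weight matters for the weight [avoid] below: only words
    without [s0] then have to be compared. *)
Lemma eq_wsum q n f g :
  (forall w, size w = n -> all (fun i => q i != 0) w -> f w = g w) ->
  wsum q n f = wsum q n g.
Proof.
elim: n f g => [|n IH] f g fg /=; first exact: fg.
apply: eq_bigr => i _; have [->|qi] := eqVneq (q i) 0; first by rewrite !mul0r.
by congr (_ * _); apply: IH => w wn qw; apply: fg => /=; rewrite ?wn ?qi.
Qed.

Lemma wsumD q n f g : wsum q n (fun w => f w + g w) = wsum q n f + wsum q n g.
Proof.
elim: n f g => [//|n IH] f g /=; rewrite -big_split /=.
by apply: eq_bigr => i _; rewrite IH mulrDr.
Qed.

Lemma wsumZ q n c f : wsum q n (fun w => c * f w) = c * wsum q n f.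
Proof.
elim: n f => [//|n IH] f /=; rewrite mulr_sumr.
by apply: eq_bigr => i _; rewrite IH mulrCA.
Qed.

Lemma wsum_cst q n c : wsum q n (fun=> c) = (\sum_i q i) ^+ n * c.
Proof.
elim: n => [|n IH] /=; first by rewrite expr0 mul1r.
by rewrite -mulr_suml IH exprS mulrA.
Qed.

Section nonneg.
Variable q : I -> R.
Hypothesis q_ge0 : forall i, 0 <= q i.

Lemma ler_wsum n f g :
  (forall w, size w = n -> all (fun i => q i != 0) w -> f w <= g w) ->
  wsum q n f <= wsum q n g.
Proof.
elim: n f g => [|n IH] f g fg /=; first exact: fg.
apply: ler_sum => i _; have [->|qi] := eqVneq (q i) 0; first by rewrite !mul0r.
by apply: ler_wpM2l => //; apply: IH => w wn qw; apply: fg => /=; rewrite ?wn ?qi.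
Qed.

Lemma wsum_ge0 n f :
  (forall w, size w = n -> all (fun i => q i != 0) w -> 0 <= f w) -> 0 <= wsum q n f.
Proof. by move=> f0; rewrite -[leLHS](mulr0 ((\sum_i q i) ^+ n)) -wsum_cst ler_wsum. Qed.

Lemma ler_norm_wsum n f g :
  (forall w, size w = n -> all (fun i => q i != 0) w -> `|f w| <= g w) ->
  `|wsum q n f| <= wsum q n g.
Proof.
move=> fg; rewrite ler_norml -mulN1r -wsumZ; apply/andP; split.
  by apply: ler_wsum => w wn qw; rewrite mulN1r lerNl (le_trans _ (fg w wn qw))// -normrN ler_norm.
by apply: ler_wsum => w wn qw; rewrite (le_trans _ (fg w wn qw))// ler_norm.
Qed.

End nonneg.

Section first_occurrence.
Variables (p : I -> R) (s0 : I).

(** A sub-probability on the same alphabet: words without [s0] need no subtype, and the lost mass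
    [p s0] per letter is the source of all exponential decay. *)
Definition avoid i : R := if i == s0 then 0 else p i.

Lemma avoid_self : avoid s0 = 0. Proof. by rewrite /avoid eqxx. Qed.

Lemma avoid_neq i : i != s0 -> avoid i = p i.
Proof. by rewrite /avoid => /negPf ->. Qed.

Lemma wsum_first_occurrence m f :
  wsum p m f = \sum_(j < m) p s0 * wsum avoid j (fun u =>
    wsum p (m - j.+1) (fun w => f (u ++ s0 :: w))) + wsum avoid m f.
Proof.
elim: m f => [|m IH] f; first by rewrite big_ord0 add0r.
rewrite big_ord_recl /= subn1 /= (bigD1 s0) //= -addrA; congr (_ + _).
rewrite [X in _ = _ + X](bigD1 s0) //= avoid_self mul0r add0r.
have E i : i != s0 -> p i * wsum p m (fun w => f (i :: w)) =
  \sum_(j < m) p s0 * (avoid i * wsum avoid j (fun u =>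
    wsum p (m - j.+1) (fun w => f (i :: u ++ s0 :: w))))
   + avoid i * wsum avoid m (fun w => f (i :: w)).
  move=> i0; rewrite IH mulrDr (avoid_neq i0); congr (_ + _).
  by rewrite mulr_sumr; apply: eq_bigr => j _; rewrite mulrCA.
rewrite (eq_bigr _ E) big_split exchange_big /=; congr (_ + _).
apply: eq_bigr => j _; rewrite -mulr_sumr; congr (_ * _).
rewrite [RHS](bigD1 s0) //= avoid_self mul0r add0r.
by apply: eq_bigr => i _; rewrite /bump /= add1n subSS.
Qed.

(** Expectation over the first block [u s0], restricted to blocks that fit into [m] letters. The
    truncation keeps every sum finite; its effect is always measured by [decay p s0 ^+ m]. *)
Definition bsum m f : R := \sum_(j < m) p s0 * wsum avoid j f.

Lemma bsumD m f g : bsum m (fun u => f u + g u) = bsum m f + bsum m g.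
Proof. by rewrite /bsum -big_split; apply: eq_bigr => j _; rewrite wsumD mulrDr. Qed.

Lemma bsumZ m c f : bsum m (fun u => c * f u) = c * bsum m f.
Proof. by rewrite /bsum mulr_sumr; apply: eq_bigr => j _; rewrite wsumZ mulrCA. Qed.

Lemma bsumB m f g : bsum m (fun u => f u - g u) = bsum m f - bsum m g.
Proof.
rewrite -[X in _ = _ + X]mulN1r -bsumZ -bsumD; congr bsum; apply/funext => u.
by rewrite mulN1r.
Qed.

Hypothesis p_gt0 : forall i, 0 < p i.
Hypothesis p_sum1 : \sum_i p i = 1.

Lemma avoid_ge0 i : 0 <= avoid i.
Proof. by rewrite /avoid; case: ifP => // _; exact: ltW. Qed.

Lemma sum_avoid : \sum_i avoid i = 1 - p s0.
Proof.
rewrite (bigD1 s0) //= avoid_self add0r -p_sum1 [in RHS](bigD1 s0) //= [RHS]addrC addKr.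
by apply: eq_bigr => i /avoid_neq.
Qed.

Lemma avoid_all w : all (fun i => avoid i != 0) w = (s0 \notin w).
Proof.
elim: w => [//|i w IH] /=; rewrite IH inE negb_or; congr (_ && _).
have [<-|si] := eqVneq s0 i.
  by rewrite avoid_self eqxx.
rewrite eq_sym in si; by rewrite avoid_neq// gt_eqF.
Qed.

(* The fourth root leaves room for polynomial and exponential moments of the block length. *)
Definition decay : R := Num.sqrt (Num.sqrt (1 - p s0)).

Lemma onem_p_ge0 : 0 <= 1 - p s0.
Proof. by rewrite -sum_avoid sumr_ge0 // => i _; exact: avoid_ge0. Qed.

Lemma decayX4 : decay ^+ 4 = 1 - p s0.
Proof. by rewrite (exprM _ 2 2) sqr_sqrtr ?sqrtr_ge0// sqr_sqrtr ?onem_p_ge0. Qed.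

Lemma decay_ge0 : 0 <= decay.
Proof. exact: sqrtr_ge0. Qed.

Lemma decay_lt1 : decay < 1.
Proof.
rewrite -[ltRHS]sqrtr1 -[in ltRHS]sqrtr1 !ltr_sqrt ?ltrBlDr ?ltrDl //.
Qed.

Definition decay_bound : R := (1 - decay)^-1.

Lemma decay_bound_ge1 : 1 <= decay_bound.
Proof.
by rewrite /decay_bound invf_ge1 ?subr_gt0 ?decay_lt1// gerBl decay_ge0.
Qed.

Lemma geometric_sum_le m : \sum_(j < m) decay ^+ j <= decay_bound.
Proof.
have D : decay != 1 by rewrite lt_eqF// decay_lt1.
rewrite -(@ler_pM2l _ (1 - decay)) ?subr_gt0 ?decay_lt1//.
rewrite /decay_bound mulfV; last by rewrite subr_eq0 eq_sym.
by rewrite -opprB mulNr -subrX1 opprB gerBl exprn_ge0// decay_ge0.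
Qed.

(** The left side is [j + 1] copies of [decay ^+ j], each at most one of the first [j + 1] terms of
    the geometric series. *)
Lemma linear_decay_le j : (j.+1)%:R * decay ^+ j <= decay_bound.
Proof.
apply: le_trans (geometric_sum_le j.+1).
rewrite mulr_natl -[in leLHS](card_ord j.+1) -sumr_const.
apply: ler_sum => i _; apply: ler_wiXn2l; rewrite ?decay_ge0 ?(ltW decay_lt1)//.
by rewrite -ltnS.
Qed.

(** Of the four factors [decay ^+ j] contained in [(1 - p s0) ^+ j], three absorb one factor [j + 1]
    each and the last is kept as the rate. *)
Lemma poly_decay_le d j : (d <= 3)%N ->
  (j.+1)%:R ^+ d * (1 - p s0) ^+ j <= decay_bound ^+ 3 * decay ^+ j.
Proof.
move=> d3; apply: (@le_trans _ _ ((j.+1)%:R ^+ 3 * (1 - p s0) ^+ j)).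
  by apply: ler_wpM2r; rewrite ?exprn_ge0 ?onem_p_ge0// ler_weXn2l// ler1n.
rewrite -decayX4 -exprM mulnC exprM [X in _ * X]exprSr mulrA -exprMn.
apply: ler_wpM2r; first by rewrite exprn_ge0// decay_ge0.
by apply: lerXn2r; rewrite ?nnegrE ?mulr_ge0 ?exprn_ge0 ?decay_ge0 ?linear_decay_le//
  (le_trans ler01)// decay_bound_ge1.
Qed.

Lemma ler_wsum_avoid d C j f : (d <= 3)%N -> 0 <= C ->
  (forall u, size u = j -> s0 \notin u -> `|f u| <= C * (size u).+1%:R ^+ d) ->
  `|wsum avoid j f| <= C * decay_bound ^+ 3 * decay ^+ j.
Proof.
move=> d3 C0 fC; apply: (@le_trans _ _ (wsum avoid j (fun=> C * j.+1%:R ^+ d))).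
  apply: ler_norm_wsum; first exact: avoid_ge0.
  by move=> w wj; rewrite avoid_all => sw; rewrite -wj fC.
rewrite wsum_cst sum_avoid mulrCA -mulrA; apply: ler_wpM2l => //.
by rewrite mulrC poly_decay_le.
Qed.

Lemma p_le1 : p s0 <= 1.
Proof. by rewrite -subr_ge0 onem_p_ge0. Qed.

(** This produces the block moments as limits [l] of truncated sums. The explicit rate is essential:
    truncation errors at all lengths are later added up and must be summable. *)
Lemma bsum_approx d C f : (d <= 3)%N -> 0 <= C ->
  (forall u, s0 \notin u -> `|f u| <= C * (size u).+1%:R ^+ d) ->
  exists l K, 0 <= K /\ forall m, `|bsum m f - l| <= K * decay ^+ m.
Proof.
move=> d3 C0 fC; set B := C * decay_bound ^+ 3.
have B0 : 0 <= B by rewrite mulr_ge0// exprn_ge0// (le_trans ler01 decay_bound_ge1).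
have bj j : `|p s0 * wsum avoid j f| <= B * decay ^+ j.
  rewrite normrM gtr0_norm//; apply: le_trans (ler_wsum_avoid d3 C0 (fun u (_ : size u = j) => fC u)).
  by rewrite ler_piMl ?p_le1.
have step m j : `|bsum (m + j) f - bsum m f| <= B * decay_bound * decay ^+ m.
  have -> : bsum (m + j) f = bsum m f + \sum_(i < j) p s0 * wsum avoid (m + i) f.
    exact: big_split_ord.
  rewrite [X in `|X|]addrC addKr.
  apply: le_trans (ler_norm_sum _ _ _) _.
  apply: (@le_trans _ _ (\sum_(i < j) B * decay ^+ m * decay ^+ i)).
    by apply: ler_sum => i _; rewrite -mulrA -exprD bj.
  rewrite -mulr_sumr mulrAC; apply: ler_wpM2r; rewrite ?exprn_ge0 ?decay_ge0//.
  by apply: ler_wpM2l => //; exact: geometric_sum_le.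
set K := B * decay_bound in step.
have K0 : 0 <= K by rewrite mulr_ge0// (le_trans ler01 decay_bound_ge1).
have Kcvg : (fun m => K * decay ^+ m) @ \oo --> (0 : R).
  rewrite -(mulr0 K); apply: cvgM; first exact: cvg_cst.
  by apply: cvg_expr; rewrite ger0_norm ?decay_ge0 ?decay_lt1.
have bc : cvg ((fun m => bsum m f) @ \oo).
  apply: cauchy_cvg; apply/cauchyP => e e0.
  have : \forall m \near \oo, K * decay ^+ m < e.
    have := cvgr_lt (0 : R) Kcvg _ e0; exact.
  move=> [m _ /(_ m (leqnn m)) me]; exists (bsum m f).
  exists m => // n /= mn; rewrite /ball /= distrC -(subnKC mn).
  exact: le_lt_trans (step _ _) me.
exists (lim ((fun m => bsum m f) @ \oo)), K; split => // m.
rewrite distrC.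
have H : (fun n => `|bsum n f - bsum m f|) @ \oo -->
    `|lim ((fun n => bsum n f) @ \oo) - bsum m f|.
  by apply: cvg_norm; apply: cvgB => //; exact: cvg_cst.
have := cvgP _ H; move/cvg_lim: H => <- //; move=> Hc.
apply: limr_le => //; exists m => // n /= mn; rewrite -(subnKC mn); exact: step.
Qed.

Lemma geometric_sum_mono m n : (m <= n)%N ->
  \sum_(j < m) decay ^+ j <= \sum_(j < n) decay ^+ j.
Proof.
move=> /subnKC <-; rewrite big_split_ord /= lerDl sumr_ge0// => j _.
by rewrite exprn_ge0// decay_ge0.
Qed.

Lemma ler_norm_bsum m (f g : seq I -> R) :
  (forall u, (size u < m)%N -> s0 \notin u -> `|f u| <= g u) ->
  `|bsum m f| <= bsum m g.
Proof.
move=> fg; apply: le_trans (ler_norm_sum _ _ _) _; apply: ler_sum => j _.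
rewrite normrM gtr0_norm// ler_wpM2l//; first exact: ltW.
apply: ler_norm_wsum => [i|w wj]; first exact: avoid_ge0.
by rewrite avoid_all => sw; apply: fg => //; rewrite wj.
Qed.

Lemma eq_bsum m (f g : seq I -> R) :
  (forall u, (size u < m)%N -> s0 \notin u -> f u = g u) ->
  bsum m f = bsum m g.
Proof.
move=> fg; apply: eq_bigr => j _; congr (_ * _); apply: eq_wsum => w wj.
by rewrite avoid_all => sw; apply: fg => //; rewrite wj.
Qed.

Lemma bsum_pow_le m d : (d <= 3)%N ->
  `|bsum m (fun u => (size u).+1%:R ^+ d)| <= decay_bound ^+ 4.
Proof.
move=> d3; apply: le_trans (ler_norm_sum _ _ _) _.
apply: (@le_trans _ _ (\sum_(j < m) decay_bound ^+ 3 * decay ^+ j)).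
  apply: ler_sum => j _; rewrite normrM gtr0_norm//.
  have := @ler_wsum_avoid d 1 j (fun u => (size u).+1%:R ^+ d) d3 ler01.
  rewrite mul1r => H; apply: le_trans (H _).
    by rewrite ler_piMl// p_le1.
  by move=> u _ _; rewrite mul1r ger0_norm// exprn_ge0.
rewrite -mulr_sumr [decay_bound ^+ 4]exprSr ler_wpM2l//; first by rewrite exprn_ge0// (le_trans ler01 decay_bound_ge1).
exact: geometric_sum_le.
Qed.

(** The first-occurrence decomposition of a constant shows that the truncated block law has mass at
    most 1. Inductions over blocks therefore lose no factor. *)
Lemma bsum_cst_le m c : 0 <= c -> `|bsum m (fun=> c)| <= c.
Proof.
move=> c0; have := wsum_first_occurrence m (fun=> c).
rewrite wsum_cst p_sum1 expr1n mul1r => H.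
have E : bsum m (fun=> c) = c - wsum avoid m (fun=> c).
  apply/eqP; rewrite eq_sym subr_eq; apply/eqP; rewrite [LHS]H; congr (_ + _).
  apply: eq_bigr => j _; congr (_ * _).
  by apply: eq_wsum => w _ _; rewrite wsum_cst p_sum1 expr1n mul1r.
have h0 : 0 <= wsum avoid m (fun=> c).
  by apply: wsum_ge0 => //; exact: avoid_ge0.
have h1 : 0 <= bsum m (fun=> c).
  rewrite sumr_ge0// => j _; apply: mulr_ge0; first exact: ltW.
  by apply: wsum_ge0 => //; exact: avoid_ge0.
by rewrite ger0_norm// E gerBl.
Qed.

(** Renewal equation: [F n u] stands for the expectation over the [n] letters that remain once the
    first block is known to be [u s0]. *)
Lemma wsum_renewal m (f : seq I -> R) (F : nat -> seq I -> R) :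
  (forall u, s0 \notin u -> forall n, wsum p n (fun w => f (u ++ s0 :: w)) = F n u) ->
  wsum p m f = bsum m (fun u => F (m - (size u).+1)%N u) + wsum avoid m f.
Proof.
move=> fF; rewrite wsum_first_occurrence; congr (_ + _).
apply: eq_bigr => j _; congr (_ * _); apply: eq_wsum => u uj.
by rewrite avoid_all => su; rewrite fF// uj.
Qed.

End first_occurrence.
Lemma ler_norm_rcons (G : seq I -> R) (B : R) (u : seq I) (i : I) : 0 <= B ->
  (forall u, `|G u| <= B * (size u).+1%:R) -> `|G (rcons u i)| <= 2 * B * (size u).+1%:R.
Proof.
move=> B0 HG; apply: le_trans (HG _) _; rewrite size_rcons [2 * B]mulrC -mulrA.
by rewrite ler_wpM2l// -natrM ler_nat mul2n -addnn addSn ltnS leq_addl.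
Qed.

End WordSums.

(** * Mean value estimates *)

Section Derivatives.
Context {R : realType}.
Implicit Types (f g : R -> R) (x a b c : R).

Lemma is_derive1D f g x a b : is_derive x 1 f a -> is_derive x 1 g b ->
  is_derive x 1 (fun y => f y + g y) (a + b).
Proof. exact: is_deriveD. Qed.

Lemma is_derive1M f g x a b : is_derive x 1 f a -> is_derive x 1 g b ->
  is_derive x 1 (fun y => f y * g y) (a * g x + f x * b).
Proof.
move=> fa gb; apply: (is_derive_eq (is_deriveM fa gb)).
by rewrite addrC /GRing.scale/= mulrC.
Qed.

Lemma is_derive1_id x : is_derive x 1 (fun y : R => y) 1.
Proof. exact: is_derive_id. Qed.

Lemma is_derive1_cst c x : is_derive x 1 (fun _ : R => c) 0.
Proof. exact: is_derive_cst. Qed.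

Lemma is_derive1_chain f g x a b :
  is_derive x 1 g b -> is_derive (g x) 1 f a -> is_derive x 1 (fun y => f (g y)) (a * b).
Proof. by move=> gb fa; exact: is_derive1_comp. Qed.

End Derivatives.

Section MeanValue.
Context {R : realType}.

Lemma segment_between (c d x y z : R) : c <= x <= d -> c <= y <= d ->
  Num.min x y <= z <= Num.max x y -> c <= z <= d.
Proof.
rewrite ge_min le_max => /andP[? ?] /andP[? ?] /andP[/orP[] ? /orP[] ?].
all: by apply/andP; split; lra.
Qed.

Implicit Types (f df d2f d3f : R -> R) (a b x B : R).

Lemma is_derive_within f df a b :
  (forall x, a <= x <= b -> is_derive x 1 f (df x)) -> {within `[a, b], continuous f}.
Proof.
move=> fdf; apply: derivable_within_continuous => x; rewrite in_itv/= => /fdf H.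
exact: ex_derive.
Qed.

(** The endpoints are unordered because increments of either sign occur: space increments of a
    random sum and backward steps in time. *)
Lemma mvt_bound f df a b B :
  (forall x, Num.min a b <= x <= Num.max a b -> is_derive x 1 f (df x)) ->
  (forall x, Num.min a b <= x <= Num.max a b -> `|df x| <= B) ->
  `|f b - f a| <= B * `|b - a|.
Proof.
wlog ab : a b / a <= b.
  move=> H; have /orP[ab|ba] := le_total a b; first exact: (H _ _ ab).
  rewrite minC maxC (distrC (f b)) (distrC b); exact: (H _ _ ba).
rewrite (min_idPl ab) (max_idPr ab) => fdf dfB.
have [c|c cab ->] := @MVT_segment _ f df a b ab _ (is_derive_within fdf).
  by rewrite in_itv/= => /andP[/ltW ac /ltW cb]; apply: fdf; rewrite ac.
by rewrite normrM ler_wpM2r// dfB// -in_itv.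
Qed.

Let between a b x y : Num.min a b <= x <= Num.max a b ->
  Num.min a x <= y <= Num.max a x ->
  Num.min a b <= y <= Num.max a b /\ `|y - a| <= `|x - a| <= `|b - a|.
Proof.
have [ab|ba] := leP a b; have [ax|xa] := leP a x; move=> /andP[h1 h2] /andP[h3 h4];
  by split; try lra; apply/andP; split; case: ger0P => ?; case: ger0P => ?; lra.
Qed.

Let between_end a b : Num.min a b <= b <= Num.max a b.
Proof. by rewrite ge_min le_max !lexx !orbT. Qed.

(** The mean value bound is applied to [f] minus its linear part, then to [df]; the factor 1/2 of
    Taylor's formula is given up. *)
Lemma taylor1_bound f df d2f a b B :
  (forall x, Num.min a b <= x <= Num.max a b -> is_derive x 1 f (df x)) ->
  (forall x, Num.min a b <= x <= Num.max a b -> is_derive x 1 df (d2f x)) ->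
  (forall x, Num.min a b <= x <= Num.max a b -> `|d2f x| <= B) ->
  `|f b - f a - (b - a) * df a| <= B * `|b - a| ^+ 2.
Proof.
move=> fdf dfd2 d2B.
have -> : f b - f a - (b - a) * df a = (f b + b * - df a) - (f a + a * - df a) by ring.
rewrite expr2 mulrA.
apply: (mvt_bound (f := fun x => f x + x * - df a) (df := fun x => df x - df a)) => x xab.
  apply: (is_derive_eq (is_derive1D (fdf x xab)
    (is_derive1M (is_derive1_id x) (is_derive1_cst (- df a) x)))); ring.
have B0 : 0 <= B by rewrite (le_trans _ (d2B _ xab)).
apply: (@le_trans _ _ (B * `|x - a|)).
  by apply: (mvt_bound (df := d2f)) => y /(between xab)[yab _]; [exact: dfd2|exact: d2B].
by apply: ler_wpM2l => //; have [_ /andP[]] := between xab (between_end a x).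
Qed.

Lemma taylor2_bound f df d2f d3f a b B :
  (forall x, Num.min a b <= x <= Num.max a b -> is_derive x 1 f (df x)) ->
  (forall x, Num.min a b <= x <= Num.max a b -> is_derive x 1 df (d2f x)) ->
  (forall x, Num.min a b <= x <= Num.max a b -> is_derive x 1 d2f (d3f x)) ->
  (forall x, Num.min a b <= x <= Num.max a b -> `|d3f x| <= B) ->
  `|f b - f a - (b - a) * df a - (b - a) ^+ 2 / 2 * d2f a| <= B * `|b - a| ^+ 3.
Proof.
move=> fdf dfd2 d2d3 d3B; pose c := d2f a / 2.
have -> : f b - f a - (b - a) * df a - (b - a) ^+ 2 / 2 * d2f a =
  (f b + (b * - df a + (b - a) * (b - a) * - c))
  - (f a + (a * - df a + (a - a) * (a - a) * - c)) by rewrite /c; ring.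
rewrite exprSr mulrA.
apply: (mvt_bound (f := fun x => f x + (x * - df a + (x - a) * (x - a) * - c))
  (df := fun x => df x - df a - (x - a) * d2f a)) => x xab.
  have dxa : is_derive x 1 (fun y : R => y - a) 1.
    apply: (is_derive_eq (is_derive1D (is_derive1_id x) (is_derive1_cst (- a) x))).
    by rewrite addr0.
  apply: (is_derive_eq (is_derive1D (fdf x xab) (is_derive1D
    (is_derive1M (is_derive1_id x) (is_derive1_cst (- df a) x))
    (is_derive1M (is_derive1M dxa dxa) (is_derive1_cst (- c) x))))).
  by rewrite /c; field.
have B0 : 0 <= B by rewrite (le_trans _ (d3B _ xab)).
apply: (@le_trans _ _ (B * `|x - a| ^+ 2)).
  by apply: (taylor1_bound (d2f := d3f)) => y /(between xab)[yab _];
    [exact: dfd2|exact: d2d3|exact: d3B].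
apply: ler_wpM2l => //; have [_ /andP[_ h]] := between xab (between_end a x).
by apply: lerXn2r; rewrite ?nnegrE.
Qed.

End MeanValue.

(** * The Gaussian heat function *)

Section NormalCDF.
Context {R : realType}.
Implicit Types (x y : R).

Definition gden y : R := normal_peak 1 * expR (- (y ^+ 2 / 2)).

Lemma normal_pdf_gden y : normal_pdf 0 1 y = gden y.
Proof.
rewrite normal_pdfE ?oner_neq0// /normal_fun /gden subr0 expr1n.
by congr (_ * expR _); rewrite mulNr.
Qed.

Lemma is_derive_Phi x : is_derive x 1 (@Phi R) (gden x).
Proof.
have x1 : x < x + 1 by rewrite ltrDl.
have int : (@lebesgue_measure R).-integrable [set` Interval -oo%O (BRight (x + 1))]
    (EFin \o normal_pdf 0 1).
  apply: (integrableS measurableT) => //.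
  exact: integrable_normal_pdf.
have cf : {for x, continuous (@normal_pdf R 0 1)}.
  exact: continuous_normal_pdf (oner_neq0 R) x.
have [d1 d2] := continuous_FTC1 x1 int (ltNyr x) cf.
rewrite -normal_pdf_gden -d2 derive1E.
by apply: DeriveDef.
Qed.

Lemma Phi_ge0 x : 0 <= Phi x.
Proof. by rewrite fine_ge0. Qed.

Lemma Phi_le1 x : Phi x <= 1.
Proof.
rewrite -[leRHS]/(fine 1%E) fine_le ?fin_num_measure//.
exact: probability_le1.
Qed.

Lemma Phi_homo x y : x <= y -> Phi x <= Phi y.
Proof.
move=> xy; rewrite fine_le ?fin_num_measure//.
by rewrite le_measure ?inE//; exact: subitvPr.
Qed.

Let idR : measurableTypeR R -> R := idfun.

#[local] HB.instance Definition _ :=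
  @isMeasurableFun.Build _ _ _ _ idR (@measurable_id _ _ setT).

(** Under the normal law the identity is a random variable with distribution function [Phi], so both
    tails are the limits of a [cdf] at infinity. *)
Lemma Phi_tails (e : R) : 0 < e -> exists2 M : R, 0 < M &
  forall x, M <= x -> Phi (- x) < e /\ 1 - e < Phi x.
Proof.
move=> e0; pose X : {RV (@normal_prob R 0 1) >-> R} := idR.
have cdfE x : cdf X x = (Phi x)%:E.
  by rewrite /Phi fineK ?fin_num_measure.
have fE : fine \o cdf X = @Phi R by apply/funext => x; exact: (congr1 fine (cdfE x)).
have /fine_cvgP[_] := cvg_cdfy1 X; rewrite fE => H1.
have /fine_cvgP[_] := cvg_cdfNy0 X; rewrite fE => H0.
have [M1 [_ M1P]] := cvgr_gt (1 : R) H1 (1 - e) (ltac:(by rewrite gtrBl)).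
have [M0 [_ M0P]] := cvgr_lt (0 : R) H0 e e0.
exists (`|M1| + `|M0| + 1); first by rewrite addrC ltr_wpDr// addr_ge0.
move=> x Mx; split.
  by apply: M0P; rewrite ltrNl; apply: lt_le_trans Mx; have := ler_norm (- M0); have := normr_ge0 M1; rewrite normrN; lra.
by apply: M1P; apply: lt_le_trans Mx; have := ler_norm M1; have := normr_ge0 M0; lra.
Qed.


End NormalCDF.

Section HeatKernel.
Context {R : realType}.
Implicit Types (x y z t h : R).

(** [herm1], [herm2], [herm3] are minus the first three derivatives of [gden]. *)
Definition herm1 y : R := y * gden y.
Definition herm2 y : R := (1 - y ^+ 2) * gden y.
Definition herm3 y : R := (y ^+ 3 - 3 * y) * gden y.

Lemma is_derive1_scale (c x : R) : is_derive x 1 (fun y => y * c) c.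
Proof.
apply: (is_derive_eq (is_derive1M (is_derive1_id x) (is_derive1_cst c x))).
by rewrite mul1r mulr0 addr0.
Qed.

Lemma is_derive1_exp (n : nat) x : is_derive x 1 (fun y => y ^+ n) (n%:R * x ^+ n.-1).
Proof.
apply: DeriveDef; first exact: exprn_derivable.
by rewrite exp_derive /GRing.scale/= mulr1.
Qed.

Lemma is_derive_gden y : is_derive y 1 gden (- herm1 y).
Proof.
have d2 : is_derive y 1 (fun x => - (x ^+ 2 / 2)) (- y).
  have := is_derive1M (is_derive1_exp 2 y) (is_derive1_cst (- 2^-1) y).
  rewrite (_ : (fun y0 => y0 ^+ 2 * - 2^-1) = (fun x => - (x ^+ 2 / 2))); last first.
    by apply/funext => x; rewrite mulrN.
  by move=> H; apply: (is_derive_eq H); rewrite mulr0 addr0 expr1; field.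
have := is_derive1M (is_derive1_cst (normal_peak 1) y)
  (is_derive1_chain d2 (is_derive_expR (- (y ^+ 2 / 2)))).
by move=> H; apply: (is_derive_eq H); rewrite /herm1 /gden; ring.
Qed.

Lemma is_derive_herm1 y : is_derive y 1 herm1 (herm2 y).
Proof.
apply: (is_derive_eq (is_derive1M (is_derive1_id y) (is_derive_gden y))).
by rewrite /herm1 /herm2; ring.
Qed.

Lemma normal_peak1_le1 : @normal_peak R 1 <= 1.
Proof.
have p2 : 1 <= @pi R *+ 2 by have := pi_ge2 R; rewrite mulr2n; lra.
have p0 : 0 < @pi R *+ 2 by rewrite (lt_le_trans ltr01).
rewrite /normal_peak expr1n mul1r invf_le1; last by rewrite sqrtr_gt0.
by rewrite -[leLHS]sqrtr1 ler_sqrt// ltW.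
Qed.

Lemma gden_ge0 y : 0 <= gden y.
Proof. by rewrite mulr_ge0 ?normal_peak_ge0 ?expR_ge0. Qed.

Lemma gden_even y : gden (- y) = gden y.
Proof. by rewrite /gden sqrrN. Qed.

(** With [E = expR (y ^+ 2 / 2)], the bound [1 + (y ^+ 2 / 2) ^+ 2 / 2 <= E] gives
    [y ^+ 4 <= 8 * E], and 9 is 1 + 8. *)
Lemma quartic_gden_le y : (1 + y ^+ 4) * gden y <= 9.
Proof.
have y2 : 0 <= y ^+ 2 / 2 by rewrite mulr_ge0 ?sqr_ge0.
have e1 := expR_ge1Dxn 1 y2.
have e0 : 0 < expR (y ^+ 2 / 2) by exact: expR_gt0.
have c0 := @normal_peak_ge0 R 1; have c1 := normal_peak1_le1.
rewrite /gden expRN mulrCA.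
apply: (@le_trans _ _ ((1 + y ^+ 4) / expR (y ^+ 2 / 2))).
  rewrite ler_piMl// mulr_ge0 ?invr_ge0 ?(ltW e0)//.
  by rewrite addr_ge0// (exprM _ 2 2) sqr_ge0.
rewrite ler_pdivrMr//; move: e1; rewrite (_ : 2`!%:R = 2 :> R)// => e1.
have -> : y ^+ 4 = (y ^+ 2) ^+ 2 by rewrite -exprM.
have : 1 <= expR (y ^+ 2 / 2) by rewrite (le_trans _ e1)// lerDl mulr_ge0// exprn_ge0.
move: e1; set E := expR _; set u := y ^+ 2; clearbody u E => e1 e2; nra.
Qed.

(** Origin of the constant 36 = 4 * 9: every polynomial factor met below is at most
    [4 * (1 + y ^+ 4)]. *)
Let gden_bound (a : R) (y : R) : `|a| <= 4 * (1 + y ^+ 4) -> `|a * gden y| <= 36.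
Proof.
move=> ha; rewrite normrM (ger0_norm (gden_ge0 y)).
have := quartic_gden_le y; have := gden_ge0 y; move: ha.
by move: (gden y) (1 + y ^+ 4) (`|a|) => g q b; nra.
Qed.

Lemma gden_le y : `|gden y| <= 36.
Proof.
rewrite -[gden y]mul1r; apply: gden_bound; rewrite normr1.
by have := sqr_ge0 (y ^+ 2); rewrite -exprM; lra.
Qed.

Let quartic y : [/\ `|y| <= 1 + y ^+ 4, y ^+ 2 <= 1 + y ^+ 4 & 0 <= y ^+ 4].
Proof.
have -> : y ^+ 4 = (y ^+ 2) ^+ 2 by rewrite -exprM.
have := sqr_ge0 (y ^+ 2 - 1); have := sqr_ge0 (`|y| - 1); have := sqr_ge0 y.
rewrite -(real_normK (num_real y)) !sqrrB1 !mulr2n => h0 h1 h2; have := sqr_ge0 (`|y| ^+ 2); split; lra.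
Qed.

Lemma herm1_le y : `|herm1 y| <= 36.
Proof.
apply: gden_bound; have [y1 y2 y4] := quartic y; have := normr_ge0 y; lra.
Qed.

Lemma herm2_le y : `|herm2 y| <= 36.
Proof.
apply: gden_bound; have [y1 y2 y4] := quartic y; have := sqr_ge0 y.
by rewrite ler_norml => y0; apply/andP; split; lra.
Qed.

Lemma herm3_le y : `|herm3 y| <= 36.
Proof.
apply: gden_bound; have [y1 y2 y4] := quartic y; have yy := normr_ge0 y.
apply: le_trans (ler_normB _ _) _; rewrite normrX (normrM 3) (ger0_norm (ler0n R 3)).
have : `|y| ^+ 3 <= 1 + y ^+ 4.
  have -> : y ^+ 4 = `|y| ^+ 4 by rewrite -normrX ger0_norm// (exprM _ 2 2) sqr_ge0.
  have v0 := normr_ge0 y; have [v1|/ltW v1] := lerP `|y| 1.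
    by rewrite ler_wpDr ?exprn_ge0// exprn_ile1.
  by rewrite ler_wpDl// ler_weXn2l.
lra.
Qed.

(** The probability that [x] plus a centred Gaussian of variance [t] is at most 0. It solves the
    heat equation with coefficient 1/2, and [x] plays the part of the current sum minus the
    threshold. *)
Definition heat t x : R := Phi (- (x / Num.sqrt t)).

Lemma heat_ge0 t x : 0 <= heat t x. Proof. exact: Phi_ge0. Qed.

Lemma heat_le1 t x : heat t x <= 1. Proof. exact: Phi_le1. Qed.

Section space.
Variable t : R.
Let c := (Num.sqrt t)^-1.

Lemma is_derive_heat_x x : is_derive x 1 (heat t) (- gden (x * c) * c).
Proof.
have d1 : is_derive x 1 (fun x => - (x * c)) (- c).
  have := is_derive1_scale (- c) x.
  by under eq_fun do rewrite mulrN.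
apply: (is_derive_eq (is_derive1_chain d1 (is_derive_Phi _))).
by rewrite gden_even mulrN mulNr.
Qed.

Lemma is_derive_gden_x x :
  is_derive x 1 (fun x => - gden (x * c) * c) (herm1 (x * c) * c ^+ 2).
Proof.
have d := is_derive1_chain (is_derive1_scale c x) (is_derive_gden (x * c)).
have := is_derive1M d (is_derive1_cst (- c) x).
under eq_fun do rewrite mulrN -mulNr.
by move=> H; apply: (is_derive_eq H); ring.
Qed.

Lemma is_derive_herm1_x x :
  is_derive x 1 (fun x => herm1 (x * c) * c ^+ 2) (herm2 (x * c) * c ^+ 3).
Proof.
have d := is_derive1_chain (is_derive1_scale c x) (is_derive_herm1 (x * c)).
by apply: (is_derive_eq (is_derive1M d (is_derive1_cst (c ^+ 2) x))); ring.
Qed.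

End space.

Lemma is_derive_invsqrt t : 0 < t ->
  is_derive t 1 (fun t => (Num.sqrt t)^-1) (- (2 * t * Num.sqrt t)^-1).
Proof.
move=> t0; have s0 : Num.sqrt t != 0 by rewrite gt_eqF// sqrtr_gt0.
apply: (is_derive_eq (is_deriveV s0 (is_derive1_sqrt t0))).
have : t = Num.sqrt t ^+ 2 by rewrite sqr_sqrtr// ltW.
move: s0; rewrite /GRing.scale/=; move: (Num.sqrt t) => s s0 ->; field; exact: s0.
Qed.

Lemma is_derive_heat_t x t : 0 < t ->
  is_derive t 1 (heat ^~ x) (herm1 (x / Num.sqrt t) / (2 * t)).
Proof.
move=> t0; have s0 : Num.sqrt t != 0 by rewrite gt_eqF// sqrtr_gt0.
have := is_derive1M (is_derive1_cst (- x) t) (is_derive_invsqrt t0).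
under eq_fun do rewrite mulNr.
move=> d; apply: (is_derive_eq (is_derive1_chain d (is_derive_Phi _))).
rewrite gden_even /herm1; move: (gden _) => g.
by field; rewrite s0 gt_eqF.
Qed.

Lemma is_derive_heat_tt x t : 0 < t ->
  is_derive t 1 (fun t => herm1 (x / Num.sqrt t) / (2 * t))
    (herm3 (x / Num.sqrt t) / (4 * t ^+ 2)).
Proof.
move=> t0; have s0 : Num.sqrt t != 0 by rewrite gt_eqF// sqrtr_gt0.
have t20 : t * 2 != 0 by rewrite mulf_neq0// gt_eqF.
have := is_derive1M (is_derive1_cst x t) (is_derive_invsqrt t0).
move=> d; have d1 := is_derive1_chain d (is_derive_herm1 _).
have := is_derive1M d1 (is_deriveV (f := fun u => u * 2) t20 (is_derive1_scale 2 t)).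
rewrite (_ : (fun y => _) = (fun t => herm1 (x / Num.sqrt t) / (2 * t))); last first.
  by apply/funext => u; rewrite [u * 2]mulrC.
move=> H; apply: (is_derive_eq H).
rewrite /herm1 /herm2 /herm3; move: (gden _) => g; rewrite /GRing.scale/=.
have E : t = Num.sqrt t ^+ 2 by rewrite sqr_sqrtr// ltW.
move: s0; move: (Num.sqrt t) E => s -> s0; field; exact: s0.
Qed.

Let invsqrt_le t u : 0 < t -> t <= u -> (Num.sqrt u)^-1 <= (Num.sqrt t)^-1.
Proof.
move=> t0 tu; have u0 : 0 < u by exact: lt_le_trans tu.
by rewrite lef_pV2 ?posrE ?sqrtr_gt0// ler_sqrt// ltW.
Qed.

(* By the heat equation [h] and [z^2] carry the same coefficient: the second-order terms cancel
   in mean over a block with [E z^2 = E h]. *)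
Lemma heat_expansion t0 t h x z : 1 <= t0 -> 0 <= h -> t0 <= t - h ->
  `|heat (t - h) (x + z) - heat t x + z * (gden (x / Num.sqrt t) / Num.sqrt t)
    - (z ^+ 2 - h) / 2 * (herm1 (x / Num.sqrt t) / t)|
  <= 36 * ((Num.sqrt t0)^-1) ^+ 3 * (`|z| ^+ 3 + h * `|z| + h ^+ 2).
Proof.
move=> t01 h0 t0h.
have p0 : 0 < t0 by rewrite (lt_le_trans ltr01).
have pt : 0 < t by lra.
set e := (Num.sqrt t0)^-1; set c := (Num.sqrt t)^-1.
have c0 : 0 <= c by rewrite invr_ge0 sqrtr_ge0.
have ce : c <= e by apply: invsqrt_le => //; lra.
have e1 : e <= 1 by rewrite -invr1 -sqrtr1; apply: invsqrt_le.
have e0 : 0 <= e by apply: le_trans ce.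
have tV : t^-1 = c ^+ 2 by rewrite exprVn sqr_sqrtr// ltW.
(* The increment is cut in three: space at time [t] ([X]), time at the point [x + z] ([T]), and
   moving the time derivative from [x + z] back to [x] ([C]), which costs the mixed term
   [h * |z|]. *)
have X : `|heat t (x + z) - heat t x + z * (gden (x * c) * c)
    - z ^+ 2 / 2 * (herm1 (x * c) * c ^+ 2)| <= 36 * e ^+ 3 * `|z| ^+ 3.
  have := @taylor2_bound _ (heat t) _ _ _ x (x + z) (36 * e ^+ 3)
    (fun y _ => is_derive_heat_x t y) (fun y _ => is_derive_gden_x t y)
    (fun y _ => is_derive_herm1_x t y).
  rewrite (_ : x + z - x = z); last by ring.
  rewrite -/c mulNr mulrN opprK; apply => y _.
  rewrite normrM (ger0_norm (exprn_ge0 3 c0)).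
  by apply: ler_pM => //; rewrite ?exprn_ge0 ?herm2_le// lerXn2r.
have T : `|heat (t - h) (x + z) - heat t (x + z) + h * (herm1 ((x + z) * c) / (2 * t))|
    <= 36 * e ^+ 3 * h ^+ 2.
  have btw u : Num.min t (t - h) <= u <= Num.max t (t - h) -> t0 <= u.
    rewrite (min_idPr _); last by lra.
    by rewrite (max_idPl _); [lra|lra].
  have u0 u : t0 <= u -> 0 < u by move=> h'; exact: lt_le_trans h'.
  have := @taylor1_bound _ (heat ^~ (x + z)) _ _ t (t - h) (36 * e ^+ 3)
    (fun u ub => is_derive_heat_t (x + z) (u0 _ (btw _ ub)))
    (fun u ub => is_derive_heat_tt (x + z) (u0 _ (btw _ ub))).
  rewrite (_ : t - h - t = - h); last by ring.
  rewrite mulNr opprK normrN (ger0_norm h0) -/c; apply => u /btw ut.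
  have pu := u0 _ ut.
  rewrite normrM; apply: ler_pM => //; first exact: herm3_le.
  rewrite ger0_norm; last by rewrite invr_ge0 mulr_ge0// exprn_ge0 ?ltW.
  rewrite invfM; apply: (@le_trans _ _ (u ^- 2)).
    by rewrite ler_piMl ?invr_ge0 ?exprn_ge0 ?(ltW pu)// invf_le1// ler1n.
  have -> : u ^- 2 = (Num.sqrt u)^-1 ^+ 4.
    by rewrite (exprM _ 2 2) exprVn sqr_sqrtr ?(ltW pu)// exprVn.
  have ue : (Num.sqrt u)^-1 <= e by apply: invsqrt_le.
  have uu : 0 <= (Num.sqrt u)^-1 by rewrite invr_ge0 sqrtr_ge0.
  (* The second time derivative has order [e ^+ 4]; it is weakened to [e ^+ 3] by [e <= 1], which is
     where [1 <= t0] is used. *)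
  apply: (@le_trans _ _ (e ^+ 4)); first by rewrite lerXn2r.
  by apply: ler_wiXn2l.
have C : `|herm1 ((x + z) * c) - herm1 (x * c)| <= 36 * (`|z| * c).
  have := @mvt_bound _ herm1 _ (x * c) ((x + z) * c) 36
    (fun u _ => is_derive_herm1 u) (fun u _ => herm2_le u).
  rewrite (_ : (x + z) * c - x * c = z * c); last by ring.
  by rewrite normrM (ger0_norm c0).
have C' : `|h / 2 * c ^+ 2 * (herm1 ((x + z) * c) - herm1 (x * c))|
    <= 36 * e ^+ 3 * (h * `|z|).
  rewrite normrM ger0_norm; last by rewrite !mulr_ge0.
  apply: (@le_trans _ _ (h * c ^+ 2 * (36 * (`|z| * c)))).
    apply: ler_pM => //; first by rewrite !mulr_ge0.
    by rewrite ler_wpM2r ?exprn_ge0//; lra.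
  rewrite (_ : h * c ^+ 2 * (36 * (`|z| * c)) = 36 * c ^+ 3 * (h * `|z|)); last by ring.
  by rewrite ler_wpM2r ?mulr_ge0// ler_wpM2l// lerXn2r.
rewrite (_ : _ - _ = (heat (t - h) (x + z) - heat t (x + z)
    + h * (herm1 ((x + z) * c) / (2 * t)))
  + (heat t (x + z) - heat t x + z * (gden (x * c) * c)
    - z ^+ 2 / 2 * (herm1 (x * c) * c ^+ 2))
  - h / 2 * c ^+ 2 * (herm1 ((x + z) * c) - herm1 (x * c))); last first.
  by rewrite -tV; field; rewrite gt_eqF.
apply: le_trans (ler_normB _ _) _.
apply: le_trans (lerD (ler_normD _ _) (lexx _)) _.
by apply: le_trans (lerD (lerD T X) C') _; lra.
Qed.

(** A crude bound for steps without moment cancellation: words in which [s0] does not occur, and the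
    exceptional first block. These contribute only boundedly often on average, so an error of order
    [t0 ^ (-1/2)] is affordable. *)
Lemma heat_lipschitz t0 t h x z : 1 <= t0 -> 0 <= h -> t0 <= t - h ->
  `|heat (t - h) (x + z) - heat t x| <= 36 * (Num.sqrt t0)^-1 * (`|z| + h).
Proof.
move=> t01 h0 t0h.
have p0 : 0 < t0 by rewrite (lt_le_trans ltr01).
have pt : 0 < t by lra.
set e := (Num.sqrt t0)^-1; set c := (Num.sqrt t)^-1.
have c0 : 0 <= c by rewrite invr_ge0 sqrtr_ge0.
have ce : c <= e by apply: invsqrt_le => //; lra.
have e1 : e <= 1 by rewrite -invr1 -sqrtr1; apply: invsqrt_le.
have e0 : 0 <= e by apply: le_trans ce.
have X : `|heat t (x + z) - heat t x| <= 36 * e * `|z|.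
  have := @mvt_bound _ (heat t) _ x (x + z) (36 * e)
    (fun y _ => is_derive_heat_x t y).
  rewrite (_ : x + z - x = z); last by ring.
  apply => y _; rewrite normrM normrN -/c (ger0_norm c0).
  by apply: ler_pM => //; exact: gden_le.
have T : `|heat (t - h) (x + z) - heat t (x + z)| <= 36 * e * h.
  have btw u : Num.min t (t - h) <= u <= Num.max t (t - h) -> t0 <= u.
    rewrite (min_idPr _); last by lra.
    by rewrite (max_idPl _); [lra|lra].
  have u0 u : t0 <= u -> 0 < u by move=> h'; exact: lt_le_trans h'.
  have := @mvt_bound _ (heat ^~ (x + z)) _ t (t - h) (36 * e)
    (fun u ub => is_derive_heat_t (x + z) (u0 _ (btw _ ub))).
  rewrite (_ : t - h - t = - h); last by ring.
  rewrite normrN (ger0_norm h0); apply => u /btw ut; have pu := u0 _ ut.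
  rewrite normrM; apply: ler_pM => //; first exact: herm1_le.
  rewrite ger0_norm; last by rewrite invr_ge0 mulr_ge0 ?ltW.
  rewrite invfM; apply: (@le_trans _ _ (u^-1)).
    by rewrite ler_piMl ?invr_ge0 ?(ltW pu)// invf_le1// ler1n.
  have -> : u^-1 = (Num.sqrt u)^-1 ^+ 2 by rewrite exprVn sqr_sqrtr// ltW.
  have ue : (Num.sqrt u)^-1 <= e by apply: invsqrt_le.
  have uu : 0 <= (Num.sqrt u)^-1 by rewrite invr_ge0 sqrtr_ge0.
  apply: (@le_trans _ _ (e ^+ 2)); first by rewrite lerXn2r.
  by rewrite expr2 ler_piMl.
rewrite (_ : _ - _ = (heat (t - h) (x + z) - heat t (x + z))
  + (heat t (x + z) - heat t x)); last by ring.
by apply: le_trans (ler_normD _ _) _; apply: le_trans (lerD T X) _; lra.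
Qed.

End HeatKernel.

(** * Lindeberg's method along renewal blocks *)

Section RenewalSums.
Context {R : realType} {I : finType} (p : I -> R) (s0 : I).
Hypothesis p_gt0 : forall i, 0 < p i.
Hypothesis p_sum1 : \sum_i p i = 1.

Let bd := decay_bound p s0.
Let bd0 : 0 <= bd. Proof. exact: le_trans ler01 (decay_bound_ge1 s0 p_gt0). Qed.

Section clt.
Variables (psi : seq I -> R) (C K0 : R).
Hypothesis psi_add : forall u w, s0 \notin u -> psi (u ++ s0 :: w) = psi (rcons u s0) + psi w.
Hypothesis C_ge0 : 0 <= C.
Hypothesis psi_le : forall u, `|psi u| <= C * (size u).+1%:R.
Hypothesis K0_ge0 : 0 <= K0.
(** Normalisation in the limit [m -> oo]: blocks have mean 0, and their variance equals their mean
    length, that is, variance one per letter. *)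
Hypothesis psi_mean : forall m,
  `|bsum p s0 m (fun u => psi (rcons u s0))| <= K0 * decay p s0 ^+ m.
Hypothesis psi_var : forall m,
  `|bsum p s0 m (fun u => psi (rcons u s0) ^+ 2 - (size u).+1%:R)| <= K0 * decay p s0 ^+ m.

Let invsqrt t : (1 : R) <= t -> 0 <= (Num.sqrt t)^-1 <= 1.
Proof.
move=> t1; rewrite invr_ge0 sqrtr_ge0 invf_le1 ?sqrtr_gt0 ?(lt_le_trans ltr01)//.
by rewrite -[leLHS]sqrtr1 ler_sqrt// (le_trans ler01).
Qed.

(* Lindeberg's method by induction over the first block.  The heat clock is the number of letters
   read, not the number of blocks, so that no random index ever appears. *)
Lemma wsum_heat_approx : exists2 K, 0 <= K & forall t0 m x, 1 <= t0 ->
  `|wsum p m (fun w => heat t0 (x + psi w)) - heat (t0 + m%:R) x|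
    <= K * (m%:R * (Num.sqrt t0)^-1 ^+ 3 + (Num.sqrt t0)^-1).
Proof.
(* [A1] is the remainder of [heat_expansion] with [|Z| <= D N], integrated through third moments of
   [N]. In [A2], 54 = 36 + 18 comes from the truncated mean and variance terms, and the last summand
   from words without [s0]. *)
pose D := 2 * C; pose A1 := 36 * (D ^+ 3 + D + 1) * bd ^+ 4.
pose A2 := 54 * K0 + 36 * (C + 1) * bd ^+ 3.
have D0 : 0 <= D by rewrite mulr_ge0.
have A10 : 0 <= A1 by do ?[apply: addr_ge0 | apply: mulr_ge0 | apply: exprn_ge0].
have A20 : 0 <= A2 by do ?[apply: addr_ge0 | apply: mulr_ge0 | apply: exprn_ge0].
(* The first term is paid per letter. The second grows by [A2 * e * decay ^+ m] at length [m],
   exactly the truncation error made there; keeping the partial sum makes the induction close. *)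
pose err (e : R) (m : nat) : R := A1 * (m%:R * e ^+ 3) + A2 * e * \sum_(i < m.+1) decay p s0 ^+ i.
suff main t0 m x : 1 <= t0 ->
    `|wsum p m (fun w => heat t0 (x + psi w)) - heat (t0 + m%:R) x| <= err (Num.sqrt t0)^-1 m.
  exists (A1 + A2 * bd); first by rewrite addr_ge0// mulr_ge0.
  move=> t0 m x t01; apply: le_trans (main _ _ _ t01) _.
  have /andP[e0 e1] := invsqrt t01; move: (_^-1) e0 e1 => e e0 e1.
  rewrite /err.
  have h1 : 0 <= A1 * e by apply: mulr_ge0.
  have h2 : 0 <= A2 * bd * (m%:R * e ^+ 3).
    by apply: mulr_ge0; apply: mulr_ge0 => //; exact: exprn_ge0.
  have h3 : A2 * e * \sum_(i < m.+1) decay p s0 ^+ i <= A2 * bd * e.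
    rewrite mulrAC ler_wpM2r// ler_wpM2l//; exact: (geometric_sum_le s0 p_gt0).
  lra.
move=> t01; have := invsqrt t01; set e := (_^-1) => /andP[e0 e1].
have t0p : 0 < t0 by exact: lt_le_trans t01.
elim/ltn_ind: m x => m IH x.
pose T := t0 + m%:R; pose H := heat T x.
have t0T : t0 <= T by rewrite lerDl.
have Tp : 0 < T by exact: lt_le_trans t0T.
have cT : (Num.sqrt T)^-1 <= e by rewrite lef_pV2 ?posrE ?sqrtr_gt0// ler_sqrt// ltW.
have cT0 : 0 <= (Num.sqrt T)^-1 by rewrite invr_ge0 sqrtr_ge0.
pose a := gden (x / Num.sqrt T) / Num.sqrt T; pose b := herm1 (x / Num.sqrt T) / T.
have ae : `|a| <= 36 * e.
  by rewrite normrM (ger0_norm cT0); apply: ler_pM => //; exact: gden_le.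
have be : `|b| <= 36 * e.
  rewrite normrM; apply: ler_pM => //; first exact: herm1_le.
  have -> : T^-1 = (Num.sqrt T)^-1 ^+ 2 by rewrite exprVn sqr_sqrtr// ltW.
  rewrite ger0_norm ?exprn_ge0// expr2 -[e]mulr1; apply: ler_pM => //.
  exact: le_trans cT e1.
have -> : wsum p m (fun w => heat t0 (x + psi w)) - H =
    wsum p m (fun w => heat t0 (x + psi w) - H).
  by rewrite wsumD wsum_cst p_sum1 expr1n mul1r.
pose Z u := psi (rcons u s0); pose N (u : seq I) : R := (size u).+1%:R.
pose F n u := wsum p n (fun w => heat t0 (x + Z u + psi w)) - H.
rewrite (@wsum_renewal _ _ p s0 p_gt0 m _ F); last first.
  move=> u su n; rewrite wsumD wsum_cst p_sum1 expr1n mul1r; congr (_ - _).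
  by apply: eq_wsum => w _ _; rewrite psi_add// addrA.
pose E u := F (m - (size u).+1)%N u + Z u * a - (Z u ^+ 2 - N u) / 2 * b.
have -> : bsum p s0 m (fun u => F (m - (size u).+1)%N u) =
    bsum p s0 m E - a * bsum p s0 m Z + b / 2 * bsum p s0 m (fun u => Z u ^+ 2 - N u).
  rewrite -!bsumZ -bsumB -bsumD; apply: (eq_bsum p_gt0) => u _ _; rewrite /E; ring.
(* A block has at least one letter, so the induction hypothesis is used at shorter lengths; the
   released letter pays for the Taylor remainder [A1 * e ^+ 3]. *)
have E1 : `|bsum p s0 m E| <= A1 * (m%:R * e ^+ 3) + A2 * e * \sum_(i < m) decay p s0 ^+ i.
  case: m IH => [|m] IH in T H t0T Tp cT cT0 a b ae be F E *.
    by rewrite /bsum !big_ord0 normr0 mul0r !mulr0 addr0.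
  apply: (@le_trans _ _ (bsum p s0 m.+1 (fun u =>
      36 * e ^+ 3 * (D ^+ 3 + D + 1) * N u ^+ 3) + bsum p s0 m.+1 (fun=> err e m))).
    rewrite -bsumD; apply: (ler_norm_bsum p_gt0) => u um su; rewrite addrC.
    have Nu : 1 <= N u by rewrite /N ler1n.
    have Zu : `|Z u| <= D * N u by exact: ler_norm_rcons.
    rewrite (_ : E u = (wsum p (m.+1 - (size u).+1) (fun w => heat t0 (x + Z u + psi w))
          - heat (T - N u) (x + Z u))
        + (heat (T - N u) (x + Z u) - heat T x + Z u * a - (Z u ^+ 2 - N u) / 2 * b));
      last by rewrite /E /F /H; ring.
    apply: le_trans (ler_normD _ _) _.
    have TN : T - N u = t0 + (m.+1 - (size u).+1)%:R.
      by rewrite /T /N -addrA -natrB.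
    apply: lerD.
      rewrite TN; apply: le_trans (IH _ _ _) _; first by rewrite subSS ltnS leq_subr.
      rewrite subSS /err; apply: lerD.
        by rewrite ler_wpM2l// ler_wpM2r ?exprn_ge0// ler_nat leq_subr.
      rewrite ler_wpM2l ?mulr_ge0//.
      by apply: geometric_sum_mono; rewrite ltnS leq_subr.
    apply: le_trans (heat_expansion x (Z u) t01 _ _) _; first by rewrite (le_trans ler01).
      by rewrite TN lerDl.
    rewrite -[leRHS]mulrA ler_wpM2l ?mulr_ge0 ?exprn_ge0//.
    have N1 : N u <= N u ^+ 3 by rewrite -[leLHS]expr1 ler_weXn2l.
    have N2 : N u ^+ 2 <= N u ^+ 3 by rewrite ler_weXn2l.
    have N0 : 0 <= N u by rewrite ler0n.
    rewrite !mulrDl mul1r; apply: lerD => //; apply: lerD.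
      by rewrite -exprMn lerXn2r ?nnegrE ?mulr_ge0.
    apply: (@le_trans _ _ (D * N u ^+ 2)); last by rewrite ler_wpM2l.
    by rewrite expr2 mulrCA ler_wpM2l.
  have B3 := le_trans (ler_norm _) (@bsum_pow_le _ _ p s0 p_gt0 p_sum1 m.+1 3 (leqnn 3)).
  have Bc : bsum p s0 m.+1 (fun=> err e m) <= err e m.
    apply: le_trans (ler_norm _) _; apply: (bsum_cst_le s0 p_gt0 p_sum1).
    apply: addr_ge0; apply: mulr_ge0 => //; last first.
    - by apply: sumr_ge0 => i _; exact: exprn_ge0 (decay_ge0 _ _).
    - exact: mulr_ge0.
    - by apply: mulr_ge0 => //; exact: exprn_ge0.
  rewrite bsumZ; apply: (@le_trans _ _ (36 * e ^+ 3 * (D ^+ 3 + D + 1) * bd ^+ 4 + err e m)).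
    apply: lerD => //; apply: ler_wpM2l B3.
    by do ?[apply: addr_ge0 | apply: mulr_ge0 | apply: exprn_ge0].
  by rewrite /err /A1 -[m.+1%:R]natr1; lra.
pose sm := decay p s0 ^+ m.
have sm0 : 0 <= sm by rewrite exprn_ge0// decay_ge0.
have E2 : `|a * bsum p s0 m Z| <= 36 * e * (K0 * sm).
  by rewrite normrM; apply: ler_pM => //; exact: psi_mean.
have E3 : `|b / 2 * bsum p s0 m (fun u => Z u ^+ 2 - N u)| <= 18 * e * (K0 * sm).
  rewrite normrM; apply: ler_pM (psi_var m) => //.
  by rewrite normrM [`|2^-1|]ger0_norm//; lra.
have E4 : `|wsum (avoid p s0) m (fun w => heat t0 (x + psi w) - H)|
    <= 36 * e * (C + 1) * bd ^+ 3 * sm.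
  apply: (@ler_wsum_avoid _ _ p s0 p_gt0 p_sum1 1) => //.
    by do ?[apply: addr_ge0 | apply: mulr_ge0].
  move=> u um _; have Em : t0 = T - m%:R by rewrite /T addrK.
  have := @heat_lipschitz _ t0 T m%:R x (psi u) t01 (ler0n _ _) _.
  rewrite -Em => /(_ (lexx _)); rewrite -/H => L; apply: le_trans L _.
  rewrite expr1 -[leRHS]mulrA ler_wpM2l ?mulr_ge0// mulrDl mul1r lerD//.
  by rewrite um ler_nat.
rewrite /err big_ord_recr /= -/sm.
apply: le_trans (ler_normD _ _) _; apply: le_trans (lerD (ler_normD _ _) E4) _.
apply: le_trans (lerD (lerD (ler_normB _ _) E3) (lexx _)) _.
by apply: le_trans (lerD (lerD (lerD E1 E2) (lexx _)) (lexx _)) _; rewrite /A2; lra.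
Qed.

Variables (G : seq I -> R) (C' : R).
Hypothesis G_add : forall u w, s0 \notin u -> G (u ++ s0 :: w) = G (rcons u s0) + psi w.
Hypothesis C'_ge0 : 0 <= C'.
Hypothesis G_le : forall u, `|G u| <= C' * (size u).+1%:R.

(** [G] may behave differently on the first block, but continues as [psi] after it. Only that block
    is treated crudely, and the theorem for [psi] is applied to what follows. *)
Lemma wsum_heat_approx_shift : exists2 K, 0 <= K & forall t0 n x, 1 <= t0 ->
  `|wsum p n (fun w => heat t0 (x + G w)) - heat (t0 + n%:R) x|
    <= K * (n%:R * (Num.sqrt t0)^-1 ^+ 3 + (Num.sqrt t0)^-1).
Proof.
have [K Ke0 KP] := wsum_heat_approx.
pose A1 := 36 * (2 * C' + 1) * bd ^+ 4; pose A2 := 36 * (C' + 1) * bd ^+ 3.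
have A10 : 0 <= A1 by do ?[apply: addr_ge0 | apply: mulr_ge0 | apply: exprn_ge0].
have A20 : 0 <= A2 by do ?[apply: addr_ge0 | apply: mulr_ge0 | apply: exprn_ge0].
exists (K + A1 + A2) => [|t0 n x t01]; first by do ?apply: addr_ge0.
have := KP t0; have := invsqrt t01; set e := (_^-1) => /andP[e0 e1] {}KP.
pose T := t0 + n%:R; pose H := heat T x.
have -> : wsum p n (fun w => heat t0 (x + G w)) - H =
    wsum p n (fun w => heat t0 (x + G w) - H).
  by rewrite wsumD wsum_cst p_sum1 expr1n mul1r.
pose Z u := G (rcons u s0).
pose F m u := wsum p m (fun w => heat t0 (x + Z u + psi w)) - H.
rewrite (@wsum_renewal _ _ p s0 p_gt0 n _ F); last first.
  move=> u su m; rewrite wsumD wsum_cst p_sum1 expr1n mul1r; congr (_ - _).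
  by apply: eq_wsum => w _ _; rewrite G_add// addrA.
have ne0 : 0 <= n%:R * e ^+ 3 by rewrite mulr_ge0// exprn_ge0.
have E1 : `|bsum p s0 n (fun u => F (n - (size u).+1)%N u)| <=
    K * (n%:R * e ^+ 3 + e) + 36 * e * (2 * C' + 1) * bd ^+ 4.
  apply: (@le_trans _ _ (bsum p s0 n (fun=> K * (n%:R * e ^+ 3 + e)) +
    bsum p s0 n (fun u => 36 * e * (2 * C' + 1) * (size u).+1%:R ^+ 1))).
    rewrite -bsumD; apply: (ler_norm_bsum p_gt0) => u un su.
    have TN : T - (size u).+1%:R = t0 + (n - (size u).+1)%:R.
      by rewrite /T -addrA -natrB.
    rewrite /F (_ : _ - H = (wsum p (n - (size u).+1) (fun w => heat t0 (x + Z u + psi w))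
        - heat (T - (size u).+1%:R) (x + Z u)) +
        (heat (T - (size u).+1%:R) (x + Z u) - H)); last by ring.
    apply: le_trans (ler_normD _ _) _; apply: lerD.
      rewrite TN; apply: le_trans (KP _ _ t01) _.
      by rewrite ler_wpM2l// lerD2r ler_wpM2r ?exprn_ge0// ler_nat leq_subr.
    apply: le_trans (heat_lipschitz x (Z u) t01 _ _) _ => //; first by rewrite TN lerDl.
    rewrite -[leRHS]mulrA ler_wpM2l ?mulr_ge0// expr1 mulrDl mul1r lerD2r.
    exact: ler_norm_rcons.
  apply: lerD.
    apply: le_trans (ler_norm _) _; apply: (bsum_cst_le s0 p_gt0 p_sum1).
    by rewrite mulr_ge0// addr_ge0.
  rewrite bsumZ ler_wpM2l ?mulr_ge0 ?addr_ge0 ?mulr_ge0//.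
  exact: le_trans (ler_norm _) (@bsum_pow_le _ _ p s0 p_gt0 p_sum1 n 1 isT).
have E4 : `|wsum (avoid p s0) n (fun w => heat t0 (x + G w) - H)|
    <= 36 * e * (C' + 1) * bd ^+ 3.
  apply: (@le_trans _ _ (36 * e * (C' + 1) * bd ^+ 3 * decay p s0 ^+ n)).
    apply: (@ler_wsum_avoid _ _ p s0 p_gt0 p_sum1 1) => //.
      by do ?[apply: addr_ge0 | apply: mulr_ge0].
    move=> u un _; have Em : t0 = T - n%:R by rewrite /T addrK.
    have := @heat_lipschitz _ t0 T n%:R x (G u) t01 (ler0n _ _) _.
    rewrite -Em => /(_ (lexx _)); rewrite -/H => L; apply: le_trans L _.
    rewrite expr1 -[leRHS]mulrA ler_wpM2l ?mulr_ge0// mulrDl mul1r lerD//.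
    by rewrite un ler_nat.
  rewrite ler_piMr ?exprn_ile1 ?decay_ge0 ?(ltW (decay_lt1 s0 p_gt0))//.
  by do ?[apply: addr_ge0 | apply: mulr_ge0 | apply: exprn_ge0].
apply: le_trans (ler_normD _ _) _; apply: le_trans (lerD E1 E4) _.
have h1 : 0 <= A1 * (n%:R * e ^+ 3) by apply: mulr_ge0.
have h2 : 0 <= A2 * (n%:R * e ^+ 3) by apply: mulr_ge0.
by move: h1 h2; rewrite /A1 /A2; lra.
Qed.

End clt.
End RenewalSums.

(** * From heat functions to distribution functions *)

Lemma Phi_lipschitz {R : realType} (x y : R) : `|Phi y - Phi x| <= 36 * `|y - x|.
Proof. exact: mvt_bound (fun u _ => is_derive_Phi u) (fun u _ => gden_le u). Qed.

Section SmoothedCLT.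
Context {R : realType} {I : finType} (p : I -> R) (G : seq I -> R) (K : R).
Hypothesis p_ge0 : forall i, 0 <= p i.
Hypothesis p_sum1 : \sum_i p i = 1.
Hypothesis K_ge0 : 0 <= K.
Hypothesis approx : forall t0 n x, 1 <= t0 ->
  `|wsum p n (fun w => heat t0 (x + G w)) - heat (t0 + n%:R) x|
    <= K * (n%:R * (Num.sqrt t0)^-1 ^+ 3 + (Num.sqrt t0)^-1).

(** The total variance is [(d + 1) * n], so the value is [Phi (c' * r)] with [r = (d + 1) ^ (-1/2)],
    and [1 - r <= 1 - r ^+ 2 = d * r ^+ 2 <= d]. *)
Let heat_limit (d c c' : R) (n : nat) : 0 < d -> (0 < n)%N ->
  `|heat (d * n%:R + n%:R) (- (c' * Num.sqrt n%:R)) - Phi c| <= 36 * (`|c' - c| + `|c'| * d).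
Proof.
move=> d0 n0; have n0' : 0 < n%:R :> R by rewrite ltr0n.
pose r := (Num.sqrt (d + 1))^-1.
have d1 : 0 < d + 1 by lra.
have -> : heat (d * n%:R + n%:R) (- (c' * Num.sqrt n%:R)) = Phi (c' * r).
  rewrite /heat mulNr opprK; congr Phi; rewrite -[X in d * _ + X]mul1r -mulrDl.
  rewrite sqrtrM ?(ltW d1)// invfM mulrACA divff ?mulr1//.
  by rewrite gt_eqF// sqrtr_gt0.
have r0 : 0 < r by rewrite invr_gt0 sqrtr_gt0.
have r1 : r <= 1.
  by rewrite invf_le1 ?sqrtr_gt0// -[leLHS]sqrtr1 ler_sqrt// ?lerDr ltW.
have r2 : r ^+ 2 * (d + 1) = 1 by rewrite exprVn sqr_sqrtr ?(ltW d1)// mulVf// gt_eqF.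
have rd : 1 - r <= d.
  suff h : 1 - r ^+ 2 <= d by apply: le_trans h; rewrite lerD2l lerN2 expr2 ler_piMr// ltW.
  by have := sqr_ge0 r; nra.
apply: le_trans (Phi_lipschitz _ _) _; rewrite ler_pM2l//.
rewrite (_ : c' * r - c = (c' - c) - c' * (1 - r)); last by ring.
apply: le_trans (ler_normB _ _) _; rewrite lerD2l normrM ler_wpM2l//.
by rewrite ger0_norm// subr_ge0.
Qed.

(** Moving the threshold by [e * sqrt n] is a move by [e / sqrt d >= M] standard deviations of the
    smoothing Gaussian, so the indicator lies between the two shifted heat functions up to the tail
    [eta]. *)
Let smoothing (d e M eta c : R) (n : nat) (y : R) : 0 < d -> (0 < n)%N -> 0 < e -> 0 < M ->
  d <= (e / M) ^+ 2 ->
  (forall x, M <= x -> Phi (- x) < eta /\ 1 - eta < Phi x) ->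
  ((y / Num.sqrt n%:R <= c)%R%:R : R) <= heat (d * n%:R) (- ((c + e) * Num.sqrt n%:R) + y) + eta /\
  heat (d * n%:R) (- ((c - e) * Num.sqrt n%:R) + y) <= (y / Num.sqrt n%:R <= c)%R%:R + eta.
Proof.
move=> d0 n0 e0 M0 dM tails; have n0' : 0 < n%:R :> R by rewrite ltr0n.
have sn : 0 < Num.sqrt n%:R :> R by rewrite sqrtr_gt0.
have sd : 0 < Num.sqrt d by rewrite sqrtr_gt0.
have Me : M <= e / Num.sqrt d.
  have eM : 0 < e / M by rewrite divr_gt0.
  have : Num.sqrt d <= e / M.
    by rewrite -(ger0_norm (ltW eM)) -sqrtr_sqr ler_sqrt// exprn_ge0// ltW.
  by rewrite !ler_pdivlMr// mulrC.
have eta0 : 0 < eta by have [h _] := tails M (lexx _); exact: le_lt_trans (Phi_ge0 _) h.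
have shift c' : - ((- (c' * Num.sqrt n%:R) + y) / Num.sqrt (d * n%:R))
    = (c' - y / Num.sqrt n%:R) / Num.sqrt d.
  rewrite sqrtrM ?(ltW d0)//; field; by rewrite !gt_eqF.
have h1 := @heat_ge0 R; have h2 := @heat_le1 R.
case: (lerP (y / Num.sqrt n%:R) c) => yc /=; split.
- have [_ /ltW tM] := tails _ Me; rewrite -lerBlDr; apply: le_trans tM _.
  rewrite /heat shift; apply: Phi_homo; rewrite ler_pM2r ?invr_gt0//; lra.
- by apply: le_trans (h2 _ _) _; rewrite lerDl ltW.
- by rewrite addr_ge0// ltW.
- have [/ltW tM _] := tails _ Me; rewrite add0r; apply: le_trans tM.
  rewrite /heat shift; apply: Phi_homo; rewrite -[leRHS]mulNr ler_pM2r ?invr_gt0//; lra.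
Qed.

Lemma wsum_clt c :
  (fun n => wsum p n (fun w => (G w / Num.sqrt n%:R <= c)%R%:R)) @ \oo --> Phi c.
Proof.
apply/cvgrPdist_le => k k0.
(* Budget: [heat_limit] costs at most [36 * (e + e)], which is [72 * e = eta = k / 4]; the
   approximation and the smoothing cost [eta] each. *)
have [e e0 ek] : exists2 e : R, 0 < e & k = 288 * e by exists (k / 288); lra.
have [eta eta0 etak] : exists2 eta : R, 0 < eta & k = 4 * eta by exists (k / 4); lra.
have [M M0 tails] := @Phi_tails R eta eta0.
(* The first bound is what [smoothing] asks for; the second gives [|c'| * d <= e] for every
   threshold [c'] within [e] of [c]. *)
pose d := Num.min ((e / M) ^+ 2) (e / (`|c| + e)).
have ce : 0 < `|c| + e by rewrite ltr_wpDl.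
have d0 : 0 < d by rewrite lt_min exprn_gt0 ?divr_gt0.
have dM : d <= (e / M) ^+ 2 by rewrite ge_min lexx.
have dc : (`|c| + e) * d <= e by rewrite mulrC -ler_pdivlMr// ge_min lexx orbT.
(* With [t0 = d * n] the error in [approx] equals [B / sqrt t0], which tends to 0 for fixed [d]. *)
pose B := K * (d^-1 + 1).
have B0 : 0 <= B by rewrite mulr_ge0// addr_ge0// invr_ge0 ltW.
near=> n.
have n0 : (0 < n)%N by near: n; exact: nbhs_infty_gt.
have n0' : 0 < n%:R :> R by rewrite ltr0n.
have dn : d^-1 <= n%:R by near: n; exact: nbhs_infty_ger.
have Bn : (B / eta) ^+ 2 / d <= n%:R by near: n; exact: nbhs_infty_ger.
have t01 : 1 <= d * n%:R by rewrite mulrC -ler_pdivrMr// mul1r.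
have t00 : 0 < d * n%:R by rewrite mulr_gt0.
have ap x : `|wsum p n (fun w => heat (d * n%:R) (x + G w)) - heat (d * n%:R + n%:R) x| <= eta.
  apply: le_trans (approx _ _ t01) _; set s := Num.sqrt _.
  have s0 : 0 < s by rewrite sqrtr_gt0.
  have s2 : s ^+ 2 = d * n%:R by rewrite sqr_sqrtr// ltW.
  have -> : K * (n%:R * s^-1 ^+ 3 + s^-1) = B / s.
    rewrite /B; have -> : n%:R = s ^+ 2 / d by rewrite s2 mulrC mulKf// gt_eqF.
    by field; rewrite !gt_eqF.
  have Be : 0 <= B / eta by rewrite divr_ge0// ltW.
  have : B / eta <= s.
    by rewrite -(ger0_norm Be) -sqrtr_sqr ler_sqrt ?(ltW t00)// [leRHS]mulrC -ler_pdivrMr.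
  by move=> h; rewrite (ler_pdivrMr _ _ s0) mulrC -(ler_pdivrMr _ _ eta0).
have lim c' : `|c' - c| <= e ->
    `|wsum p n (fun w => heat (d * n%:R) (- (c' * Num.sqrt n%:R) + G w)) - Phi c| <= 2 * eta.
  move=> cc; set W := wsum _ _ _.
  have := heat_limit c c' d0 n0; have := ap (- (c' * Num.sqrt n%:R)); rewrite -/W.
  set h := heat _ _ => a1 a2; rewrite (_ : W - _ = (W - h) + (h - Phi c)); last by ring.
  apply: le_trans (ler_normD _ _) _; apply: le_trans (lerD a1 a2) _.
  have : `|c'| * d <= e.
    apply: le_trans dc; rewrite ler_wpM2r ?(ltW d0)//.
    rewrite (_ : c' = c + (c' - c)); last by ring.
    by apply: le_trans (ler_normD _ _) _; rewrite lerD2l.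
  by lra.
have up := lim (c + e); have dw := lim (c - e).
have {}up : `|wsum p n (fun w => heat (d * n%:R) (- ((c + e) * Num.sqrt n%:R) + G w)) - Phi c|
   <= 2 * eta by apply: up; rewrite (_ : c + e - c = e) ?gtr0_norm//; ring.
have {}dw : `|wsum p n (fun w => heat (d * n%:R) (- ((c - e) * Num.sqrt n%:R) + G w)) - Phi c|
   <= 2 * eta by apply: dw; rewrite (_ : c - e - c = - e) ?normrN ?gtr0_norm//; ring.
set X := wsum p n _.
have etaE : eta = wsum p n (fun=> eta) by rewrite wsum_cst p_sum1 expr1n mul1r.
have X1 : X <= wsum p n (fun w => heat (d * n%:R) (- ((c + e) * Num.sqrt n%:R) + G w)) + eta.
  rewrite [X in _ <= _ + X]etaE -wsumD.
  apply: ler_wsum => // w _ _.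
  by have [h _] := smoothing c (G w) d0 n0 e0 M0 dM tails; exact: h.
have X2 : wsum p n (fun w => heat (d * n%:R) (- ((c - e) * Num.sqrt n%:R) + G w)) <= X + eta.
  rewrite [X in _ <= _ + X]etaE -wsumD.
  apply: ler_wsum => // w _ _.
  by have [_ h] := smoothing c (G w) d0 n0 e0 M0 dM tails; exact: h.
move: up dw; rewrite !ler_norml => /andP[u1 u2] /andP[w1 w2].
by apply/andP; split; lra.
Unshelve. all: by end_near. Qed.

End SmoothedCLT.

(** * Exponential moments of renewal blocks *)

Section ExponentialMoments.
Context {R : realType} {I : finType} (p : I -> R) (s0 : I).
Hypothesis p_gt0 : forall i, 0 < p i.
Hypothesis p_sum1 : \sum_i p i = 1.

Let bd := decay_bound p s0.
Let bd1 : 1 <= bd. Proof. exact: decay_bound_ge1. Qed.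
Let bd0 : 0 <= bd. Proof. exact: le_trans bd1. Qed.
Let s := decay p s0.
Let s_ge0 : 0 <= s. Proof. exact: decay_ge0. Qed.
Let s_lt1 : s < 1. Proof. exact: decay_lt1. Qed.

Lemma expR_quadratic_le (y : R) : expR y <= 1 + y + y ^+ 2 * expR `|y|.
Proof.
have := @taylor1_bound _ expR expR expR 0 y (expR `|y|)
  (fun x _ => is_derive_expR x) (fun x _ => is_derive_expR x) _.
rewrite subr0 expR0 mulr1 real_normK ?num_real// => H.
have {}H : `|expR y - 1 - y| <= expR `|y| * y ^+ 2.
  apply: H => x /andP[_ xy]; rewrite ger0_norm ?expR_ge0// ler_expR.
  by apply: le_trans xy _; rewrite ge_max normr_ge0 ler_norm.
by have := le_trans (ler_norm _) H; lra.
Qed.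

Lemma decay_cvg0 (e K : R) : 0 < e -> 0 <= K -> exists M, forall m, (M <= m)%N -> K * s ^+ m < e.
Proof.
move=> e0 K0.
have Kcvg : (fun m => K * s ^+ m) @ \oo --> (0 : R).
  rewrite -(mulr0 K); apply: cvgM; first exact: cvg_cst.
  by apply: cvg_expr; rewrite ger0_norm.
have [M _ HM] := cvgr_lt (0 : R) Kcvg _ e0.
by exists M => m Mm; exact: HM.
Qed.

(** From [s <= 1 - y <= expR (- y)] one gets [s * expR y <= 1]. Of the four powers [s ^+ j], one
    absorbs the exponential, two the polynomial, and one remains. *)
Lemma wsum_avoid_exp (y : R) d j : (d <= 2)%N -> 0 <= y -> y <= 1 - s ->
  wsum (avoid p s0) j (fun u => (size u).+1%:R ^+ d * expR (y * (size u).+1%:R))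
  <= expR 1 * bd ^+ 2 * s ^+ j.
Proof.
move=> d2 y0 ys.
rewrite (@eq_wsum _ _ _ _ _ (fun=> j.+1%:R ^+ d * expR (y * j.+1%:R))); last first.
  by move=> w -> _.
rewrite wsum_cst sum_avoid// -decayX4// -/s.
have sy : s * expR y <= 1.
  have h : s <= expR (- y) by apply: le_trans (expR_ge1Dx _); lra.
  by rewrite -(expR0 R) -(addNr y) expRD ler_wpM2r// expR_ge0.
have sy0 : 0 <= s * expR y by rewrite mulr_ge0// expR_ge0.
have -> : expR (y * j.+1%:R) = expR y ^+ j * expR y.
  by rewrite -exprSr -expRM_natr mulrC.
rewrite (_ : _ * _ = expR y * ((s * expR y) ^+ j * (j.+1%:R ^+ d * (s ^+ j) ^+ 2) * s ^+ j));
  last by rewrite -[in LHS]exprM mulnC exprM exprMn; ring.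
rewrite -[leRHS]mulrA; apply: ler_pM.
- exact: expR_ge0.
- by do ?[apply: mulr_ge0 | apply: exprn_ge0].
- by rewrite ler_expR; apply: le_trans ys _; rewrite gerBl.
apply: ler_wpM2r; first exact: exprn_ge0.
rewrite -[leRHS]mul1r; apply: ler_pM; rewrite ?exprn_ge0 ?exprn_ile1//.
  by rewrite mulr_ge0 ?exprn_ge0.
apply: (@le_trans _ _ (j.+1%:R ^+ 2 * (s ^+ j) ^+ 2)).
  by rewrite ler_wpM2r ?exprn_ge0// ler_weXn2l// ler1n.
rewrite -exprMn lerXn2r ?nnegrE ?mulr_ge0 ?exprn_ge0//.
exact: linear_decay_le.
Qed.

Lemma bsum_exp_le (y : R) d m : (d <= 2)%N -> 0 <= y -> y <= 1 - s ->
  bsum p s0 m (fun u => (size u).+1%:R ^+ d * expR (y * (size u).+1%:R)) <= expR 1 * bd ^+ 3.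
Proof.
move=> d2 y0 ys; apply: (@le_trans _ _ (\sum_(j < m) expR 1 * bd ^+ 2 * s ^+ j)).
  apply: ler_sum => j _; apply: le_trans (wsum_avoid_exp j d2 y0 ys).
  rewrite ler_piMl ?(p_le1 s0 p_gt0 p_sum1)//.
  apply: wsum_ge0 => [i|w _ _]; first exact: avoid_ge0.
  by rewrite mulr_ge0 ?exprn_ge0 ?expR_ge0.
rewrite -mulr_sumr [bd ^+ 3]exprSr mulrA ler_wpM2l ?mulr_ge0 ?exprn_ge0 ?expR_ge0//.
exact: geometric_sum_le.
Qed.

Lemma ler_bsum m (f g : seq I -> R) :
  (forall u, (size u < m)%N -> s0 \notin u -> f u <= g u) ->
  bsum p s0 m f <= bsum p s0 m g.
Proof.
move=> fg; apply: ler_sum => j _; apply: ler_wpM2l; first exact: ltW.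
apply: ler_wsum => [i|w wj]; first exact: avoid_ge0.
by rewrite avoid_all// => sw; apply: fg => //; rewrite wj.
Qed.

Lemma bsum_homo m n (f : seq I -> R) : (forall u, 0 <= f u) -> (m <= n)%N ->
  bsum p s0 m f <= bsum p s0 n f.
Proof.
move=> f0 /subnKC <-; rewrite /bsum big_split_ord /= lerDl sumr_ge0// => j _.
apply: mulr_ge0; first exact: ltW.
by apply: wsum_ge0 => // i; exact: avoid_ge0.
Qed.

Lemma bsum_le_limit (f : seq I -> R) (l K : R) : (forall u, 0 <= f u) -> 0 <= K ->
  (forall m, `|bsum p s0 m f - l| <= K * s ^+ m) -> forall m, bsum p s0 m f <= l.
Proof.
move=> f0 K0 fl m; apply/ler_addgt0Pr => e e0.
have [M HM] := decay_cvg0 e0 K0.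
apply: le_trans (bsum_homo f0 (leq_maxl m M)) _.
have := fl (maxn m M); rewrite ler_norml => /andP[_].
by have := HM _ (leq_maxr m M); lra.
Qed.

Section moments.
Variables (W G : seq I -> R) (C l K0 : R).
Hypothesis C_ge0 : 0 <= C.
Hypothesis W_add : forall u w, s0 \notin u -> W (u ++ s0 :: w) = W (rcons u s0) + W w.
Hypothesis W_le : forall u, `|W u| <= C * (size u).+1%:R.
Hypothesis G_add : forall u w, s0 \notin u -> G (u ++ s0 :: w) = G (rcons u s0) + W w.
Hypothesis G_le : forall u, `|G u| <= C * (size u).+1%:R.
Hypothesis l_lt0 : l < 0.
Hypothesis K0_ge0 : 0 <= K0.
Hypothesis W_drift : forall m,
  `|bsum p s0 m (fun u => W (rcons u s0)) - l| <= K0 * s ^+ m.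

(** Negative drift makes the exponential moment of a block at most 1 for small [lam], so completed
    blocks never increase the expectation; only the unfinished last block and the first block of [G]
    contribute. *)
Lemma exp_moment_bounded : exists lam K, [/\ 0 < lam, 0 <= K &
  forall n, wsum p n (fun w => expR (lam * G w)) <= K].
Proof.
pose D := 2 * C + 1; have D1 : 1 <= D by rewrite lerDr mulr_ge0.
have D0 : 0 < D by exact: lt_le_trans D1.
pose B := D ^+ 2 * (expR 1 * bd ^+ 3).
have B0 : 0 < B.
  by rewrite !mulr_gt0 ?exprn_gt0 ?expR_gt0// (lt_le_trans ltr01).
(* The first bound ensures integrability over a block, the second makes the quadratic term of the
   exponential at most half of the linear gain [lam * - l]. *)
pose lam := Num.min ((1 - s) / D) (- l / (2 * B)).
have lam0 : 0 < lam.
  rewrite lt_min divr_gt0 ?subr_gt0//=.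
  by apply: divr_gt0; [rewrite oppr_gt0|apply: mulr_gt0].
have lamD : lam * D <= 1 - s by rewrite -ler_pdivlMr// ge_min lexx.
have lamB : lam * B <= - l / 2.
  rewrite -ler_pdivlMr// (_ : - l / 2 / B = - l / (2 * B)) ?ge_min ?lexx ?orbT//.
  by field; rewrite gt_eqF.
have lamD0 : 0 <= lam * D by rewrite mulr_ge0 ?ltW.
have CD : 2 * C <= D by rewrite lerDl.
have blk H u : (forall u, `|H u| <= C * (size u).+1%:R) ->
    expR (lam * H (rcons u s0)) <= expR (lam * D * (size u).+1%:R).
  move=> HH; rewrite ler_expR -mulrA ler_wpM2l ?(ltW lam0)//.
  apply: le_trans (ler_norm _) _; apply: le_trans (ler_norm_rcons _ _ C_ge0 HH) _.
  by rewrite ler_wpM2r.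
have tail H n : (forall u, `|H u| <= C * (size u).+1%:R) ->
    wsum (avoid p s0) n (fun w => expR (lam * H w)) <= expR 1 * bd ^+ 2 * s ^+ n.
  move=> HH; apply: le_trans (wsum_avoid_exp n (leq0n 2) lamD0 lamD).
  apply: ler_wsum => [i|w _ _]; first exact: avoid_ge0.
  rewrite expr0 mul1r ler_expR -mulrA ler_wpM2l ?(ltW lam0)//.
  apply: le_trans (ler_norm _) _; apply: le_trans (HH _) _.
  by rewrite ler_wpM2r//; move: C_ge0 CD; lra.
(* The integrand is positive, so [m] may be enlarged until the truncated drift is below [l / 2]. *)
have contr m : bsum p s0 m (fun u => expR (lam * W (rcons u s0))) <= 1.
  have [M HM] := @decay_cvg0 (- l / 2) K0 ltac:(by rewrite divr_gt0// oppr_gt0) K0_ge0.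
  apply: (@le_trans _ _ (bsum p s0 (maxn m M) (fun u => expR (lam * W (rcons u s0))))).
    by apply: bsum_homo (leq_maxl _ _) => u; exact: expR_ge0.
  have := HM _ (leq_maxr m M); have := W_drift (maxn m M).
  move: (maxn m M) => m'; rewrite ler_norml => /andP[_ h1] h2.
  apply: (@le_trans _ _ (bsum p s0 m' (fun u => 1 + (lam * W (rcons u s0) +
      (lam * D) ^+ 2 * ((size u).+1%:R ^+ 2 * expR (lam * D * (size u).+1%:R)))))).
    apply: ler_bsum => u _ _; apply: le_trans (expR_quadratic_le _) _.
    rewrite -addrA lerD2l lerD2l.
    have lW : `|lam * W (rcons u s0)| <= lam * D * (size u).+1%:R.
      rewrite normrM gtr0_norm// -mulrA ler_wpM2l ?(ltW lam0)//.
      by apply: le_trans (ler_norm_rcons _ _ C_ge0 W_le) _; rewrite ler_wpM2r.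
    rewrite mulrA -exprMn; apply: ler_pM; rewrite ?sqr_ge0 ?expR_ge0 ?ler_expR//.
    by rewrite -(real_normK (num_real _)) lerXn2r ?nnegrE// mulr_ge0.
  rewrite bsumD bsumD !bsumZ.
  have c1 : bsum p s0 m' (fun=> 1) <= 1.
    by apply: le_trans (ler_norm _) _; exact: bsum_cst_le.
  have c2 := bsum_exp_le m' (leqnn 2) lamD0 lamD.
  have c3 : (lam * D) ^+ 2 * bsum p s0 m' (fun u => (size u).+1%:R ^+ 2 *
      expR (lam * D * (size u).+1%:R)) <= lam * (- l / 2).
    apply: le_trans (ler_wpM2l _ c2) _; first exact: sqr_ge0.
    have -> : (lam * D) ^+ 2 * (expR 1 * bd ^+ 3) = lam * (lam * B) by rewrite /B; ring.
    by rewrite ler_wpM2l ?(ltW lam0).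
  have c4 : lam * bsum p s0 m' (fun u => W (rcons u s0)) <= lam * (l / 2).
    by rewrite ler_wpM2l ?(ltW lam0)//; lra.
  by move: c1 c3 c4; lra.
pose c := expR 1 * bd ^+ 2.
have c0 : 0 <= c by rewrite mulr_ge0 ?expR_ge0 ?exprn_ge0.
have F_le n : wsum p n (fun w => expR (lam * W w)) <= c * bd.
  apply: (@le_trans _ _ (c * \sum_(i < n.+1) s ^+ i)); last first.
    by rewrite ler_wpM2l//; exact: geometric_sum_le.
  elim/ltn_ind: n => n IH.
  rewrite (@wsum_renewal _ _ p s0 p_gt0 n _ (fun m u => expR (lam * W (rcons u s0)) *
     wsum p m (fun w => expR (lam * W w)))); last first.
    move=> u su m; rewrite -wsumZ; apply: eq_wsum => w _ _.
    by rewrite W_add// mulrDr expRD.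
  rewrite big_ord_recr /= mulrDr; apply: lerD; last exact: tail.
  pose k := c * \sum_(i < n) s ^+ i.
  have k0 : 0 <= k by rewrite mulr_ge0// sumr_ge0// => i _; exact: exprn_ge0.
  apply: (@le_trans _ _ (bsum p s0 n (fun u => k * expR (lam * W (rcons u s0))))).
    apply: ler_bsum => u un _; rewrite mulrC; apply: ler_wpM2r; first exact: expR_ge0.
    apply: le_trans (IH _ _) _; first by rewrite ltn_subrL (leq_ltn_trans _ un).
    rewrite ler_wpM2l//; apply: geometric_sum_mono => //.
    by rewrite -subSn// subSS leq_subr.
  by rewrite bsumZ ler_piMr.
exists lam, (c * bd * (expR 1 * bd ^+ 3) + c); split => //.
  by do ?[apply: addr_ge0 | apply: mulr_ge0 | apply: exprn_ge0 | apply: expR_ge0].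
move=> n.
rewrite (@wsum_renewal _ _ p s0 p_gt0 n _ (fun m u => expR (lam * G (rcons u s0)) *
     wsum p m (fun w => expR (lam * W w)))); last first.
  move=> u su m; rewrite -wsumZ; apply: eq_wsum => w _ _.
  by rewrite G_add// mulrDr expRD.
apply: lerD; last first.
  by apply: le_trans (tail _ n G_le) _; rewrite ler_piMr// exprn_ile1// ltW.
apply: (@le_trans _ _ (bsum p s0 n (fun u => c * bd *
   ((size u).+1%:R ^+ 0 * expR (lam * D * (size u).+1%:R))))).
  apply: ler_bsum => u _ _; rewrite expr0 mul1r mulrC; apply: ler_pM.
  - by apply: wsum_ge0 => [i|w _ _]; [exact: ltW|exact: expR_ge0].
  - exact: expR_ge0.
  - exact: F_le.
  - by apply: blk.
by rewrite bsumZ ler_wpM2l ?mulr_ge0//; exact: bsum_exp_le.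
Qed.

End moments.
End ExponentialMoments.

(** * Limit theorems for functionals of words *)

Section WordLimitTheorems.
Context {R : realType} {I : finType} (p : I -> R) (s0 : I).
Hypothesis p_gt0 : forall i, 0 < p i.
Hypothesis p_sum1 : \sum_i p i = 1.
Variables (Psi : seq I -> R) (C : R).
Hypothesis Psi_add : forall u w, s0 \notin u -> Psi (u ++ s0 :: w) = Psi (rcons u s0) + Psi w.
Hypothesis C_ge0 : 0 <= C.
Hypothesis Psi_le : forall u, `|Psi u| <= C * (size u).+1%:R.
Hypothesis Psi_nondegenerate : forall L, exists2 u : seq I, s0 \notin u &
  Psi (rcons u s0) != L * (size u).+1%:R.

(** The class is relative to [Psi], and only the first block of [G] is free; this is what allows the
    same constants for the vector growth and for the operator norm. *)
Definition additive_block (G : seq I -> R) :=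
  (exists2 C', 0 <= C' & forall u, `|G u| <= C' * (size u).+1%:R) /\
  (forall u w, s0 \notin u -> G (u ++ s0 :: w) = G (rcons u s0) + Psi w).

Let s_ge0 : 0 <= decay p s0. Proof. exact: decay_ge0. Qed.

Let wsum_gt0 u (f : seq I -> R) : s0 \notin u -> (forall w, 0 <= f w) -> 0 < f u ->
  0 < wsum (avoid p s0) (size u) f.
Proof.
elim: u f => [//|i u IH] f su f0 fu /=.
rewrite (bigD1 i)//= ltr_wpDr//.
  apply: sumr_ge0 => j _; apply: mulr_ge0; first exact: avoid_ge0.
  by apply: wsum_ge0 => // j'; exact: avoid_ge0.
move: su; rewrite inE negb_or => /andP[si su].
by rewrite mulr_gt0// ?IH// avoid_neq// eq_sym.
Qed.

Let bsum_gt0 u (f : seq I -> R) : s0 \notin u -> (forall w, 0 <= f w) -> 0 < f u ->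
  0 < bsum p s0 (size u).+1 f.
Proof.
move=> su f0 fu; rewrite /bsum big_ord_recr /= ltr_wpDl//; last first.
  by rewrite mulr_gt0// wsum_gt0.
apply: sumr_ge0 => j _; apply: mulr_ge0; first exact: ltW.
by apply: wsum_ge0 => // i; exact: avoid_ge0.
Qed.

Let centered_add (G : seq I -> R) (a b : R) :
  (forall u w, s0 \notin u -> G (u ++ s0 :: w) = G (rcons u s0) + Psi w) ->
  forall u w, s0 \notin u -> a * (G (u ++ s0 :: w) - (size (u ++ s0 :: w))%:R * b) =
   a * (G (rcons u s0) - (size (rcons u s0))%:R * b) + a * (Psi w - (size w)%:R * b).
Proof.
move=> HG u w su; rewrite HG// size_cat size_rcons /= addnS -addSn natrD; ring.
Qed.

Let centered_le (G : seq I -> R) C' (a b : R) : 0 <= C' -> (forall u, `|G u| <= C' * (size u).+1%:R) ->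
  forall u, `|a * (G u - (size u)%:R * b)| <= `|a| * (C' + `|b|) * (size u).+1%:R.
Proof.
move=> C0 HG u; rewrite normrM -mulrA ler_wpM2l// mulrDl.
apply: le_trans (ler_normB _ _) _; apply: lerD => //.
by rewrite normrM normr_nat mulrC ler_wpM2l// ler_nat.
Qed.

Lemma word_limit_theorems : exists2 sigma : R, 0 < sigma & exists L : R,
  forall G, additive_block G ->
  (forall c, (fun n => wsum p n (fun w =>
     ((G w - n%:R * L) / (sigma * Num.sqrt n%:R) <= c)%R%:R)) @ \oo --> Phi c) /\
  (forall e, 0 < e -> exists lam K : R, [/\ 0 < lam, 0 <= K & forall n,
     wsum p n (fun w => (e * n%:R < `|G w - n%:R * L|)%R%:R) <= K * expR (- lam * n%:R)]).
Proof.
pose N (u : seq I) : R := (size u).+1%:R; pose Y u := Psi (rcons u s0).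
have N_ge1 u : 1 <= N u by rewrite /N ler1n.
have N_ge0 u : 0 <= N u by rewrite /N.
have [lN [KN [KN0 NP]]] := @bsum_approx _ _ p s0 p_gt0 p_sum1 1 1 N isT ler01
  (fun u _ => ltac:(by rewrite mul1r expr1 ger0_norm)).
have [lY [KY [KY0 YP]]] := @bsum_approx _ _ p s0 p_gt0 p_sum1 1 (2 * C) Y isT
  (mulr_ge0 (ler0n _ 2) C_ge0) (fun u _ => ltac:(by rewrite expr1 ler_norm_rcons)).
have lN0 : 0 < lN.
  apply: lt_le_trans (bsum_le_limit p_gt0 N_ge0 KN0 NP 1).
  exact: (bsum_gt0 (u := [::])).
(* Renewal-reward: mean block value over mean block length, the unique choice for which [Z] has mean
   0. *)
pose L := lY / lN; pose Z u := Y u - L * N u.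
have ZP m : `|bsum p s0 m Z| <= (KY + `|L| * KN) * decay p s0 ^+ m.
  rewrite bsumB bsumZ (_ : _ - _ = (bsum p s0 m Y - lY) - L * (bsum p s0 m N - lN)); last first.
    by rewrite /L; field; rewrite gt_eqF.
  rewrite mulrDl; apply: le_trans (ler_normB _ _) _; apply: lerD => //.
  by rewrite normrM -mulrA ler_wpM2l.
pose D := 2 * C + `|L|; have D0 : 0 <= D by rewrite addr_ge0// mulr_ge0.
have Z_le u : `|Z u| <= D * N u.
  rewrite mulrDl; apply: le_trans (ler_normB _ _) _; apply: lerD; first exact: ler_norm_rcons.
  by rewrite normrM (ger0_norm (N_ge0 u)).
have [l2 [K2 [K20 Z2P]]] := @bsum_approx _ _ p s0 p_gt0 p_sum1 2 (D ^+ 2)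
  (fun u => Z u ^+ 2) isT (sqr_ge0 _) (fun u _ => ltac:(
    by rewrite normrX -exprMn lerXn2r ?nnegrE ?mulr_ge0 ?Z_le)).
have l20 : 0 < l2.
  (* A single word of positive weight with [Z u != 0] suffices, because truncated sums of squares
     increase to [l2]. *)
  have [u su Zu] := Psi_nondegenerate L.
  apply: lt_le_trans (bsum_le_limit p_gt0 (fun u => sqr_ge0 (Z u)) K20 Z2P (size u).+1).
  apply: bsum_gt0 => // [w|]; first exact: sqr_ge0.
  by rewrite exprn_even_gt0//= /Z subr_eq0.
(* About [n / lN] blocks occur among [n] letters, each of variance [l2]. *)
pose sigma := Num.sqrt (l2 / lN).
have s20 : 0 < l2 / lN by rewrite divr_gt0.
have sg0 : 0 < sigma by rewrite sqrtr_gt0.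
have s2 : sigma ^+ 2 = l2 / lN by rewrite sqr_sqrtr// ltW.
exists sigma => //; exists L => G [[C' C'0 G_le] G_add]; split=> [c|e e0].
  pose psi w := sigma^-1 * (Psi w - (size w)%:R * L).
  pose g w := sigma^-1 * (G w - (size w)%:R * L).
  have psiE u : psi (rcons u s0) = sigma^-1 * Z u.
    by rewrite /psi size_rcons [_ * L]mulrC.
  pose K0 := sigma^-1 * (KY + `|L| * KN) + (lN / l2 * K2 + KN).
  have sV0 : 0 <= sigma^-1 by rewrite invr_ge0 ltW.
  have h1 : 0 <= sigma^-1 * (KY + `|L| * KN) by rewrite mulr_ge0// addr_ge0// mulr_ge0.
  have h2 : 0 <= lN / l2 * K2 + KN by rewrite addr_ge0// mulr_ge0// ltW// divr_gt0.
  have Kd m (K K' : R) : 0 <= K' -> K * decay p s0 ^+ m <= (K + K') * decay p s0 ^+ m.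
    by move=> K'0; rewrite ler_wpM2r ?exprn_ge0// lerDl.
  have mean m : `|bsum p s0 m (fun u => psi (rcons u s0))| <= K0 * decay p s0 ^+ m.
    under [X in bsum _ _ _ X]eq_fun do rewrite psiE.
    rewrite bsumZ normrM (ger0_norm sV0).
    by apply: le_trans (Kd _ _ _ h2); rewrite -mulrA ler_wpM2l.
  have var m : `|bsum p s0 m (fun u => psi (rcons u s0) ^+ 2 - (size u).+1%:R)|
      <= K0 * decay p s0 ^+ m.
    under [X in bsum _ _ _ X]eq_fun do rewrite psiE exprMn exprVn s2.
    rewrite bsumB bsumZ (_ : _ - _ = lN / l2 * (bsum p s0 m (fun u => Z u ^+ 2) - l2)
      - (bsum p s0 m N - lN)); last by rewrite /N; field; rewrite !gt_eqF.
    rewrite /K0 (addrC (sigma^-1 * (KY + `|L| * KN))); apply: le_trans (Kd _ _ _ h1).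
    rewrite mulrDl; apply: le_trans (ler_normB _ _) _; apply: lerD => //.
    rewrite normrM gtr0_norm ?divr_gt0// -[leRHS]mulrA ler_wpM2l// ltW// divr_gt0//.
  have psi_add := centered_add sigma^-1 L Psi_add.
  have g_add := centered_add sigma^-1 L G_add.
  have psi_le := centered_le sigma^-1 L C_ge0 Psi_le.
  have g_le := centered_le sigma^-1 L C'0 G_le.
  have K00 : 0 <= K0 by rewrite addr_ge0.
  have [K Kge0 approx] := wsum_heat_approx_shift p_gt0 p_sum1 psi_add
    (mulr_ge0 (normr_ge0 _) (addr_ge0 C_ge0 (normr_ge0 _))) psi_le K00 mean var
    g_add (mulr_ge0 (normr_ge0 _) (addr_ge0 C'0 (normr_ge0 _))) g_le.
  have := @wsum_clt _ _ p g K (fun i => ltW (p_gt0 i)) p_sum1 Kge0 approx c.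
  rewrite (_ : (fun n => _) = (fun n => wsum p n (fun w =>
     ((G w - n%:R * L) / (sigma * Num.sqrt n%:R) <= c)%R%:R)))//.
  apply/funext => n; apply: eq_wsum => w wn _.
  have E : g w / Num.sqrt n%:R = (G w - n%:R * L) / (sigma * Num.sqrt n%:R).
    by rewrite /g wn invfM; ring.
  by rewrite E.
(* One-sided deviations. Centring at [b], half way to the deviation, leaves block drift
   [- (e / 2 * lN)], while on the event the centred value still exceeds [(e / 2) * n]; the bounded
   exponential moment then gives the rate as in Markov's inequality. *)
have side (eps : R) : eps = 1 \/ eps = -1 -> exists lam K : R, [/\ 0 < lam, 0 <= K & forall n,
     wsum p n (fun w => (e * n%:R < eps * (G w - n%:R * L))%R%:R) <= K * expR (- lam * n%:R)].
  move=> epsE; pose b := L + eps * (e / 2).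
  have eps2 : eps * eps = 1 by case: epsE => ->; rewrite ?mulr1 ?mulrNN ?mulr1.
  pose W w := eps * (Psi w - (size w)%:R * b); pose g w := eps * (G w - (size w)%:R * b).
  pose C2 := C + C' + `|b|.
  have eps1 : `|eps| = 1 by case: epsE => ->; rewrite ?normrN normr1.
  have C20 : 0 <= C2 by rewrite !addr_ge0.
  have W_le u : `|W u| <= C2 * (size u).+1%:R.
    apply: le_trans (centered_le _ _ C_ge0 Psi_le u) _; rewrite eps1 mul1r ler_wpM2r//.
    by rewrite lerD2r lerDl.
  have g_le u : `|g u| <= C2 * (size u).+1%:R.
    apply: le_trans (centered_le _ _ C'0 G_le u) _; rewrite eps1 mul1r ler_wpM2r//.
    by rewrite lerD2r lerDr.
  have drift m : `|bsum p s0 m (fun u => W (rcons u s0)) - - (e / 2 * lN)|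
      <= (KY + `|L| * KN + e / 2 * KN) * decay p s0 ^+ m.
    have WE u : W (rcons u s0) = eps * Z u - e / 2 * N u.
      rewrite /W size_rcons /b /Z /Y /N mulrBr [RHS](_ : _ =
        eps * Psi (rcons u s0) - eps * L * (size u).+1%:R - (eps * eps) * (e / 2) * (size u).+1%:R);
        last by rewrite eps2; ring.
      ring.
    under [X in bsum _ _ _ X]eq_fun do rewrite WE.
    rewrite bsumB !bsumZ opprK.
    rewrite (_ : _ + _ = eps * bsum p s0 m Z - e / 2 * (bsum p s0 m N - lN)); last by ring.
    have e20 : 0 < e / 2 by rewrite divr_gt0.
    rewrite mulrDl; apply: le_trans (ler_normB _ _) _.
    rewrite (normrM eps) (normrM (e / 2)) eps1 mul1r (gtr0_norm e20).
    by apply: lerD => //; rewrite -[leRHS]mulrA ler_wpM2l// ltW.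
  have l0 : - (e / 2 * lN) < 0 by rewrite oppr_lt0 mulr_gt0// divr_gt0.
  have K00 : 0 <= KY + `|L| * KN + e / 2 * KN.
    by rewrite !addr_ge0// mulr_ge0// divr_ge0// ltW.
  have [lam [K [lam0 Kge0 KP]]] := exp_moment_bounded p_gt0 p_sum1 C20
    (centered_add eps b Psi_add) W_le (centered_add eps b G_add) g_le l0 K00 drift.
  exists (lam * (e / 2)), K; split=> // [|n]; first by rewrite mulr_gt0// divr_gt0.
  apply: (@le_trans _ _ (wsum p n (fun w => expR (- (lam * (e / 2)) * n%:R) * expR (lam * g w)))).
    apply: ler_wsum => [i|w wn _]; first exact: ltW.
    case: (ltrP (e * n%:R)) => /= h; last by rewrite mulr_ge0 ?expR_ge0.
    rewrite -expRD -[leLHS]expR0 ler_expR /g wn /b.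
    rewrite (_ : _ + _ = lam * (eps * (G w - n%:R * L) - (e / 2) * n%:R
       - (eps * eps) * (e / 2) * n%:R)); last by ring.
    by rewrite eps2 mulr_ge0 ?(ltW lam0)//; lra.
  by rewrite wsumZ mulrC ler_wpM2r ?expR_ge0.
have [l1 [K1 [l10 K10 H1]]] := side 1 (or_introl erefl).
have [l3 [K3 [l30 K30 H3]]] := side (-1) (or_intror erefl).
exists (Num.min l1 l3), (K1 + K3); split; rewrite ?lt_min ?l10 ?addr_ge0// => n.
apply: (@le_trans _ _ (wsum p n (fun w => (e * n%:R < 1 * (G w - n%:R * L))%R%:R +
    (e * n%:R < -1 * (G w - n%:R * L))%R%:R))).
  apply: ler_wsum => [i|w _ _]; first exact: ltW.
  rewrite mul1r mulN1r; case: (lerP 0 (G w - n%:R * L)) => h.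
    by rewrite (ger0_norm h) lerDl.
  by rewrite (ltr0_norm h) lerDr.
rewrite wsumD mulrDl; apply: lerD.
  apply: le_trans (H1 n) _; rewrite ler_wpM2l// ler_expR ler_wpM2r//.
  by rewrite lerN2 ge_min lexx.
apply: le_trans (H3 n) _; rewrite ler_wpM2l// ler_expR ler_wpM2r//.
by rewrite lerN2 ge_min lexx orbT.
Qed.

End WordLimitTheorems.

(** * Dependence on the parameter *)

Section Sublevel.
Context {R : realType}.
Local Notation mu := (@lebesgue_measure R).

Lemma measurable_bigsetU_seq (J : Type) (r : seq J) (V : J -> set R) :
  (forall j, measurable (V j)) -> measurable (\big[setU/set0]_(j <- r) V j).
Proof. by move=> mV; apply: big_ind => // A B; exact: measurableU. Qed.

Lemma measure_bigsetU_le (J : Type) (r : seq J) (V : J -> set R) (c : R) :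
  (forall j, measurable (V j)) -> (forall j, (mu (V j) <= c%:E)%E) ->
  (mu (\big[setU/set0]_(j <- r) V j) <= ((size r)%:R * c)%:E)%E.
Proof.
move=> mV Vc; elim: r => [|j r IH]; first by rewrite big_nil measure0 mul0r.
have mr := measurable_bigsetU_seq r mV.
rewrite big_cons; apply: (le_trans (measureU2 mu (mV j) mr)).
by rewrite /= -natr1 mulrDl mul1r addrC EFinD leeD.
Qed.

(** On cells of length [1 / K] with [K > 2 M / kap] the derivative varies by at most [kap / 2], so
    between two points of the sublevel set in one cell it is at least [kap / 2], and these points
    are within [4 eps / kap]. Each cell thus needs one interval of length [8 eps / kap]. *)
Lemma sublevel_cover (h h1 : R -> R) (a M kap eps : R) :
  0 <= M -> 0 < kap -> 0 < eps ->
  (forall t, a <= t <= a + 1 -> is_derive t 1 h (h1 t)) ->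
  (forall t u, a <= t <= a + 1 -> a <= u <= a + 1 -> `|h1 t - h1 u| <= M * `|t - u|) ->
  (forall t, a <= t <= a + 1 -> `|h t| < eps -> kap <= `|h1 t|) ->
  exists V : set R, [/\ measurable V,
    forall t, a <= t <= a + 1 -> `|h t| < eps -> V t &
    (mu V <= ((2 * M / kap + 2) * (8 * eps / kap))%:E)%E].
Proof.
move=> M0 k0 e0 dh lip big.
pose K := (Num.truncn (2 * M / kap)).+1; pose d := 4 * eps / kap.
have d0 : 0 < d by rewrite divr_gt0// mulr_gt0.
have Mk0 : 0 <= 2 * M / kap by rewrite divr_ge0 ?mulr_ge0 ?(ltW k0).
have /andP[K1 K2] : (K.-1%:R : R) <= 2 * M / kap < K%:R by rewrite /K /= truncn_itv.
have Kp : 0 < K%:R :> R by rewrite ltr0n.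
pose J (i : nat) t := [/\ a <= t <= a + 1, `|h t| < eps & Num.truncn ((t - a) * K%:R) = i].
have close i t u : J i t -> J i u -> `|t - u| <= d.
  move=> [tL ht ti] [uL hu ui].
  have tu1 : `|t - u| * K%:R <= 1.
    have pos v : a <= v <= a + 1 -> 0 <= (v - a) * K%:R.
      by move=> /andP[av _]; rewrite mulr_ge0// subr_ge0.
    have := truncn_itv (pos t tL); have := truncn_itv (pos u uL); rewrite ti ui -natr1.
    move=> /andP[u1 u2] /andP[t1 t2].
    rewrite -[X in _ * X](ger0_norm (ltW Kp)) -normrM ler_norml mulrBl.
    by apply/andP; split; lra.
  wlog tu : t u tL uL ht hu ti ui tu1 / t <= u.
    move=> H; have [tu|ut] := leP t u; first exact: H.
    by rewrite distrC; apply: H => //; [rewrite distrC|exact: ltW].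
  have [||c c1 hc] := @MVT_segment _ h h1 t u tu _ _.
  - move=> x; rewrite in_itv/= => /andP[tx xu]; apply: dh.
    by move: tL uL => /andP[? ?] /andP[? ?]; apply/andP; split; lra.
  - apply: (is_derive_within (df := h1)) => x /andP[tx xu]; apply: dh.
    by move: tL uL => /andP[? ?] /andP[? ?]; apply/andP; split; lra.
  move: c1; rewrite in_itv/= => /andP[tc cu].
  have cL : a <= c <= a + 1.
    by move: tL uL => /andP[? ?] /andP[? ?]; apply/andP; split; lra.
  have hct : `|h1 t - h1 c| <= kap / 2.
    apply: le_trans (lip _ _ tL cL) _.
    have ct : `|t - c| <= `|t - u| by rewrite !ler0_norm; lra.
    apply: (@le_trans _ _ (M * `|t - u|)); first by rewrite ler_wpM2l.
    have tuK : `|t - u| <= K%:R^-1 by rewrite -[leRHS]mul1r ler_pdivlMr.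
    apply: (@le_trans _ _ (M / K%:R)); first by rewrite ler_wpM2l.
    by rewrite ler_pdivrMr//; move: K2; rewrite ltr_pdivrMr// => K2; lra.
  have hc1 : kap / 2 <= `|h1 c|.
    have := big t tL ht; rewrite (_ : h1 t = (h1 t - h1 c) + h1 c); last by ring.
    by move=> H; have := le_trans H (ler_normD _ _); lra.
  have hu2 : `|h u - h t| <= 2 * eps.
    by apply: le_trans (ler_normB _ _) _; lra.
  rewrite distrC /d ler_pdivlMr//.
  move: hu2; rewrite hc normrM => hu2.
  have := ler_wpM2r (normr_ge0 (u - t)) hc1; lra.
(* The centre is a point of the sublevel set itself; cells that do not meet it get the arbitrary
   centre 0. *)
have /choice [c cP] : forall i, exists c, forall t, J i t -> `|t - c| <= d.
  move=> i; have [[c Jc]|nJ] := pselect (exists c, J i c).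
    by exists c => t Jt; exact: close Jt Jc.
  by exists 0 => t Jt; exfalso; apply: nJ; exists t.
(* The extra index [K] belongs to the right endpoint [t = a + 1]. *)
pose V := \big[setU/set0]_(i <- iota 0 K.+1) [set` `[c i - d, c i + d]].
have mI i : mu [set` `[c i - d, c i + d]] = (8 * eps / kap)%:E.
  rewrite lebesgue_measure_itv/= lte_fin ifT; last by lra.
  by rewrite -EFinD; congr EFin; rewrite /d; lra.
exists V; split.
- by apply: measurable_bigsetU_seq => i; exact: measurable_itv.
- move=> t tL ht; pose i := Num.truncn ((t - a) * K%:R).
  have Jt : J i t by [].
  have iK : i \in iota 0 K.+1.
    rewrite mem_iota add0n /= ltnS -(ler_nat R).
    move: tL => /andP[ta tb]; apply: le_trans (_ : (t - a) * K%:R <= _).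
      by rewrite truncn_le mulr_ge0// subr_ge0.
    by rewrite ler_piMl// lerBlDl.
  rewrite /V (big_rem i)//=; left; rewrite /= in_itv/=.
  by have := cP i t Jt; rewrite ler_norml => /andP[? ?]; apply/andP; split; lra.
- apply: le_trans (measure_bigsetU_le (c := 8 * eps / kap) _ _ _) _.
  + by move=> i; exact: measurable_itv.
  + by move=> i; rewrite mI.
  rewrite size_iota lee_fin ler_wpM2r ?divr_ge0 ?mulr_ge0 ?(ltW k0) ?(ltW e0)//.
  by move: K1; rewrite /K /= -2!natr1; lra.
Qed.

End Sublevel.

(** * Coordinates, determinant and wedge in the plane *)

Section PlaneVectors.
Context {R : realType}.
Implicit Types (u v : 'cV[R]_2) (M : 'M[R]_2).

Definition nsq v : R := v 0 0 ^+ 2 + v 1 0 ^+ 2.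

Lemma nsq_ge0 v : 0 <= nsq v.
Proof. by rewrite addr_ge0// sqr_ge0. Qed.

Lemma vnorm_sqr v : vnorm v ^+ 2 = nsq v.
Proof. by rewrite sqr_sqrtr// nsq_ge0. Qed.

Lemma forall_ord2 (Q : 'I_2 -> Prop) : Q 0 -> Q 1 -> forall i, Q i.
Proof.
move=> q0 q1 [[|[|//]] Hi]; first by rewrite (_ : Ordinal Hi = 0)//; apply: val_inj.
by rewrite (_ : Ordinal Hi = 1)//; apply: val_inj.
Qed.

Lemma cV2P u v : u 0 0 = v 0 0 -> u 1 0 = v 1 0 -> u = v.
Proof.
by move=> h0 h1; apply/matrixP => i j; rewrite (ord1 j); move: i; apply: forall_ord2.
Qed.

Lemma nsq_eq0 v : (nsq v == 0) = (v == 0).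
Proof.
rewrite paddr_eq0 ?sqr_ge0// !sqrf_eq0; apply/andP/eqP => [[/eqP h0 /eqP h1]|->].
  by apply: cV2P; rewrite !mxE.
by rewrite !mxE.
Qed.

Lemma nsq_gt0 v : (0 < nsq v) = (v != 0).
Proof. by rewrite lt_def nsq_ge0 andbT nsq_eq0. Qed.

Lemma mulmx2 n M (N : 'M[R]_(2, n)) r j : (M *m N) r j = M r 0 * N 0 j + M r 1 * N 1 j.
Proof. by rewrite mxE !big_ord_recl big_ord0 addr0; congr (_ + M r _ * N _ j); apply: val_inj. Qed.

Lemma det2 M : \det M = M 0 0 * M 1 1 - M 0 1 * M 1 0.
Proof.
rewrite (expand_det_row _ 0) !big_ord_recl big_ord0 addr0 /cofactor !det_mx11 !mxE /=.
rewrite expr0 mul1r expr1 mulN1r mulrN; congr (_ * M _ _ - M _ _ * M _ _); exact: val_inj.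
Qed.

Lemma wedge_mulmx M u v : wedge (M *m u) (M *m v) = \det M * wedge u v.
Proof. by rewrite /wedge det2 !mulmx2; ring. Qed.

End PlaneVectors.

(** * Bounds uniform over the parameter interval *)

Section Regularity.
Context {R : realType} {k : nat}.
Variables (A : R -> 'I_k -> 'M[R]_2) (a : R).
Hypothesis smoothA : smooth_family A a.

Definition d2A t i : 'M[R]_2 := \matrix_(r, c) derive1n 2 (fun s => A s i r c) t.

Let itv t : a <= t <= a + 1 -> `[a, a + 1]%classic t. Proof. by rewrite /= in_itv. Qed.

Lemma is_derive_entry t i r c : a <= t <= a + 1 ->
  is_derive t 1 (fun s => A s i r c) (dA A t i r c).
Proof.
move=> /itv tL; have [U [_ /(_ _ tL) Ut HU]] := smoothA.
rewrite mxE; have := HU i r c 0%N t Ut; rewrite derive1n0 => H.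
by apply: DeriveDef => //; rewrite derive1E.
Qed.

Lemma is_derive_entry2 t i r c : a <= t <= a + 1 ->
  is_derive t 1 (fun s => dA A s i r c) (d2A t i r c).
Proof.
move=> /itv tL; have [U [_ /(_ _ tL) Ut HU]] := smoothA.
have -> : (fun s => dA A s i r c) = derive1n 1 (fun s => A s i r c).
  by apply/funext => s; rewrite mxE derive1n1.
rewrite mxE (derive1nS _ 1) derive1E; apply: DeriveDef => //; exact: HU.
Qed.

Lemma bounded_on_segment (f : R -> R) : (forall t, a <= t <= a + 1 -> derivable f t 1) ->
  exists2 K, 0 <= K & forall t, a <= t <= a + 1 -> `|f t| <= K.
Proof.
move=> df; have a1 : a <= a + 1 by lra.
have cf : {within `[a, a + 1], continuous f}.
  by apply: derivable_within_continuous => t; rewrite in_itv/=; exact: df.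
have [c _ cP] := EVT_max a1 cf; have [e _ eP] := EVT_min a1 cf.
exists (`|f c| + `|f e|); first by rewrite addr_ge0.
move=> t tL; have tI : t \in `[a, a + 1] by rewrite in_itv.
have h1 := cP t tI; have h2 := eP t tI.
have h3 := ler_norm (f c); have h4 := ler_norm (- f e); rewrite normrN in h4.
have := normr_ge0 (f c); have := normr_ge0 (f e).
by rewrite ler_norml => ? ?; apply/andP; split; lra.
Qed.


Lemma bounded_entries : exists2 K, 1 <= K & forall t i r c, a <= t <= a + 1 ->
  [/\ `|A t i r c| <= K, `|dA A t i r c| <= K & `|d2A t i r c| <= K].
Proof.
have ex (irc : 'I_k * 'I_2 * 'I_2) : exists K, 0 <= K /\ forall t, a <= t <= a + 1 ->
    [/\ `|A t irc.1.1 irc.1.2 irc.2| <= K, `|dA A t irc.1.1 irc.1.2 irc.2| <= K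
      & `|d2A t irc.1.1 irc.1.2 irc.2| <= K].
  case: irc => -[i r] c /=.
  have [K0 K00 H0] := @bounded_on_segment (fun s => A s i r c)
    (fun t tL => @ex_derive _ _ _ _ _ _ _ (is_derive_entry i r c tL)).
  have [K1 K10 H1] := @bounded_on_segment (fun s => dA A s i r c)
    (fun t tL => @ex_derive _ _ _ _ _ _ _ (is_derive_entry2 i r c tL)).
  have d3 t : a <= t <= a + 1 -> derivable (fun s => d2A s i r c) t 1.
    move=> /itv tL; have [U [_ /(_ _ tL) Ut HU]] := smoothA.
    have -> : (fun s => d2A s i r c) = derive1n 2 (fun s => A s i r c).
      by apply/funext => s; rewrite mxE.
    exact: HU.
  have [K2 K20 H2] := @bounded_on_segment (fun s => d2A s i r c) d3.
  exists (K0 + K1 + K2); split=> [|t tL]; first by rewrite !addr_ge0.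
  by split; [apply: le_trans (H0 t tL) _|apply: le_trans (H1 t tL) _|
    apply: le_trans (H2 t tL) _]; lra.
have [K KP] := choice ex.
exists (1 + \sum_j K j); first by rewrite lerDl sumr_ge0// => j _; have [] := KP j.
move=> t i r c tL; have [_ /(_ t tL) /= [h0 h1 h2]] := KP (i, r, c).
have KS : K (i, r, c) <= 1 + \sum_j K j.
  rewrite (bigD1 (i, r, c))//= addrCA lerDl addr_ge0// sumr_ge0// => j _.
  by have [] := KP j.
by split; [apply: le_trans h0 _|apply: le_trans h1 _|apply: le_trans h2 _].
Qed.

Lemma det_lower_bound (S : {set 'I_k}) :
  (forall t j, a <= t <= a + 1 -> j \notin S -> 0 < \det (A t j)) ->
  exists2 d0, 0 < d0 & forall t j, a <= t <= a + 1 -> j \notin S -> d0 <= \det (A t j).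
Proof.
move=> dpos; have a1 : a <= a + 1 by lra.
have ex (j : 'I_k) : exists d, 0 < d /\ forall t, a <= t <= a + 1 -> j \notin S -> d <= \det (A t j).
  have [jS|jS] := boolP (j \in S); first by exists 1.
  have cf : {within `[a, a + 1], continuous (fun t => \det (A t j))}.
    apply: derivable_within_continuous => t; rewrite in_itv/= => tL.
    under eq_fun do rewrite det2.
    have E r c := is_derive_entry j r c tL.
    have dN : is_derive t 1 (fun s => -1 * (A s j 0 1 * A s j 1 0)) _ :=
      is_derive1M (is_derive1_cst (-1) t) (is_derive1M (E 0 1) (E 1 0)).
    have := @ex_derive _ _ _ _ _ _ _ (is_derive1D (is_derive1M (E 0 0) (E 1 1)) dN).
    by under eq_fun do rewrite mulN1r.
  have [c cI cP] := EVT_min a1 cf; exists (\det (A c j)); split=> [|t tL _].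
    by apply: dpos => //; move: cI; rewrite in_itv.
  by apply: cP; rewrite in_itv.
have [d dP] := choice ex.
exists (\big[Num.min/1]_j d j).
  by elim/big_ind: _ => // [x y x0 y0|j _]; [rewrite lt_min x0|have [] := dP j].
move=> t j tL jS; have [_ H] := dP j; apply: le_trans (H t tL jS).
by rewrite (bigD1 j)//= ge_min lexx.
Qed.

End Regularity.

(** * Parameter derivatives of word products *)

Section Parametric.
Context {R : realType} {k : nat}.
Variables (A : R -> 'I_k -> 'M[R]_2) (a c0 : R) (S : {set 'I_k}).
Hypothesis smoothA : smooth_family A a.
Hypothesis det_gt0 : forall t j, a <= t <= a + 1 -> j \notin S -> 0 < \det (A t j).
Hypothesis c0_gt0 : 0 < c0.
Hypothesis twist : forall t j (v : 'cV[R]_2), a <= t <= a + 1 -> j \notin S -> v != 0 ->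
  c0 <= wedge (A t j *m v) (dA A t j *m v) / vnorm (A t j *m v) ^+ 2.
Local Notation inv := (fun j => j \notin S).

Lemma word_prod_rcons t w j : word_prod A t (rcons w j) = A t j *m word_prod A t w.
Proof. by rewrite /word_prod foldl_rcons. Qed.

(** The adjugate recovers [det * v] from [A t j *m v]; its entries are at most [K], so
    [det ^+ 2 * |v|^2 <= 4 K^2 |A v|^2]. *)
Lemma nsq_lower_bound : exists2 kap, 0 < kap <= 1 & forall t j v,
  a <= t <= a + 1 -> j \notin S -> kap * nsq v <= nsq (A t j *m v).
Proof.
have [K K1 KP] := bounded_entries smoothA.
have [d0 d00 dP] := det_lower_bound smoothA det_gt0.
have K0 : 0 < K by exact: lt_le_trans K1.
pose q := d0 ^+ 2 / (4 * K ^+ 2).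
have q0 : 0 < q by rewrite divr_gt0 ?mulr_gt0 ?exprn_gt0.
exists (Num.min q 1); first by rewrite lt_min q0 ltr01 ge_min lexx orbT.
move=> t j v tL jS; apply: (@le_trans _ _ (q * nsq v)).
  by rewrite ler_wpM2r ?nsq_ge0// ge_min lexx.
rewrite mulrAC ler_pdivrMr ?mulr_gt0 ?exprn_gt0//.
have dd : d0 ^+ 2 <= \det (A t j) ^+ 2.
  by have d1 := dP t j tL jS; rewrite lerXn2r ?nnegrE ?(ltW d00)// (le_trans (ltW d00)).
apply: (@le_trans _ _ (\det (A t j) ^+ 2 * nsq v)); first by rewrite ler_wpM2r ?nsq_ge0.
have sq r c : A t j r c ^+ 2 <= K ^+ 2.
  have [h _ _] := KP t j r c tL; rewrite -(real_normK (num_real _)).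
  by rewrite lerXn2r ?nnegrE ?(ltW K0).
have := sq 0 0; have := sq 0 1; have := sq 1 0; have := sq 1 1.
rewrite /nsq det2 !mulmx2; set u0 := A t j 0 0 * _ + _; set u1 := A t j 1 0 * _ + _.
move: (A t j 0 0) (A t j 0 1) (A t j 1 0) (A t j 1 1) @u0 @u1 => p q' r s /= h1 h2 h3 h4.
set v0 := v 0 0; set v1 := v 1 0; set u0 := p * v0 + q' * v1; set u1 := r * v0 + s * v1.
have -> : (p * s - q' * r) ^+ 2 * (v0 ^+ 2 + v1 ^+ 2) =
    (s * u0 - q' * u1) ^+ 2 + (- r * u0 + p * u1) ^+ 2 by rewrite /u0 /u1; ring.
have CS (x y : R) : x ^+ 2 <= K ^+ 2 -> y ^+ 2 <= K ^+ 2 ->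
    (x * u0 + y * u1) ^+ 2 <= 2 * K ^+ 2 * (u0 ^+ 2 + u1 ^+ 2).
  move=> hx hy; have Ku : (x ^+ 2 + y ^+ 2) * (u0 ^+ 2 + u1 ^+ 2)
      <= 2 * K ^+ 2 * (u0 ^+ 2 + u1 ^+ 2).
    by rewrite ler_wpM2r ?addr_ge0 ?sqr_ge0//; lra.
  apply: le_trans Ku; rewrite -subr_ge0.
  by rewrite (_ : _ - _ = (x * u1 - y * u0) ^+ 2) ?sqr_ge0//; ring.
have := CS s (- q') h1; rewrite sqrrN => /(_ h3).
have := CS (- r) p; rewrite sqrrN => /(_ h2 h4).
by rewrite mulNr; lra.
Qed.

(** For [z = A y] the product rule gives [z /\ z' = A y /\ A' y + det A (y /\ y')]. The first term
    is at least [c0 |z|^2] by the twist, the second is nonnegative by induction, so rotation by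
    earlier letters is never undone. The empty word does not rotate, whence the value 0 there. *)
Lemma word_jets : exists K kap : R, [/\ 1 <= K, 0 < kap <= 1 &
  forall (x : 'cV[R]_2) (w : seq 'I_k), x != 0 -> exists z1 z2 : R -> 'cV[R]_2,
  forall t, a <= t <= a + 1 -> let z := word_prod A t w *m x in
    [/\ forall r, is_derive t 1 (fun s => (word_prod A s w *m x) r 0) (z1 t r 0),
        forall r, is_derive t 1 (fun s => z1 s r 0) (z2 t r 0),
        forall r, [/\ `|z r 0| <= (`|x 0 0| + `|x 1 0|) * K ^+ size w,
                      `|z1 t r 0| <= (`|x 0 0| + `|x 1 0|) * K ^+ size w &
                      `|z2 t r 0| <= (`|x 0 0| + `|x 1 0|) * K ^+ size w] &
        all inv w -> kap ^+ size w * nsq x <= nsq z /\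
                     (if nilp w then 0 else c0) * nsq z <= wedge z (z1 t)]].
Proof.
have [K K1 KP] := bounded_entries smoothA.
have [kap /andP[kap0 kap1] kapP] := nsq_lower_bound.
(* A second derivative of a product has four terms, and each matrix-vector term costs a factor
   [2 * K]. *)
exists (8 * K), kap; split; [lra|by rewrite kap0|move=> x w x0].
set X := `|x 0 0| + `|x 1 0|; have X0 : 0 <= X by rewrite addr_ge0.
elim/last_ind: w => [|w j [z1 [z2 IH]]].
  exists (fun=> 0), (fun=> 0) => t tL /=; rewrite /word_prod/= mul1mx expr0 !mulr1 !mul1r.
  split.
  - by move=> r; rewrite mxE; exact: is_derive1_cst.
  - by move=> r; rewrite mxE; exact: is_derive1_cst.
  - apply: forall_ord2; split; rewrite ?mxE ?normr0// ?lerDl ?lerDr//.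
  - by move=> _; rewrite mul0r /wedge !mxE !mulr0 subrr.
exists (fun t => dA A t j *m (word_prod A t w *m x) + A t j *m z1 t),
  (fun t => (d2A A t j *m (word_prod A t w *m x) + dA A t j *m z1 t)
     + (dA A t j *m z1 t + A t j *m z2 t)) => t tL z.
have [D1 D2 bd low] := IH t tL.
have mulD (F G : R -> 'M[R]_2) (f g : R -> 'cV[R]_2) r :
    (forall c, is_derive t 1 (fun s => F s r c) (G t r c)) ->
    (forall c, is_derive t 1 (fun s => f s c 0) (g t c 0)) ->
    is_derive t 1 (fun s => (F s *m f s) r 0) ((G t *m f t + F t *m g t) r 0).
  move=> HF Hf; under eq_fun do rewrite mulmx2.
  apply: (is_derive_eq (is_derive1D (is_derive1M (HF 0) (Hf 0)) (is_derive1M (HF 1) (Hf 1)))).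
  by rewrite [RHS]mxE !mulmx2; ring.
have addE (u v : 'cV[R]_2) r : (u + v) r 0 = u r 0 + v r 0 by rewrite mxE.
have zE s : word_prod A s (rcons w j) *m x = A s j *m (word_prod A s w *m x).
  by rewrite word_prod_rcons mulmxA.
have dz r : is_derive t 1 (fun s => (word_prod A s w *m x) r 0) (z1 t r 0) by [].
split.
- move=> r; under eq_fun do rewrite zE.
  by apply: (mulD (A ^~ j) (dA A ^~ j) (fun s => word_prod A s w *m x) z1) => // c;
    exact: (is_derive_entry smoothA j r c tL).
- move=> r.
  have H1 := mulD (dA A ^~ j) (d2A A ^~ j) (fun s => word_prod A s w *m x) z1 r
    (fun c => is_derive_entry2 smoothA j r c tL) dz.
  have H2 := mulD (A ^~ j) (dA A ^~ j) z1 z2 r (fun c => is_derive_entry smoothA j r c tL) D2.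
  rewrite addE; under eq_fun do rewrite addE; exact: (is_derive1D H1 H2).
- move=> r; set XK := X * (8 * K) ^+ size w.
  have XK0 : 0 <= XK by rewrite mulr_ge0// exprn_ge0//; lra.
  have b2 (M : 'M[R]_2) (v : 'cV[R]_2) : (forall c, `|M r c| <= K) ->
      (forall c, `|v c 0| <= XK) -> `|(M *m v) r 0| <= 2 * K * XK.
    move=> HM Hv; rewrite mulmx2; apply: le_trans (ler_normD _ _) _; rewrite !normrM.
    have := ler_pM (normr_ge0 _) (normr_ge0 _) (HM 0) (Hv 0).
    have := ler_pM (normr_ge0 _) (normr_ge0 _) (HM 1) (Hv 1); lra.
  have Ab c : `|A t j r c| <= K by have [] := KP t j r c tL.
  have dAb c : `|dA A t j r c| <= K by have [] := KP t j r c tL.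
  have d2Ab c : `|d2A A t j r c| <= K by have [] := KP t j r c tL.
  have zb c : `|(word_prod A t w *m x) c 0| <= XK by have [] := bd c.
  have z1b c : `|z1 t c 0| <= XK by have [] := bd c.
  have z2b c : `|z2 t c 0| <= XK by have [] := bd c.
  have KX : 0 <= K * XK by rewrite mulr_ge0//; lra.
  rewrite size_rcons exprS mulrCA -/XK; split.
  + by rewrite /z zE; apply: le_trans (b2 _ _ Ab zb) _; lra.
  + rewrite addE; apply: le_trans (ler_normD _ _) _.
    by apply: le_trans (lerD (b2 _ _ dAb zb) (b2 _ _ Ab z1b)) _; lra.
  + rewrite !addE; apply: le_trans (ler_normD _ _) _.
    apply: le_trans (lerD (ler_normD _ _) (ler_normD _ _)) _.
    apply: le_trans (lerD (lerD (b2 _ _ d2Ab zb) (b2 _ _ dAb z1b))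
      (lerD (b2 _ _ dAb z1b) (b2 _ _ Ab z2b))) _; lra.
- rewrite all_rcons => /andP[jS wS]; have [low1 low2] := low wS.
  have x0' : 0 < nsq x by rewrite nsq_gt0.
  have zw0 : 0 < nsq (word_prod A t w *m x).
    by apply: lt_le_trans low1; rewrite mulr_gt0// exprn_gt0.
  have zk := kapP t j (word_prod A t w *m x) tL jS.
  have z0 : 0 < nsq z by rewrite /z zE; apply: lt_le_trans zk; rewrite mulr_gt0.
  split.
    rewrite size_rcons exprS -mulrA /z zE; apply: le_trans zk.
    by rewrite ler_wpM2l// ltW.
  have -> : nilp (rcons w j) = false by rewrite /nilp size_rcons.
  have -> : forall u, wedge z (u + A t j *m z1 t) =
      wedge z u + \det (A t j) * wedge (word_prod A t w *m x) (z1 t).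
    by move=> u; rewrite -wedge_mulmx /z zE /wedge !mxE; ring.
  have w0 : 0 <= wedge (word_prod A t w *m x) (z1 t).
    by apply: le_trans low2; rewrite mulr_ge0 ?(ltW zw0)//; case: ifP => // _; exact: ltW.
  rewrite -[leLHS]addr0; apply: lerD; last by rewrite mulr_ge0// ltW// det_gt0.
  have := twist tL jS (v := word_prod A t w *m x); rewrite -nsq_gt0 => /(_ zw0).
  by rewrite vnorm_sqr -zE -/z ler_pdivlMr.
Qed.

End Parametric.

(** * Exceptional parameters for small values of [l A_t(w) x] *)

Section Nonvanishing.
Context {R : realType} {k : nat}.
Variables (A : R -> 'I_k -> 'M[R]_2) (a c0 : R) (S : {set 'I_k}).
Hypothesis smoothA : smooth_family A a.
Hypothesis det_gt0 : forall t j, a <= t <= a + 1 -> j \notin S -> 0 < \det (A t j).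
Hypothesis c0_gt0 : 0 < c0.
Hypothesis twist : forall t j (v : 'cV[R]_2), a <= t <= a + 1 -> j \notin S -> v != 0 ->
  c0 <= wedge (A t j *m v) (dA A t j *m v) / vnorm (A t j *m v) ^+ 2.
Local Notation inv := (fun j => j \notin S).
Local Notation mu := (@lebesgue_measure R).

Lemma row_mulmx2 (l : 'rV[R]_2) (v : 'cV[R]_2) :
  (l *m v) 0 0 = l 0 0 * v 0 0 + l 0 1 * v 1 0.
Proof. by rewrite mxE !big_ord_recl big_ord0 addr0; congr (_ + l _ _ * v _ _); apply: val_inj. Qed.

Lemma norm_combination (x y u v B : R) : `|u| <= B -> `|v| <= B ->
  `|x * u + y * v| <= (`|x| + `|y|) * B.
Proof.
move=> uB vB; apply: le_trans (ler_normD _ _) _.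
by rewrite mulrDl !normrM; apply: lerD; exact: ler_wpM2l.
Qed.

Lemma rV2_norm_gt0 (l : 'rV[R]_2) : l != 0 -> 0 < `|l 0 0| + `|l 0 1|.
Proof.
move=> l0; rewrite lt_def addr_ge0// andbT paddr_eq0// !normr_eq0.
apply: contraNN l0 => /andP[/eqP h0 /eqP h1]; apply/eqP/trmx_inj.
by apply: cV2P; rewrite !mxE.
Qed.

(* With [q] the component of [z] along [ker l], [|l|^2 (z /\ z') = h q' - q h'] for [h = l z]:
   where [h] is small, [|h'|] is bounded below. *)
Lemma word_cover (l : 'rV[R]_2) (x : 'cV[R]_2) : l != 0 -> x != 0 ->
  exists g rho E c1 : R, [/\ 0 < g, 0 < rho <= 1, 1 <= E, 0 <= c1 &
  forall (w : seq 'I_k) (eps : R), w != [::] -> all inv w ->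
    0 < eps <= g * rho ^+ size w ->
    exists V : set R, [/\ measurable V,
      forall t, a <= t <= a + 1 -> `|(l *m (word_prod A t w *m x)) 0 0| < eps -> V t &
      (mu V <= (c1 * E ^+ size w * eps)%:E)%E]].
Proof.
move=> l0 x0; have [K [kap [K1 /andP[k0 k1] jets]]] := word_jets smoothA det_gt0 c0_gt0 twist.
set Lq := `|l 0 0| + `|l 0 1|; have Lq0 : 0 < Lq by exact: rV2_norm_gt0.
set X := `|x 0 0| + `|x 1 0|.
have X0 : 0 < X.
  have := @rV2_norm_gt0 x^T; rewrite !mxE; apply.
  by apply: contraNN x0 => /eqP h; rewrite -[x]trmxK h trmx0.
pose nl := l 0 0 ^+ 2 + l 0 1 ^+ 2.
have nl0 : 0 < nl.
  rewrite lt_def addr_ge0 ?sqr_ge0// andbT; apply/eqP => h.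
  have /eqP := h; rewrite paddr_eq0 ?sqr_ge0// !sqrf_eq0 => /andP[/eqP h0 /eqP h1].
  by move: Lq0; rewrite /Lq h0 h1 normr0 addr0 ltxx.
have nx0 : 0 < nsq x by rewrite nsq_gt0.
have K0 : 0 < K by exact: lt_le_trans K1.
pose m0 := Lq * X; have m00 : 0 < m0 by rewrite mulr_gt0.
(* Chosen so that the wedge estimate reads [2 * g * rho ^+ n <= eps + |h1|]; then
   [eps <= g * rho ^+ n] leaves the same amount for [|h1|]. *)
pose g := c0 * nl * nsq x / m0 / 2.
have g0 : 0 < g by rewrite divr_gt0// divr_gt0// !mulr_gt0.
pose rho := kap / K.
have rho0 : 0 < rho by rewrite divr_gt0.
have rho1 : rho <= 1 by rewrite ler_pdivrMr// mul1r (le_trans k1).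
(* One [rho] comes from the number of cells, of order [(K / rho) ^+ n], the other from the length
   [eps / rho ^+ n] of each interval. *)
pose E := K / rho / rho.
have Kr : 1 <= K / rho by rewrite ler_pdivlMr// mul1r (le_trans rho1).
have E1 : 1 <= E by rewrite ler_pdivlMr// mul1r (le_trans rho1).
exists g, rho, E, ((2 * m0 / g + 2) * (8 / g)); split=> //.
- by rewrite rho0.
- apply/ltW/mulr_gt0; last exact: divr_gt0.
  by apply: addr_gt0 => //; apply: divr_gt0 => //; exact: mulr_gt0.
move=> w eps wn wS /andP[eps0 epsg].
have [z1 [z2 J]] := jets x w x0.
set n := size w in J epsg *.
pose h (t : R) : R := (l *m (word_prod A t w *m x)) 0 0.
pose h1 (t : R) : R := (l *m z1 t) 0 0; pose h2 (t : R) : R := (l *m z2 t) 0 0.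
have lin (f f' : R -> 'cV[R]_2) (t : R) : (forall r, is_derive t 1 (fun s => f s r 0) (f' t r 0)) ->
    is_derive t 1 (fun s => (l *m f s) 0 0) ((l *m f' t) 0 0).
  move=> H; under eq_fun do rewrite row_mulmx2.
  apply: (is_derive_eq (is_derive1D (is_derive1M (is_derive1_cst (l 0 0) t) (H 0))
    (is_derive1M (is_derive1_cst (l 0 1) t) (H 1)))).
  by rewrite row_mulmx2; ring.
have Kn0 : 0 < K ^+ n by rewrite exprn_gt0.
have rn0 : 0 < rho ^+ n by rewrite exprn_gt0.
have kn0 : 0 < kap ^+ n by rewrite exprn_gt0.
have pair_le (v : 'cV[R]_2) : (forall r, `|v r 0| <= X * K ^+ n) ->
    `|(l *m v) 0 0| <= m0 * K ^+ n /\ `|- l 0 1 * v 0 0 + l 0 0 * v 1 0| <= m0 * K ^+ n.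
  move=> Hv; rewrite row_mulmx2 /m0 /Lq.
  rewrite -mulrA -[`|l 0 1|]normrN; split; first by rewrite normrN; exact: norm_combination.
  by rewrite [`|_| + _]addrC; exact: norm_combination.
have low t : a <= t <= a + 1 -> `|h t| < eps -> g * rho ^+ n <= `|h1 t|.
  move=> tL ht; have [_ _ bd /(_ wS) [zlow wlow]] := J t tL.
  move: wlow; rewrite (_ : nilp w = false) => [wlow|]; last by case: (w) wn.
  set z := word_prod A t w *m x in bd zlow wlow.
  have [_ q_le] := pair_le z (fun r => let: And3 h _ _ := bd r in h).
  have [_ q1_le] := pair_le (z1 t) (fun r => let: And3 _ h _ := bd r in h).
  set q := - l 0 1 * z 0 0 + _ in q_le; set q1 := - l 0 1 * z1 t 0 0 + _ in q1_le.
  have key : nl * wedge z (z1 t) = h t * q1 - q * h1 t.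
    by rewrite /h /h1 !row_mulmx2 -/z /nl /wedge /q /q1; ring.
  have h3 : c0 * nl * (kap ^+ n * nsq x) <= m0 * K ^+ n * (eps + `|h1 t|).
    apply: (@le_trans _ _ (nl * wedge z (z1 t))).
      rewrite [c0 * nl]mulrC -mulrA ler_wpM2l ?(ltW nl0)//.
      by apply: le_trans wlow; rewrite ler_wpM2l// ltW.
    rewrite key; apply: le_trans (ler_norm _) _; apply: le_trans (ler_normB _ _) _.
    rewrite !normrM mulrDr; apply: lerD; last by rewrite ler_wpM2r.
    by rewrite mulrC; apply: ler_pM => //; exact: ltW.
  have h4 : c0 * nl * (kap ^+ n * nsq x) = m0 * K ^+ n * (2 * (g * rho ^+ n)).
    by rewrite /g /rho exprMn exprVn; field; rewrite !gt_eqF.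
  move: h3; rewrite h4 ler_pM2l ?mulr_gt0// => h3; clear -h3 epsg; lra.
have hL t : a <= t <= a + 1 -> is_derive t 1 h (h1 t).
  by move=> tL; have [D1 _ _ _] := J t tL; exact: (lin (fun s => word_prod A s w *m x) z1).
have M0 : 0 <= m0 * K ^+ n by rewrite mulr_ge0 ?ltW.
have lip t u : a <= t <= a + 1 -> a <= u <= a + 1 ->
    `|h1 t - h1 u| <= m0 * K ^+ n * `|t - u|.
  move=> tL uL; apply: (mvt_bound (df := h2)) => s /(segment_between uL tL) sL.
    by have [_ D2 _ _] := J s sL; exact: (lin z1 z2).
  have [_ _ bd _] := J s sL.
  by have [] := pair_le (z2 s) (fun r => let: And3 _ _ h := bd r in h).
have kn : 0 < g * rho ^+ n by rewrite mulr_gt0.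
have [V [mV Vc Vmu]] := sublevel_cover M0 kn eps0 hL lip low.
exists V; split => //; apply: le_trans Vmu _; rewrite lee_fin.
rewrite (_ : _ * E ^+ n * eps = ((2 * m0 / g + 2) * (K / rho) ^+ n) * (8 * eps / (g * rho ^+ n))); last first.
  by rewrite /E exprMn [in LHS]exprVn; field; rewrite !gt_eqF.
apply: ler_wpM2r; first by apply/ltW/divr_gt0 => //; exact: mulr_gt0.
rewrite [leRHS]mulrDl; apply: lerD; last by rewrite ler_peMr// exprn_ege1.
rewrite (expr_div_n K rho) le_eqVlt; apply/orP; left; apply/eqP.
by field; rewrite !gt_eqF.
Qed.

(** The rate [beta] is the same for all parameters; only [eta] depends on [t]. A parameter is
    exceptional when it is bad for every [eta m], and the bad sets have measure of order [eta m]. *)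
Lemma ae_nonvanishing (l : 'rV[R]_2) (x : 'cV[R]_2) : l != 0 -> x != 0 ->
  exists2 beta, 0 < beta <= 1 & {ae mu, forall t, a <= t <= a + 1 -> exists2 eta, 0 < eta &
    forall w, w != [::] -> all inv w ->
      eta * beta ^+ size w <= `|(l *m (word_prod A t w *m x)) 0 0| }.
Proof.
move=> l0 x0; have [g [rho [E [c1 [g0 /andP[rho0 rho1] E1 c10 cov]]]]] := word_cover l0 x0.
have E0 : 0 < E by exact: lt_le_trans E1.
(* There are [k ^ n] words of length [n], each costing [E ^+ n * beta ^+ n]; this [D] gives
   [k * E * beta <= 1/2], so the lengths sum geometrically. *)
pose D : R := 2 * k.+1%:R * E.
have D1 : 1 <= D by rewrite /D mulr_ege1// mulr_ege1// ler1n.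
have D0 : 0 < D by exact: lt_le_trans D1.
pose beta := rho / D; have b0 : 0 < beta by rewrite divr_gt0.
have br : beta <= rho by rewrite ler_pdivrMr// ler_peMr// ltW.
exists beta; first by rewrite b0 (le_trans br).
pose eta (m : nat) := g / m.+1%:R.
have eta0 m : 0 < eta m by rewrite divr_gt0.
have etag m : eta m <= g by rewrite ler_pdivrMr// ler_peMr ?(ltW g0)// ler1n.
have /choice [V VP] : forall mw : nat * seq 'I_k, exists V : set R, [/\ measurable V,
    mw.2 != [::] -> all inv mw.2 -> forall t, a <= t <= a + 1 ->
      `|(l *m (word_prod A t mw.2 *m x)) 0 0| < eta mw.1 * beta ^+ size mw.2 -> V t &
    (mu V <= (c1 * E ^+ size mw.2 * (eta mw.1 * beta ^+ size mw.2))%:E)%E].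
  case=> m w /=; have e0 : 0 < eta m * beta ^+ size w by rewrite mulr_gt0// exprn_gt0.
  have [/andP[wn wS]|nw] := boolP ((w != [::]) && all inv w).
    have [|V [mV VC Vmu]] := cov w (eta m * beta ^+ size w) wn wS.
      rewrite e0 /=; apply: ler_pM => //; rewrite ?exprn_ge0 ?(ltW b0) ?(ltW (eta0 m))//.
      by rewrite lerXn2r ?nnegrE ?(ltW b0) ?(ltW rho0).
    by exists V.
  exists set0; split=> [|h1 h2|]; first exact: measurable0.
    by move: nw; rewrite h1 h2.
  by rewrite measure0 lee_fin mulr_ge0 ?(ltW e0)// mulr_ge0// exprn_ge0// ltW.
pose W m n := \big[setU/set0]_(w <- enum {: n.-tuple 'I_k}) V (m, val w).
have mW m n : measurable (W m n).
  by apply: measurable_bigsetU_seq => w; have [] := VP (m, val w).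
have muW m n : (mu (W m n) <= (2 * c1 * eta m / (2 ^ n.+1)%:R)%:E)%E.
  apply: le_trans (measure_bigsetU_le (c := c1 * E ^+ n * (eta m * beta ^+ n)) _ _ _) _.
  - by move=> w; have [] := VP (m, val w).
  - by move=> w; have [_ _] := VP (m, val w); rewrite /= size_tuple.
  rewrite -cardE card_tuple card_ord lee_fin expnS natrM natrX natrX.
  rewrite (_ : 2 * c1 * eta m / (2 * 2 ^+ n) = c1 * eta m * (2^-1) ^+ n); last first.
    by rewrite exprVn; field; rewrite expf_neq0.
  rewrite (_ : _ * _ = c1 * eta m * (k%:R * E * beta) ^+ n); last first.
    by rewrite !exprMn; ring.
  apply: ler_wpM2l; first by apply: mulr_ge0 => //; exact: ltW.
  apply: lerXn2r; rewrite ?nnegrE//.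
    by apply: mulr_ge0; [apply: mulr_ge0 => //|]; exact: ltW.
  rewrite /beta /D mulrA ler_pdivrMr ?mulr_gt0// (_ : 2^-1 * _ = k.+1%:R * E); last by field.
  apply: (@le_trans _ _ (k%:R * E)); first by rewrite ler_piMr// mulr_ge0// ltW.
  by rewrite ler_wpM2r ?(ltW E0)// ler_nat.
pose B m := \bigcup_n W m n.
have mB m : measurable (B m) by exact: bigcup_measurable.
have muB m : (mu (B m) <= (2 * c1 * eta m)%:E)%E.
  apply: le_trans (measure_sigma_subadditive mu (mW m) (mB m) (@subset_refl _ _)) _.
  apply: (@le_trans _ _ (\sum_(0 <= n <oo) (0 + (2 * c1 * eta m / (2 ^ n.+1)%:R)%:E))%E).
    by apply: lee_nneseries => [*|n *]; [exact: measure_ge0|rewrite add0e; exact: muW].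
  apply: le_trans (epsilon_trick _ _ _) _ => //.
    by rewrite !mulr_ge0// ltW.
  by rewrite eseries0 ?add0e// => n _.
exists (\bigcap_m B m); split.
- exact: bigcapT_measurable.
- apply/eqP; rewrite eq_le measure_ge0 andbT; apply/lee_addgt0Pr => e e0; rewrite add0e.
  pose m := Num.truncn (2 * c1 * g / e).
  apply: (@le_trans _ _ (mu (B m))).
    apply: le_measure; rewrite ?inE//; [exact: bigcapT_measurable|exact: mB|].
    by move=> u Hu; exact: (Hu m Logic.I).
  apply: le_trans (muB m) _; rewrite lee_fin /eta mulrA ler_pdivrMr// [leRHS]mulrC -ler_pdivrMr//.
  exact/ltW/truncnS_gt.
- move=> t /= nt m _; apply: contrapT => nB; apply: nt => tL.
  exists (eta m) => // w wn wS; rewrite leNgt; apply/negP => hw; apply: nB.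
  exists (size w) => //; rewrite /W (big_rem (in_tuple w))/=; last by rewrite mem_enum.
  by left; have [_ VC _] := VP (m, w); exact: VC.
Qed.

End Nonvanishing.

(** * From words to random variables *)

Section ProbabilityTransfer.
Context {R : realType} {k : nat} {d : measure_display} {T : measurableType d}.
Variables (P : probability T R) (xi : nat -> T -> 'I_k) (p : 'I_k -> R).
Hypothesis iid : iid_law P xi p.

Definition letters m n (om : T) : seq 'I_k := [seq xi i om | i <- iota m n].

Let cylinder v : measurable [set om | letters 0 (size v) om = v] /\
  P [set om | letters 0 (size v) om = v] = (\prod_(i <- v) p i)%:E.
Proof.
have [mxi law] := iid; split.
  elim/last_ind: v => [|v i IH].
    rewrite (_ : [set _ | _] = setT); first exact: measurableT.
    by apply/seteqP; split.
  rewrite (_ : [set _ | _] = [set om | letters 0 (size v) om = v] `&` [set om | xi (size v) om = i]).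
    by apply: measurableI => //; exact: mxi.
  apply/seteqP; split=> om /=; rewrite /letters size_rcons -addn1 iotaD map_cat /= cats1.
    by move/rcons_inj => [].
  by move=> [-> ->].
rewrite -law; congr (P _); apply/seteqP; split => om /= H.
  move=> i iv; rewrite -[in RHS]H (nth_map 0%N) ?size_iota// nth_iota//.
apply: (@eq_from_nth _ (xi 0%N om)); rewrite size_map size_iota// => i iv.
by rewrite (nth_map 0%N) ?size_iota// nth_iota// add0n H.
Qed.

Let event v n (Q : pred (seq 'I_k)) := [set om | letters 0 (size v) om = v /\
  Q (letters (size v) n om)].

(** Generalised over a prefix [v] already read, so that the induction on [n] reads the next letter
    as [wsum] does. *)
Let eventP n v (Q : pred (seq 'I_k)) : measurable (event v n Q) /\
  P (event v n Q) = ((\prod_(i <- v) p i) * wsum p n (fun w => (Q w)%:R))%:E.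
Proof.
elim: n v Q => [|n IH] v Q.
  rewrite /event /=; case: (boolP (Q [::])) => q0 /=.
    rewrite (_ : [set _ | _] = [set om | letters 0 (size v) om = v]).
      by rewrite mulr1; exact: cylinder.
    by apply/seteqP; split=> om /=; [case|].
  rewrite (_ : [set _ | _] = set0); first by rewrite mulr0 measure0; split => //; exact: measurable0.
  by apply/seteqP; split=> om /=; [case|].
pose F (i : 'I_k) := event (rcons v i) n (fun w => Q (i :: w)).
have E : event v n.+1 Q = \big[setU/set0]_(i < k) F i.
  rewrite -bigcup_seq.
  apply/seteqP; split => om /=.
    move=> [ov oQ]; exists (xi (size v) om); first by rewrite /= mem_index_enum.
    rewrite /F /event /= size_rcons; split; last by [].
    by rewrite /letters -addn1 iotaD map_cat -/(letters 0 (size v) om) ov /= cats1.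
  move=> [i _]; rewrite /F /event /= size_rcons => -[].
  rewrite {1}/letters -addn1 iotaD map_cat /= cats1 addn1 add0n.
  by move/rcons_inj => [ov <-].
have mF i : measurable (F i) by have [] := IH (rcons v i) (fun w => Q (i :: w)).
have tF : trivIset [set: 'I_k] F.
  apply/trivIsetP => i j _ _ ij; apply/seteqP; split => // om [].
  rewrite /F /event /= !size_rcons => -[-> _] [/rcons_inj [] /eqP]; by rewrite (negPf ij).
rewrite E; split.
  by elim/big_ind: _ => //; exact: measurableU.
rewrite measure_bigsetU_ord//= mulr_sumr -sumEFin; apply: eq_bigr => i _.
have [_ ->] := IH (rcons v i) (fun w => Q (i :: w)); congr EFin.
by rewrite -cats1 big_cat big_seq1 /= mulrA.
Qed.

Lemma word_event n (Q : pred (seq 'I_k)) : measurable [set om | Q (letters 0 n om)] /\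
  P [set om | Q (letters 0 n om)] = (wsum p n (fun w => (Q w)%:R))%:E.
Proof.
have [m e] := eventP n [::] Q; rewrite big_nil mul1r in e.
rewrite (_ : [set _ | _] = event [::] n Q)//.
by apply/seteqP; split => om /=; [|case].
Qed.

(** Exponential bounds are summable in [n]; Borel-Cantelli is applied for each tolerance
    [1 / (i + 1)] and the null sets are united. *)
Lemma ae_limit (G : seq 'I_k -> R) (L : R) :
  (forall e, 0 < e -> exists lam K : R, [/\ 0 < lam, 0 <= K & forall n,
     wsum p n (fun w => (e * n%:R < `|G w - n%:R * L|)%R%:R) <= K * expR (- lam * n%:R)]) ->
  {ae P, forall om, (fun n : nat => G (letters 0 n om) / n%:R) @ \oo --> L}.
Proof.
move=> dev; pose F (i n : nat) :=
  [set om | i.+1%:R^-1 * n%:R < `|G (letters 0 n om) - n%:R * L|].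
have mF i n : measurable (F i n).
  by have [] := word_event n (fun w => i.+1%:R^-1 * n%:R < `|G w - n%:R * L|).
have PF i n : P (F i n) = (wsum p n (fun w => (i.+1%:R^-1 * n%:R < `|G w - n%:R * L|)%R%:R))%:E.
  by have [] := word_event n (fun w => i.+1%:R^-1 * n%:R < `|G w - n%:R * L|).
have null i : P (lim_sup_set (F i)) = 0%E.
  apply: lim_sup_set_cvg0 => //.
  have [lam [K [lam0 K0 HK]]] := dev i.+1%:R^-1 ltac:(by rewrite invr_gt0).
  pose r := expR (- lam); have r0 : 0 < r by exact: expR_gt0.
  have r1 : r < 1 by rewrite -expR0 ltr_expR oppr_lt0.
  apply: (@le_lt_trans _ _ (K / (1 - r))%:E); last exact: ltry.
  apply: lime_le; first by apply: is_cvg_nneseries => n _ _; exact: measure_ge0.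
  apply: nearW => n; rewrite (eq_bigr _ (fun j _ => PF i j)) sumEFin lee_fin.
  apply: (@le_trans _ _ (\sum_(0 <= j < n) K * r ^+ j)).
    by apply: ler_sum => j _; apply: le_trans (HK j) _; rewrite /r -expRM_natr.
  rewrite -mulr_sumr ler_wpM2l// -[leRHS]mul1r ler_pdivlMr ?subr_gt0// mulrC.
  by rewrite -opprB mulNr big_mkord -subrX1 opprB gerBl exprn_ge0// ltW.
exists (\bigcup_i lim_sup_set (F i)); split.
- apply: bigcupT_measurable => i; apply: bigcapT_measurable => n.
  by apply: bigcup_measurable => m _.
- apply/eqP; rewrite eq_le measure_ge0 andbT.
  have mL i : measurable (lim_sup_set (F i)).
    apply: bigcapT_measurable => n; by apply: bigcup_measurable => m _.
  have mU : measurable (\bigcup_i lim_sup_set (F i)) by exact: bigcupT_measurable.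
  apply: le_trans (measure_sigma_subadditive P mL mU (@subset_refl _ _)) _.
  by rewrite eseries0 // => i _ _; exact: null.
- move=> om /= nc; apply: contrapT => nF; apply: nc.
  apply/cvgrPdist_le => e e0.
  pose i := Num.truncn e^-1.
  have ie : i.+1%:R^-1 <= e.
    by rewrite invf_ple ?posrE//; exact/ltW/truncnS_gt.
  have : ~ lim_sup_set (F i) om by move=> h; apply: nF; exists i.
  rewrite /lim_sup_set => /existsNP [n /not_implyP [_ nU]].
  exists n.+1 => // m /= nm.
  have m0 : 0 < m%:R :> R by rewrite ltr0n (leq_ltn_trans _ nm).
  have nFm : ~ F i m om by move=> h; apply: nU; exists m => //=; exact: ltnW.
  have h : `|G (letters 0 m om) - m%:R * L| <= i.+1%:R^-1 * m%:R by rewrite leNgt; apply/negP.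
  rewrite distrC (_ : _ / _ - L = (G (letters 0 m om) - m%:R * L) / m%:R); last first.
    by field; rewrite gt_eqF.
  rewrite normrM [`|m%:R^-1|]gtr0_norm ?invr_gt0// ler_pdivrMr//.
  by apply: le_trans h _; rewrite ler_wpM2r// ltW.
Qed.

Lemma cvg_dist_letters (G : seq 'I_k -> R) (L sigma : R) :
  (forall c, (fun n => wsum p n (fun w =>
     ((G w - n%:R * L) / (sigma * Num.sqrt n%:R) <= c)%R%:R)) @ \oo --> Phi c) ->
  cvg_dist_std_normal P (fun n om =>
    (G (letters 0 n om) - n%:R * L) / (sigma * Num.sqrt n%:R)).
Proof.
move=> H c; rewrite (_ : (fun n => _) = (fun n => wsum p n (fun w =>
     ((G w - n%:R * L) / (sigma * Num.sqrt n%:R) <= c)%R%:R)))//.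
apply/funext => n.
by have [_ ->] := word_event n (fun w => (G w - n%:R * L) / (sigma * Num.sqrt n%:R) <= c).
Qed.

End ProbabilityTransfer.

(** * Products with rank-one factors *)

Section RankOne.
Context {R : realType}.
Implicit Types (u v r : 'cV[R]_2) (l : 'rV[R]_2) (M N : 'M[R]_2).

Lemma vnormE v : vnorm v = Num.sqrt (nsq v). Proof. by []. Qed.

Lemma vnormZ c v : vnorm (c *: v) = `|c| * vnorm v.
Proof. by rewrite !vnormE /nsq !mxE !exprMn -mulrDr sqrtrM ?sqr_ge0// sqrtr_sqr. Qed.

Lemma vnorm_gt0 v : (0 < vnorm v) = (v != 0).
Proof. by rewrite vnormE sqrtr_gt0 nsq_gt0. Qed.

Lemma vnorm_mulmx_le M v K : 0 <= K -> (forall (i j : 'I_2), `|M i j| <= K) ->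
  vnorm (M *m v) <= 2 * K * vnorm v.
Proof.
move=> K0 MK; rewrite -[2 * K]ger0_norm ?mulr_ge0// -sqrtr_sqr !vnormE -sqrtrM ?sqr_ge0//.
apply: ler_wsqrtr; rewrite /nsq !mulmx2.
have sq (r c : 'I_2) : M r c ^+ 2 <= K ^+ 2.
  by rewrite -(real_normK (num_real (M r c))) lerXn2r ?nnegrE.
have CS (r : 'I_2) : (M r 0 * v 0 0 + M r 1 * v 1 0) ^+ 2 <= 2 * K ^+ 2 * (v 0 0 ^+ 2 + v 1 0 ^+ 2).
  apply: (@le_trans _ _ ((M r 0 ^+ 2 + M r 1 ^+ 2) * (v 0 0 ^+ 2 + v 1 0 ^+ 2))); last first.
    by rewrite ler_wpM2r ?addr_ge0 ?sqr_ge0//; have := sq r 0; have := sq r 1; lra.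
  rewrite -subr_ge0 (_ : _ - _ = (M r 0 * v 1 0 - M r 1 * v 0 0) ^+ 2) ?sqr_ge0//.
  by ring.
by have := CS 0; have := CS 1; lra.
Qed.

Lemma opnorm_ge M v : vnorm v = 1 -> vnorm (M *m v) <= opnorm M.
Proof.
move=> v1; apply: sup_upper_bound; last by exists v.
split; first by exists (vnorm (M *m v)), v.
pose K := `|M 0 0| + `|M 0 1| + `|M 1 0| + `|M 1 1|.
have MK (r c : 'I_2) : `|M r c| <= K.
  have h := (normr_ge0 (M 0 0), normr_ge0 (M 0 1), normr_ge0 (M 1 0), normr_ge0 (M 1 1)).
  move: h => [[[h1 h2] h3] h4].
  by move: r c; apply: forall_ord2; apply: forall_ord2; rewrite /K; lra.
exists (2 * K) => _ [u /= u1 <-]; have -> : 2 * K = 2 * K * vnorm u by rewrite u1 mulr1.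
by apply: vnorm_mulmx_le => //; exact: le_trans (MK 0 0).
Qed.

Lemma opnorm_le M B : (forall v, vnorm v = 1 -> vnorm (M *m v) <= B) -> opnorm M <= B.
Proof.
move=> MB; apply: ge_sup; last by move=> _ [v /= v1 <-]; exact: MB.
pose e : 'cV[R]_2 := \col_i (if i == 0 then 1 else 0).
exists (vnorm (M *m e)), e => //=.
by rewrite vnormE /nsq !mxE /= expr1n expr0n addr0 sqrtr1.
Qed.

Lemma opnorm_scale M N y : 0 < y ->
  (forall v, vnorm v = 1 -> vnorm (N *m v) = y * vnorm (M *m v)) -> opnorm N = y * opnorm M.
Proof.
move=> y0 NM; apply/eqP; rewrite eq_le; apply/andP; split.
  by apply: opnorm_le => v v1; rewrite NM// ler_pM2l// opnorm_ge.
rewrite mulrC -ler_pdivlMr//; apply: opnorm_le => v v1.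
by rewrite ler_pdivlMr// mulrC -NM// opnorm_ge.
Qed.

Lemma rank1_factor M : \rank M = 1%N ->
  exists r l, [/\ M = r *m l, vnorm r = 1 & l != 0].
Proof.
move=> rk; have [c [l Ml]] : exists (c : 'cV[R]_2) (l : 'rV[R]_2), M = c *m l.
  move: (col_base M) (row_base M) (mulmx_base M); rewrite rk => c l <-.
  by exists c, l.
have M0 : M != 0 by apply/eqP => h; move: rk; rewrite h mxrank0.
have c0 : c != 0 by apply: contraNN M0 => /eqP h; rewrite Ml h mul0mx.
have l0 : l != 0 by apply: contraNN M0 => /eqP h; rewrite Ml h mulmx0.
have n0 : 0 < vnorm c by rewrite vnorm_gt0.
exists ((vnorm c)^-1 *: c), (vnorm c *: l); split.
- by rewrite -scalemxAl -scalemxAr scalerA mulVf ?gt_eqF// scale1r.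
- by rewrite vnormZ gtr0_norm ?invr_gt0// mulVf// gt_eqF.
- by rewrite scaler_eq0 negb_or l0 gt_eqF.
Qed.

Lemma combE m n (x y : R) (M N : 'M[R]_(m, n)) i j :
  (x *: M - y *: N) i j = x * M i j - y * N i j.
Proof. by rewrite !mxE. Qed.

Lemma mulmx11 l v : l *m v = ((l *m v) 0 0)%:M.
Proof. by apply/matrixP => i j; rewrite !ord1 [RHS]mxE eqxx mulr1n. Qed.

Lemma rank1_mul r l v : (r *m l) *m v = (l *m v) 0 0 *: r.
Proof. by rewrite -mulmxA [in LHS]mulmx11 mul_mx_scalar. Qed.

(** If [l' r = 0], the range lies in the kernel, and both are lines, so they coincide. *)
Lemma range_not_in_kernel r l r' l' : \rank (r *m l) = 1%N -> \rank (r' *m l') = 1%N ->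
  ~~ (((r *m l)^T == kermx ((r' *m l')^T))%MS) -> (l' *m r) 0 0 != 0.
Proof.
move=> rk rk'; apply: contraNN => /eqP h.
have sub : ((r *m l)^T <= kermx (r' *m l')^T)%MS.
  apply/sub_kermxP; rewrite -trmx_mul -mulmxA (mulmxA l') (mulmx11 l' r) h.
  by rewrite mul_scalar_mx scale0r mulmx0 trmx0.
have [_ <-] := mxrank_leqif_eq sub.
by rewrite mxrank_ker !mxrank_tr rk rk'.
Qed.

(** Squaring leaves [x0 x2 = x1^2] or [x0 x2 = - x1^2]. In the second case the recurrence gives
    [x1 x3 = q^6 - 2 D q^4], which must be [q^6] or [- q^6]: so [D = 0], or [D = q^2] and then
    [T x0 x1 = 0]. *)
Lemma recurrence_geometric (q D T x0 x1 x2 x3 : R) : 0 < q -> 0 < D -> T != 0 ->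
  x2 = T * x1 - D * x0 -> x3 = T * x2 - D * x1 ->
  `|x0| = q -> `|x1| = q ^+ 2 -> `|x2| = q ^+ 3 -> `|x3| = q ^+ 4 -> x0 * x2 = x1 ^+ 2.
Proof.
move=> q0 D0 T0 E2 E3 h0 h1 h2 h3.
have s0 : x0 ^+ 2 = q ^+ 2 by rewrite -(real_normK (num_real _)) h0.
have s1 : x1 ^+ 2 = q ^+ 4 by rewrite -(real_normK (num_real _)) h1 -exprM.
have s2 : x2 ^+ 2 = q ^+ 6 by rewrite -(real_normK (num_real _)) h2 -exprM.
have s3 : x3 ^+ 2 = q ^+ 8 by rewrite -(real_normK (num_real _)) h3 -exprM.
have qn0 : q != 0 by rewrite gt_eqF.
have : (x0 * x2) ^+ 2 = (q ^+ 4) ^+ 2 by rewrite exprMn s0 s2; ring.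
move/eqP; rewrite eqf_sqr => /orP[/eqP ->|/eqP n02]; first by rewrite s1.
exfalso.
have e1 : T * (x0 * x1) = D * q ^+ 2 - q ^+ 4 by rewrite -n02 E2 -s0; ring.
have e2 : x1 * x2 = - q ^+ 2 * (x0 * x1).
  apply: (mulfI (expf_neq0 2 qn0)); rewrite -{1}s0.
  have -> : x0 ^+ 2 * (x1 * x2) = (x0 * x2) * (x0 * x1) by ring.
  by rewrite n02; ring.
have e3 : x1 * x3 = q ^+ 6 - 2 * D * q ^+ 4.
  rewrite E3 (_ : x1 * _ = T * (x1 * x2) - D * x1 ^+ 2); last by ring.
  rewrite e2 s1; have -> : T * (- q ^+ 2 * (x0 * x1)) = - q ^+ 2 * (T * (x0 * x1)) by ring.
  by rewrite e1; ring.
have : (x1 * x3) ^+ 2 = (q ^+ 6) ^+ 2 by rewrite exprMn s1 s3; ring.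
have p4 : q ^+ 4 != 0 by rewrite expf_neq0.
have p6 : 0 < q ^+ 4 by rewrite exprn_gt0.
move/eqP; rewrite eqf_sqr e3 => /orP[/eqP h|/eqP h].
  have : D * q ^+ 4 = 0 by lra.
  by move/eqP; rewrite mulf_eq0 (gt_eqF D0) (negPf p4).
have : D * q ^+ 4 = q ^+ 2 * q ^+ 4 by move: h; rewrite -exprD; lra.
move/(mulIf p4) => Dq; move: e1; rewrite Dq -exprD subrr => /eqP.
rewrite mulf_eq0 (negPf T0)/= mulf_eq0 => /orP[] /eqP h'.
  by move: h0; rewrite h' normr0 => /esym/eqP; rewrite (negPf qn0).
by move: h1; rewrite h' normr0 => /esym/eqP; rewrite expf_eq0/= (negPf qn0).
Qed.

Definition kerv l : 'cV[R]_2 := \col_i (if i == 0 then - l 0 1 else l 0 0).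
(** The wedge with [r] as a linear form, so that the estimate for [l A_t(w) x] also covers the wedge
    conditions. *)
Definition wedger r : 'rV[R]_2 := \row_i (if i == 0 then - r 1 0 else r 0 0).

Lemma wedgerE r v : (wedger r *m v) 0 0 = wedge r v.
Proof. by rewrite row_mulmx2 !mxE /= /wedge; ring. Qed.

(* [x_n = l M^n r] satisfies the Cayley-Hamilton recurrence.  Were [|x_n|] geometric, [x] itself
   would be, and [x_0 M r - x_1 r] would span an [M]-invariant [ker l]. *)
Lemma orbit_not_geometric M r l q : 0 < \det M -> l != 0 -> 0 < q ->
  wedge r (M *m r) != 0 -> wedge r (M *m (M *m r)) != 0 -> (l *m (M *m kerv l)) 0 0 != 0 ->
  `|(l *m r) 0 0| = q -> `|(l *m (M *m r)) 0 0| = q ^+ 2 ->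
  `|(l *m (M *m (M *m r))) 0 0| = q ^+ 3 ->
  `|(l *m (M *m (M *m (M *m r)))) 0 0| = q ^+ 4 -> False.
Proof.
move=> D0 l0 q0 w1 w2 k1.
pose T := M 0 0 + M 1 1; pose D := \det M.
have CH v : M *m (M *m v) = T *: (M *m v) - D *: v.
  by apply: cV2P; rewrite combE !mulmx2 /D /T det2; ring.
have lin v : (l *m (M *m (M *m v))) 0 0 = T * (l *m (M *m v)) 0 0 - D * (l *m v) 0 0.
  by rewrite CH mulmxBr -!scalemxAr combE.
(* With zero trace, Cayley-Hamilton makes the square of [M] a multiple of the identity, against the
   second wedge condition. *)
have T0 : T != 0.
  apply: contraNN w2 => /eqP T0; rewrite CH T0 scale0r add0r /wedge.
  by rewrite !mxE; apply/eqP; ring.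
move=> h0 h1 h2 h3.
have := recurrence_geometric q0 D0 T0 (lin r) (lin (M *m r)) h0 h1 h2 h3.
set x0 := (l *m r) 0 0; set x1 := (l *m (M *m r)) 0 0; set x2 := (l *m _) 0 0 => geo.
pose u := x0 *: (M *m r) - x1 *: r.
have uE (N : 'M[R]_2) : N *m u = x0 *: (N *m (M *m r)) - x1 *: (N *m r).
  by rewrite mulmxBr -!scalemxAr.
have lu : (l *m u) 0 0 = 0.
  by rewrite mulmxBr -!scalemxAr combE -/x0 -/x1; ring.
have lMu : (l *m (M *m u)) 0 0 = 0.
  by rewrite uE mulmxBr -!scalemxAr combE -/x1 -/x2 geo; ring.
have x00 : x0 != 0 by rewrite -normr_eq0 h0 gt_eqF.
have u0 : wedge r u != 0.
  rewrite (_ : wedge r u = x0 * wedge r (M *m r)) ?mulf_neq0//.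
  by rewrite /wedge /u !combE; ring.
have nl : l 0 0 ^+ 2 + l 0 1 ^+ 2 != 0.
  rewrite paddr_eq0 ?sqr_ge0// !sqrf_eq0; apply: contraNN l0 => /andP[/eqP a0 /eqP a1].
  by apply/eqP/trmx_inj/cV2P; rewrite !mxE.
pose c := - l 0 1 * u 0 0 + l 0 0 * u 1 0.
have uk : (l 0 0 ^+ 2 + l 0 1 ^+ 2) *: u = c *: kerv l.
  have := lu; rewrite row_mulmx2 => lu'.
  have sc (x : R) (v : 'cV[R]_2) i : (x *: v) i 0 = x * v i 0 by rewrite mxE.
  have kE i : kerv l i 0 = if i == 0 then - l 0 1 else l 0 0 by rewrite mxE.
  apply: cV2P; rewrite !sc kE /= /c.
    have -> : (l 0 0 ^+ 2 + l 0 1 ^+ 2) * u 0 0 = l 0 0 * (l 0 0 * u 0 0 + l 0 1 * u 1 0) +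
      (- l 0 1 * u 0 0 + l 0 0 * u 1 0) * - l 0 1 by ring.
    by rewrite lu'; ring.
  have -> : (l 0 0 ^+ 2 + l 0 1 ^+ 2) * u 1 0 = l 0 1 * (l 0 0 * u 0 0 + l 0 1 * u 1 0) +
      (- l 0 1 * u 0 0 + l 0 0 * u 1 0) * l 0 0 by ring.
  by rewrite lu'; ring.
have : (l *m (M *m ((l 0 0 ^+ 2 + l 0 1 ^+ 2) *: u))) 0 0 = 0.
  by rewrite -!scalemxAr [LHS]mxE lMu mulr0.
rewrite uk -!scalemxAr [LHS]mxE => /eqP; rewrite mulf_eq0 (negPf k1) orbF => /eqP c0.
have := uk; rewrite c0 scale0r => /eqP; rewrite scaler_eq0 (negPf nl)/= => /eqP u00.
by move: u0; rewrite u00 /wedge !mxE !mulr0 subrr eqxx.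
Qed.

End RankOne.

(** * Block structure at a good parameter *)

Section FixedParameter.
Context {R : realType} {k : nat}.
Variables (A : R -> 'I_k -> 'M[R]_2) (t : R) (S : {set 'I_k}).
Variables (r : 'I_k -> 'cV[R]_2) (l : 'I_k -> 'rV[R]_2) (K kap b : R).
Local Notation inv := (fun j => j \notin S).
Local Notation W := (word_prod A t).
Hypothesis K_ge1 : 1 <= K.
Hypothesis entry_le : forall i (x y : 'I_2), `|A t i x y| <= K.
Hypothesis kap_le1 : kap <= 1.
Hypothesis kap_lower : forall j v, j \notin S -> kap * nsq v <= nsq (A t j *m v).
Hypothesis factor : forall s, s \in S -> A t s = r s *m l s.
Hypothesis r_unit : forall s, s \in S -> vnorm (r s) = 1.
Hypothesis b_gt0 : 0 < b.
Hypothesis b_kap : b <= kap.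
Hypothesis b_K : b * (2 * K) <= 1.
Hypothesis b_pair : forall s s' w, s \in S -> s' \in S -> all inv w ->
  b ^+ (size w).+1 <= `|(l s' *m (W w *m r s)) 0 0|.

Let b_le1 : b <= 1. Proof. exact: le_trans kap_le1. Qed.
Let K_gt0 : 0 < K. Proof. exact: lt_le_trans K_ge1. Qed.

Lemma word_prod_cat u w : W (u ++ w) = W w *m W u.
Proof.
elim/last_ind: w => [|w j IH]; first by rewrite cats0 /word_prod /= mul1mx.
by rewrite -rcons_cat !word_prod_rcons IH mulmxA.
Qed.

Lemma word_prod1 i : W [:: i] = A t i.
Proof. by rewrite /word_prod /= mulmx1. Qed.

Lemma word_prod_upper u v : vnorm (W u *m v) <= (2 * K) ^+ size u * vnorm v.
Proof.
elim/last_ind: u => [|u i IH]; first by rewrite /word_prod /= mul1mx mul1r.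
rewrite word_prod_rcons -mulmxA size_rcons exprS -mulrA.
apply: le_trans (vnorm_mulmx_le _ (ltW K_gt0) (entry_le i)) _.
by rewrite ler_wpM2l// mulr_ge0// ltW.
Qed.

(** [w] is the invertible stretch read since the last singular letter [s]. An invertible letter of
    [u] joins [w]; a singular letter [i] closes a factor bounded by [b_pair] and restarts from [r i]
    with [w] empty. *)
Lemma word_prod_lower u s w : s \in S -> all inv w ->
  b ^+ (size w + size u).+1 <= vnorm (W u *m (W w *m r s)).
Proof.
elim: u s w => [|i u IH] s w sS wS.
  have low : kap ^+ size w <= nsq (W w *m r s).
    elim/last_ind: w wS => [|w j IHw].
      by rewrite /word_prod/= mul1mx -vnorm_sqr r_unit// expr1n.
    rewrite all_rcons => /andP[jS wS]; rewrite word_prod_rcons -mulmxA size_rcons exprS.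
    apply: le_trans (kap_lower _ jS); rewrite ler_wpM2l ?IHw//.
    exact: le_trans (ltW b_gt0) b_kap.
  rewrite addn0 /word_prod/= mul1mx -/(word_prod A t w).
  have b0 n : 0 <= b ^+ n by rewrite exprn_ge0// ltW.
  rewrite -(ger0_norm (b0 _)) -sqrtr_sqr vnormE; apply: ler_wsqrtr.
  apply: le_trans low; apply: (@le_trans _ _ (b ^+ size w)).
    rewrite -exprM; apply: ler_wiXn2l; rewrite ?(ltW b_gt0)//.
    by rewrite (leq_trans (leqnSn _))// leq_pmulr.
  by rewrite lerXn2r ?nnegrE ?(ltW b_gt0)// (le_trans (ltW b_gt0)).
rewrite -cat1s word_prod_cat word_prod1 -mulmxA.
have [iS|iS] := boolP (i \in S); last first.
  have := IH s (rcons w i) sS; rewrite all_rcons iS wS => /(_ isT).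
  by rewrite word_prod_rcons size_rcons -!mulmxA /= addSn addnS.
rewrite factor// rank1_mul -scalemxAr vnormZ.
have := IH i [::] iS isT; rewrite {2}/word_prod/= mul1mx add0n => low.
rewrite /= addnS -addSn -addnS exprD; apply: ler_pM; rewrite ?exprn_ge0 ?(ltW b_gt0)//.
exact: b_pair.
Qed.

Let C := - ln b.
Let C_ge0 : 0 <= C. Proof. by rewrite oppr_ge0 ln_le0. Qed.

Lemma abs_ln_le x n : b ^+ n <= x -> x <= (2 * K) ^+ n -> `|ln x| <= C * n%:R.
Proof.
move=> xl xu; have x0 : 0 < x by apply: lt_le_trans xl; rewrite exprn_gt0.
have K2 : 0 < 2 * K by rewrite mulr_gt0.
have h1 : ln b *+ n <= ln x by rewrite -lnXn// ler_ln ?posrE ?exprn_gt0.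
have h2 : ln x <= ln (2 * K) *+ n by rewrite -lnXn// ler_ln ?posrE ?exprn_gt0.
have h3 : ln (2 * K) <= C.
  rewrite /C -lnV ?posrE// ler_ln ?posrE ?invr_gt0//.
  by rewrite -[leRHS]mul1r ler_pdivlMr// mulrC.
rewrite ler_norml; apply/andP; split.
  by rewrite /C mulNr opprK mulr_natr.
by apply: le_trans h2 _; rewrite -[leLHS]mulr_natr ler_wpM2r.
Qed.

Variable s0 : 'I_k.
Hypothesis s0S : s0 \in S.

Definition Psi u := ln (vnorm (W u *m r s0)).

Lemma base_lower u : b ^+ (size u).+1 <= vnorm (W u *m r s0).
Proof. by have := @word_prod_lower u s0 [::] s0S isT; rewrite {2}/word_prod/= mul1mx add0n. Qed.

Let base_gt0 u : 0 < vnorm (W u *m r s0).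
Proof. by apply: lt_le_trans (base_lower u); rewrite exprn_gt0. Qed.

Lemma additive_vector v N : vnorm v = 1 ->
  (forall u, b ^+ (N + size u) <= vnorm (W u *m v)) ->
  additive_block s0 Psi (fun u => ln (vnorm (W u *m v))).
Proof.
move=> v1 low; split.
  exists (C * N.+1%:R); first by rewrite mulr_ge0.
  move=> u; apply: (@le_trans _ _ (C * (N + size u)%:R)).
    apply: abs_ln_le => //; apply: le_trans (word_prod_upper u v) _; rewrite v1 mulr1.
    by apply: ler_weXn2l; [have := K_ge1; lra|exact: leq_addl].
  rewrite -mulrA ler_wpM2l// -natrM ler_nat mulSn addnC.
  by rewrite leq_add// ?leqnSn// leq_pmulr.
move=> u w _.
have E : W (rcons u s0) *m v = (l s0 *m (W u *m v)) 0 0 *: r s0.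
  by rewrite word_prod_rcons -mulmxA factor// rank1_mul.
have E2 : W (u ++ s0 :: w) *m v = (l s0 *m (W u *m v)) 0 0 *: (W w *m r s0).
  by rewrite -cat_rcons word_prod_cat -mulmxA E -scalemxAr.
have pos : 0 < vnorm (W (rcons u s0) *m v).
  by apply: lt_le_trans (low _); rewrite exprn_gt0.
by rewrite /Psi -lnM ?posrE ?base_gt0// E2 E !vnormZ r_unit// mulr1.
Qed.

Lemma additive_Psi : additive_block s0 Psi Psi.
Proof.
apply: (additive_vector (N := 1)); first exact: r_unit.
by move=> u; exact: base_lower.
Qed.

(** After [u s0] the product has rank one with range [r s0], so on every vector the rest acts by the
    same factor [vnorm (W w *m r s0)]: the norm splits exactly. *)
Lemma additive_opnorm : additive_block s0 Psi (fun u => ln (opnorm (W u))).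
Proof.
have low u : b ^+ (size u).+1 <= opnorm (W u).
  by apply: le_trans (base_lower u) _; apply: opnorm_ge; exact: r_unit.
split.
  exists C => // u; apply: abs_ln_le => //.
  apply: opnorm_le => v v1; apply: le_trans (word_prod_upper u v) _; rewrite v1 mulr1.
  by apply: ler_weXn2l => //; have := K_ge1; lra.
move=> u w _.
have pos : 0 < opnorm (W (rcons u s0)).
  by apply: lt_le_trans (low _); rewrite exprn_gt0.
rewrite /Psi -lnM ?posrE ?base_gt0// mulrC; congr ln; apply: opnorm_scale => // v v1.
have E : W (rcons u s0) *m v = (l s0 *m (W u *m v)) 0 0 *: r s0.
  by rewrite word_prod_rcons -mulmxA factor// rank1_mul.
by rewrite -cat_rcons word_prod_cat -mulmxA E -scalemxAr !vnormZ r_unit// mulr1 mulrC.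
Qed.

Lemma additive_eta s w x : s \in S -> all inv w -> x != 0 -> (exists y, x = A t s *m y) ->
  let u := W w *m x in additive_block s0 Psi (fun n => ln (vnorm (W n *m ((vnorm u)^-1 *: u)))).
Proof.
move=> sS wS x0 [y xE] u.
pose c := (l s *m y) 0 0.
have xc : x = c *: r s by rewrite xE factor// rank1_mul.
have c0 : c != 0 by apply: contraNN x0 => /eqP h; rewrite xc h scale0r.
have uE : u = c *: (W w *m r s) by rewrite /u xc -scalemxAr.
have low := word_prod_lower [::] sS wS; rewrite {2}/word_prod/= mul1mx addn0 in low.
have ns0 : 0 < vnorm (W w *m r s) by apply: lt_le_trans low; rewrite exprn_gt0.
have u0 : 0 < vnorm u by rewrite uE vnormZ mulr_gt0// normr_gt0.
(* One [size w] is the length of the prefix [w] in the lower bound; the other pays for the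
   normalisation, since [|W w r_s| <= (2 K) ^ |w| <= b ^ (- |w|)]. *)
apply: (additive_vector (N := (size w + size w).+1)).
  by rewrite vnormZ gtr0_norm ?invr_gt0// mulVf// gt_eqF.
move=> n; rewrite -scalemxAr vnormZ gtr0_norm ?invr_gt0//.
rewrite mulrC ler_pdivlMr// uE -scalemxAr !vnormZ mulrCA ler_wpM2l//.
apply: le_trans (word_prod_lower n sS wS).
have up := word_prod_upper w (r s); rewrite r_unit// mulr1 in up.
apply: le_trans (ler_wpM2l _ up) _; first by rewrite exprn_ge0// ltW.
rewrite addSn -addnA -addnS exprD mulrAC -exprMn.
rewrite ler_piMl ?exprn_ge0 ?(ltW b_gt0)// exprn_ile1//.
by rewrite !mulr_ge0// ltW.
Qed.

Lemma Psi_nondegenerate j0 : j0 \notin S -> 0 < \det (A t j0) -> l s0 != 0 ->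
  wedge (r s0) (A t j0 *m r s0) != 0 ->
  wedge (r s0) (A t j0 *m (A t j0 *m r s0)) != 0 ->
  (l s0 *m (A t j0 *m kerv (l s0))) 0 0 != 0 ->
  forall L, exists2 u, s0 \notin u & Psi (rcons u s0) != L * (size u).+1%:R.
Proof.
move=> j0S D0 l0 w1 w2 k1 L; apply: contrapT => none.
have H n : `|(l s0 *m (W (nseq n j0) *m r s0)) 0 0| = expR L ^+ n.+1.
  have E : Psi (rcons (nseq n j0) s0) = L * n.+1%:R.
    apply/eqP; apply: contraT => h; exfalso; apply: none; exists (nseq n j0).
      by rewrite mem_nseq negb_and; apply/orP; right; apply: contraNN j0S => /eqP <-.
    by rewrite size_nseq.
  rewrite -expRM_natr -E /Psi lnK ?posrE//.
  by rewrite word_prod_rcons -mulmxA factor// rank1_mul vnormZ r_unit// mulr1.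
have W0 n : W (nseq n.+1 j0) = A t j0 *m W (nseq n j0).
  by rewrite -word_prod_rcons -[nseq n.+1 j0]/(j0 :: nseq n j0); congr W; elim: n => //= n ->.
have WN : W (nseq 0 j0) = 1%:M by [].
refine (orbit_not_geometric D0 l0 (expR_gt0 L) w1 w2 k1 _ _ _ _).
- by have := H 0%N; rewrite WN mul1mx.
- by have := H 1%N; rewrite W0 WN mulmx1.
- by have := H 2%N; rewrite !W0 WN mulmx1 -!mulmxA.
- by have := H 3%N; rewrite !W0 WN mulmx1 -!mulmxA.
Qed.

End FixedParameter.

(** * Almost sure choice of the parameter *)

Section ParameterSelection.
Context {R : realType} {k : nat}.
Variables (A : R -> 'I_k -> 'M[R]_2) (a c0 : R) (S : {set 'I_k}).
Hypothesis smoothA : smooth_family A a.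
Hypothesis det_gt0 : forall t j, a <= t <= a + 1 -> j \notin S -> 0 < \det (A t j).
Hypothesis c0_gt0 : 0 < c0.
Hypothesis twist : forall t j (v : 'cV[R]_2), a <= t <= a + 1 -> j \notin S -> v != 0 ->
  c0 <= wedge (A t j *m v) (dA A t j *m v) / vnorm (A t j *m v) ^+ 2.
Local Notation inv := (fun j => j \notin S).
Local Notation mu := (@lebesgue_measure R).
Local Notation W t := (word_prod A t).

(** The rotation estimate handles nonempty words; the hypothesis handles the empty one. Taking [b]
    below [eta], [beta] and [|l x|] merges the three constants, at the price of the exponent
    [size w + 1]. *)
Lemma ae_exponential_lower (l : 'rV[R]_2) (x : 'cV[R]_2) : (l *m x) 0 0 != 0 ->
  {ae mu, forall t, a <= t <= a + 1 -> exists2 b, 0 < b <= 1 &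
    forall w, all inv w -> b ^+ (size w).+1 <= `|(l *m (W t w *m x)) 0 0| }.
Proof.
move=> lx; have l0 : l != 0 by apply: contraNN lx => /eqP ->; rewrite mul0mx mxE.
have x0 : x != 0 by apply: contraNN lx => /eqP ->; rewrite mulmx0 mxE.
have [beta /andP[b0 b1] H] := ae_nonvanishing smoothA det_gt0 c0_gt0 twist l0 x0.
have F := ae_filter_ringOfSetsType mu.
apply: filterS H => t H tL; have [eta e0 HE] := H tL.
pose b := Num.min (Num.min eta beta) `|(l *m x) 0 0|.
have bp : 0 < b by rewrite !lt_min e0 b0 normr_gt0.
have bb : b <= beta by rewrite !ge_min lexx orbT.
have be : b <= eta by rewrite !ge_min lexx.
exists b; first by rewrite bp (le_trans bb).
move=> [|i w] wS; first by rewrite expr1 /word_prod/= mul1mx ge_min lexx orbT.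
apply: le_trans (HE _ _ wS) => //; rewrite exprS.
apply: ler_pM; [exact: ltW|by rewrite exprn_ge0// ltW|exact: be|].
by apply: lerXn2r; rewrite ?nnegrE ?(ltW bp) ?(ltW b0).
Qed.

Lemma ae_word_nonzero (l : 'rV[R]_2) (x : 'cV[R]_2) w : l != 0 -> x != 0 ->
  w != [::] -> all inv w ->
  {ae mu, forall t, a <= t <= a + 1 -> (l *m (W t w *m x)) 0 0 != 0}.
Proof.
move=> l0 x0 wn wS.
have [beta /andP[b0 b1] H] := ae_nonvanishing smoothA det_gt0 c0_gt0 twist l0 x0.
have F := ae_filter_ringOfSetsType mu.
apply: filterS H => t H tL; have [eta e0 HE] := H tL.
rewrite -normr_gt0; apply: lt_le_trans (HE _ wn wS).
by rewrite mulr_gt0// exprn_gt0.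
Qed.

End ParameterSelection.

Theorem theorem3p2 (R : realType) (k : nat) (sing : {set 'I_k})
    (p : 'I_k -> R) (A : R -> 'I_k -> 'M[R]_2) (a c0 : R) :
  sing != finset.set0 -> ~: sing != finset.set0 ->
  (forall i, 0 < p i) -> \sum_i p i = 1 ->
  smooth_family A a ->
  (forall t, a <= t <= a + 1 -> in_Mstar sing (A t)) ->
  (* (A1) *)
  (forall i t, i \in sing -> a <= t <= a + 1 -> A t i = A a i) ->
  (* (A2) *)
  0 < c0 ->
  (forall t j (v : 'cV[R]_2), a <= t <= a + 1 -> j \notin sing -> v != 0 ->
     c0 <= wedge (A t j *m v) (dA A t j *m v) / vnorm (A t j *m v) ^+ 2) ->
  forall (d : measure_display) (Omega : measurableType d)
         (P : probability Omega R) (xi : nat -> Omega -> 'I_k),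
  iid_law P xi p ->
  {ae lebesgue_measure, forall t : R, a <= t <= a + 1 ->
    exists2 sigma : R, 0 < sigma &
    exists L : R,
      (* L = L_1(A_t), the mu-a.e. limit of (1/n) log ||A_t^n|| *)
      {ae P, forall om,
         (fun n : nat => ln (opnorm (rand_prod A t xi n om)) / n%:R) @ \oo --> L}
      /\
      (* CLT for eta_t-a.e. direction: the atoms of eta_t are the directions
         A_t^n(w) r_s, s singular, w a word over the invertible letters *)
      (forall (s : 'I_k) (w : seq 'I_k) (r : 'cV[R]_2),
         s \in sing -> all (fun j => j \notin sing) w ->
         r != 0 -> (exists x : 'cV[R]_2, r = A t s *m x) ->
         let u := word_prod A t w *m r in
         let v := (vnorm u)^-1 *: u in
         cvg_dist_std_normal P (fun (n : nat) om =>
           (ln (vnorm (rand_prod A t xi n om *m v)) - n%:R * L)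
             / (sigma * Num.sqrt n%:R)))
      /\
      cvg_dist_std_normal P (fun (n : nat) om =>
           (ln (opnorm (rand_prod A t xi n om)) - n%:R * L)
             / (sigma * Num.sqrt n%:R))}.
Proof.
move=> sing0 inv0 p_gt0 p_sum1 smoothA Mstar A1 c0_gt0 twist d Omega P xi iid.
have det_gt0 t j : a <= t <= a + 1 -> j \notin sing -> 0 < \det (A t j).
  by move=> /Mstar [_ + _]; apply.
have aL : a <= a <= a + 1 by rewrite lexx lerDl ler01.
have [s0 s0S] := set0Pn _ sing0.
have [j0] := set0Pn _ inv0; rewrite inE => j0S.
have [rk _ trans] := Mstar a aL.
(* Factored once, at [t = a]: by (A1) the same [r] and [l] serve every parameter, and the measure
   estimates require them to be independent of [t]. *)
have /choice [rl rlP] : forall i, exists rl : 'cV[R]_2 * 'rV[R]_2, i \in sing ->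
    [/\ A a i = rl.1 *m rl.2, vnorm rl.1 = 1 & rl.2 != 0].
  move=> i; have [iS|] := boolP (i \in sing); last by exists (0, 0).
  by have [r [l H]] := rank1_factor (rk i iS); exists (r, l).
pose r i := (rl i).1; pose l i := (rl i).2.
have facA i : i \in sing -> A a i = r i *m l i by move=> /rlP [].
have r_unit i : i \in sing -> vnorm (r i) = 1 by move=> /rlP [].
have l_neq0 i : i \in sing -> l i != 0 by move=> /rlP [].
have r_neq0 i : i \in sing -> r i != 0 by move=> iS; rewrite -vnorm_gt0 r_unit.
have F := ae_filter_ringOfSetsType (@lebesgue_measure R).
have pairs : {ae lebesgue_measure, forall t : R, forall ij : 'I_k * 'I_k, a <= t <= a + 1 ->
    ij.1 \in sing -> ij.2 \in sing -> exists2 b, 0 < b <= 1 &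
    forall w, all (fun j => j \notin sing) w ->
      b ^+ (size w).+1 <= `|(l ij.2 *m (word_prod A t w *m r ij.1)) 0 0| }.
  apply: filter_forall => -[i j] /=.
  have [iS|iS] := boolP (i \in sing); last by apply: nearW.
  have [jS|jS] := boolP (j \in sing); last by apply: nearW.
  have lr : (l j *m r i) 0 0 != 0.
    have tr := trans i j iS jS; have ri := rk i iS; have rj := rk j jS.
    rewrite (facA i iS) in tr ri; rewrite (facA j jS) in tr rj.
    exact: range_not_in_kernel ri rj tr.
  by apply: filterS (ae_exponential_lower smoothA det_gt0 c0_gt0 twist lr) => t H tL _ _; exact: H.
have [K K1 KP] := bounded_entries smoothA.
have [kap /andP[kap0 kap1] kapP] := nsq_lower_bound smoothA det_gt0.
have wr0 : wedger (r s0) != 0.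
  apply: contraNN (r_neq0 _ s0S) => /eqP/matrixP h; apply/eqP/cV2P.
    by have := h 0 1; rewrite !mxE.
  by have := h 0 0; rewrite !mxE => /eqP; rewrite oppr_eq0 => /eqP.
have kl0 : kerv (l s0) != 0.
  apply: contraNN (l_neq0 _ s0S) => /eqP/matrixP h; apply/eqP/trmx_inj/cV2P.
    by have := h 1 0; rewrite !mxE.
  by have := h 0 0; rewrite !mxE => /eqP; rewrite oppr_eq0 => /eqP.
have jS1 : all (fun j => j \notin sing) [:: j0] by rewrite /= j0S.
have jS2 : all (fun j => j \notin sing) [:: j0; j0] by rewrite /= j0S.
have nz := ae_word_nonzero smoothA det_gt0 c0_gt0 twist.
have n1 := nz _ _ [:: j0] wr0 (r_neq0 _ s0S) isT jS1.
have n2 := nz _ _ [:: j0; j0] wr0 (r_neq0 _ s0S) isT jS2.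
have n3 := nz _ _ [:: j0] (l_neq0 _ s0S) kl0 isT jS1.
apply: filterS (filterI pairs (filterI n1 (filterI n2 n3))) => t [Hp [H1 [H2 H3]]] tL.
have {}H1 := H1 tL; have {}H2 := H2 tL; have {}H3 := H3 tL.
have W2 : word_prod A t [:: j0; j0] = A t j0 *m A t j0 by rewrite /word_prod /= mulmx1.
rewrite wedgerE word_prod1 in H1; rewrite wedgerE W2 -mulmxA in H2; rewrite word_prod1 in H3.
have /choice [bp bpP] : forall ij : 'I_k * 'I_k, exists b : R, 0 < b /\
    (ij.1 \in sing -> ij.2 \in sing -> forall w, all (fun j => j \notin sing) w ->
      b ^+ (size w).+1 <= `|(l ij.2 *m (word_prod A t w *m r ij.1)) 0 0|).
  move=> ij; have [iS|iS] := boolP (ij.1 \in sing); last by exists 1.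
  have [jS|jS] := boolP (ij.2 \in sing); last by exists 1.
  by have [b /andP[b0 _] hb] := Hp ij tL iS jS; exists b.
(* One constant below the contraction of invertible letters, the inverse growth bound and all
   finitely many pair constants. *)
pose b := Num.min (Num.min kap (2 * K)^-1) (\big[Num.min/1]_ij bp ij).
have K0 : 0 < 2 * K by rewrite mulr_gt0// (lt_le_trans ltr01).
have b0 : 0 < b.
  rewrite !lt_min kap0 invr_gt0 K0 /=.
  by elim/big_ind: _ => // [x y x0 y0|ij _]; [rewrite lt_min x0|have [] := bpP ij].
have b_kap : b <= kap by rewrite !ge_min lexx.
have b_K : b * (2 * K) <= 1 by rewrite -ler_pdivlMr// mul1r !ge_min lexx orbT.
have b_pair i j w : i \in sing -> j \in sing -> all (fun j => j \notin sing) w ->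
    b ^+ (size w).+1 <= `|(l j *m (word_prod A t w *m r i)) 0 0|.
  move=> iS jS wS; have [bp0 hb] := bpP (i, j).
  apply: le_trans (hb iS jS w wS); apply: lerXn2r; rewrite ?nnegrE ?(ltW b0) ?(ltW bp0)//.
  by rewrite /b (bigD1 (i, j))//= !ge_min lexx !orbT.
have entry_le i (x y : 'I_2) : `|A t i x y| <= K by have [] := KP t i x y tL.
have kap_lower j v : j \notin sing -> kap * nsq v <= nsq (A t j *m v) by exact: kapP.
have factor i : i \in sing -> A t i = r i *m l i by move=> iS; rewrite A1// facA.
have [[C C0 PsiC] Psi_add] := additive_Psi K1 entry_le kap1 kap_lower factor r_unit b0 b_kap
  b_K b_pair s0S.
have nd := Psi_nondegenerate kap1 kap_lower factor r_unit b0 b_kap b_pair s0S j0S (det_gt0 t j0 tL j0S) (l_neq0 _ s0S) H1 H2 H3.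
have [sigma sigma0 [L HL]] := word_limit_theorems p_gt0 p_sum1 Psi_add C0 PsiC nd.
exists sigma => //; exists L.
have op := additive_opnorm K1 entry_le kap1 kap_lower factor r_unit b0 b_kap b_K b_pair s0S.
have [op_clt op_dev] := HL _ op.
split; first exact: (ae_limit iid op_dev).
split; last exact: (cvg_dist_letters iid op_clt).
move=> s w x sS wS x0 xr u v.
have := additive_eta K1 entry_le kap1 kap_lower factor r_unit b0 b_kap b_K b_pair s0S sS wS x0 xr.
move=> /HL [v_clt _]; exact: (cvg_dist_letters iid v_clt).
Qed.
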